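(* Let $Q_1,Q_2\in L^1([0,1];\mathbb C^{n\times n})$ and let $C_j,D_j\in\mathbb C^{n\times n}$ satisfy $\operatorname{rank}\begin{pmatrix}C_j&D_j\end{pmatrix}=n$, $j\in\{1,2\}$. For every $\lambda\in\rho(L_{C_1,D_1}(Q_1))\cap\rho(L_{C_2,D_2}(Q_2))$, $$(L_{C_1,D_1}(Q_1)-\lambda)^{-1}-(L_{C_2,D_2}(Q_2)-\lambda)^{-1}\in\mathfrak S_1(L^2([0,1];\mathbb C^n)).$$ Moreover, the following trace formula holds: $$\operatorname{tr}\bigl((L_{C_1,D_1}(Q_1)-\lambda)^{-1}-(L_{C_2,D_2}(Q_2)-\lambda)^{-1}\bigr)=\operatorname{tr}\int_0^1\Bigl(\Phi_1(x,\lambda)(C_1+D_1\Phi_1(1,\lambda))^{-1}C_1\Phi_1^{-1}(x,\lambda)-\Phi_2(x,\lambda)(C_2+D_2\Phi_2(1,\lambda))^{-1}C_2\Phi_2^{-1}(x,\lambda)\Bigr)iB\,dx,$$ where $\Phi_j(\cdot,\lambda)$ is the fundamental $n\times n$ matrix solution of the equation $-iB^{-1}y'+Q_j(x)y=\lambda y$ satisfying $\Phi_j(0,\lambda)=I_n$, $j\in\{1,2\}$.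
   Context: $B=\operatorname{diag}(b_1,\dots,b_n)\in\mathbb C^{n\times n}$ is a fixed nonsingular matrix. For $Q\in L^1([0,1];\mathbb C^{n\times n})$ and $C,D\in\mathbb C^{n\times n}$ with $\operatorname{rank}\begin{pmatrix}C&D\end{pmatrix}=n$, the operator $L_{C,D}(Q)$ acts in $L^2([0,1];\mathbb C^n)$ by $y\mapsto -iB^{-1}y'+Q(x)y$ on the domain $\{y\in W^{1,1}([0,1];\mathbb C^n): -iB^{-1}y'+Qy\in L^2([0,1];\mathbb C^n),\ Cy(0)+Dy(1)=0\}$. $\rho(\cdot)$ denotes the resolvent set and $\mathfrak S_1$ the trace class. *)

(* Defs.v *)
From HB Require Import structures.
From mathcomp Require Import all_boot all_order all_algebra.
From mathcomp Require Import all_classical all_reals all_analysis.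
From mathcomp Require Import complex.

Set Implicit Arguments.
Unset Strict Implicit.
Unset Printing Implicit Defensive.

Import Order.TTheory GRing.Theory Num.Theory.
Import numFieldNormedType.Exports.

Local Open Scope classical_set_scope.
Local Open Scope ring_scope.
Local Open Scope complex_scope.

Local Notation Re := complex.Re.
Local Notation Im := complex.Im.

Definition I01 (R : realType) : set R := `[0, 1].
Arguments I01 : clear implicits.

Section ComplexLebesgue.
Context {R : realType}.
Local Notation C := R[i].
Local Notation mu := (@lebesgue_measure R).
Local Notation I01 := (I01 R).

(* f restricted to [0, 1] is in L^p; values of f outside [0, 1] are ignored *)
Definition cLfun (p : \bar R) (f : R -> C) : Prop :=
  (fun x => Re (f x)) \_ I01 \in Lfun mu p /\
  (fun x => Im (f x)) \_ I01 \in Lfun mu p.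

Definition cintegral (D : set R) (f : R -> C) : C :=
  (\int[mu]_(x in D) Re (f x)) +i* (\int[mu]_(x in D) Im (f x)).

Definition mxLfun (p : \bar R) m n (F : R -> 'M[C]_(m, n)) : Prop :=
  forall i j, cLfun p (fun x => F x i j).

Definition mxintegral m n (D : set R) (F : R -> 'M[C]_(m, n)) : 'M[C]_(m, n) :=
  \matrix_(i, j) cintegral D (fun x => F x i j).

Let ReZ (a z : C) : Re (a * z) = Re a * Re z - Im a * Im z.
Proof. by case: a z => [? ?] []. Qed.
Let ImZ (a z : C) : Im (a * z) = Re a * Im z + Im a * Re z.
Proof. by case: a z => [? ?] []. Qed.
Let ReD (a z : C) : Re (a + z) = Re a + Re z.
Proof. by case: a z => [? ?] []. Qed.
Let ImD (a z : C) : Im (a + z) = Im a + Im z.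
Proof. by case: a z => [? ?] []. Qed.

Let restrict_lin (a b : R) (f g : R -> R) :
  (fun x => a * f x + b * g x) \_ I01 = a *: (f \_ I01) + b *: (g \_ I01).
Proof.
apply/funext => x; rewrite /patch; rewrite !fctE /=.
case: ifPn => _; first by [].
by rewrite /point /= !scaler0 addr0.
Qed.

Let Lfun_lin (p : \bar R) (p1 : (1 <= p)%E) (a b : R) (f g : R -> R) :
  f \_ I01 \in Lfun mu p -> g \_ I01 \in Lfun mu p ->
  (fun x => a * f x + b * g x) \_ I01 \in Lfun mu p.
Proof.
move=> fp gp; rewrite restrict_lin.
have sc := @Lfun_submod_closed _ _ _ mu p p1.
have [L0 LZD] := sc.
have bg : b *: (g \_ I01) \in Lfun mu p by rewrite -[X in X \in _]addr0; exact: LZD.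
exact: LZD.
Qed.

Lemma cLfun0 p : (1 <= p)%E -> cLfun p (fun=> 0).
Proof.
move=> p1.
have [L0 _] := @Lfun_submod_closed _ _ _ mu p p1.
by split; rewrite (_ : _ \_ _ = 0)//; apply/funext => x; rewrite patchE if_same.
Qed.

Let Lfun_ext (p : \bar R) (f g : R -> R) :
  f =1 g -> f \_ I01 \in Lfun mu p -> g \_ I01 \in Lfun mu p.
Proof. by move=> /funext ->. Qed.

Lemma cLfun_ext p f g : f =1 g -> cLfun p f -> cLfun p g.
Proof. by move=> /funext ->. Qed.

Lemma cLfunZD p (a : C) f g : (1 <= p)%E -> cLfun p f -> cLfun p g ->
  cLfun p (fun x => a * f x + g x).
Proof.
move=> p1 [fR fI] [gR gI]; split.
  apply: Lfun_ext (Lfun_lin p1 1 1 (Lfun_lin p1 (Re a) (- Im a) fR fI) gR) => x.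
  by rewrite ReD ReZ !mul1r mulNr.
apply: Lfun_ext (Lfun_lin p1 1 1 (Lfun_lin p1 (Re a) (Im a) fI fR) gI) => x.
by rewrite ImD ImZ !mul1r.
Qed.

Lemma cLfun_conj p f : (1 <= p)%E -> cLfun p f -> cLfun p (fun x => (f x)^*%C).
Proof.
move=> p1 [fR fI]; split; first by apply: Lfun_ext fR => x; case: (f x).
apply: Lfun_ext (Lfun_lin p1 (-1) 0 fI fI) => x.
by rewrite mul0r addr0 mulN1r; case: (f x).
Qed.

Let restrictM (f g : R -> R) :
  (fun x => f x * g x) \_ I01 = (f \_ I01) \* (g \_ I01).
Proof.
by apply/funext => x; rewrite /= !patchE; case: ifPn => // _; rewrite mulr0.
Qed.

Lemma cLfunM f g : cLfun 2%:E f -> cLfun 2%:E g -> cLfun 1 (fun x => f x * g x).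
Proof.
move=> [fR fI] [gR gI].
have M (u v : R -> R) : u \_ I01 \in Lfun mu 2%:E -> v \_ I01 \in Lfun mu 2%:E ->
    (fun x => u x * v x) \_ I01 \in Lfun mu 1.
  by move=> u2 v2; rewrite restrictM; exact: Lfun2_mul_Lfun1.
split.
  apply: Lfun_ext (Lfun_lin (lexx _) 1 (-1) (M _ _ fR gR) (M _ _ fI gI)) => x.
  by rewrite ReZ mul1r mulN1r.
apply: Lfun_ext (Lfun_lin (lexx _) 1 1 (M _ _ fR gI) (M _ _ fI gR)) => x.
by rewrite ImZ !mul1r.
Qed.

Let mI : (R.-ocitv.-measurable).-sigma.-measurable I01.
Proof. exact: measurable_itv. Qed.

Let LfunI (f : R -> R) :
  f \_ I01 \in Lfun mu 1 -> mu.-integrable I01 (EFin \o f).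
Proof.
move=> /Lfun1_integrable; rewrite -restrict_EFin => fi.
by apply/integrable_mkcond.
Qed.

Let Rint_lin (a b : R) (f g : R -> R) :
  f \_ I01 \in Lfun mu 1 -> g \_ I01 \in Lfun mu 1 ->
  \int[mu]_(x in I01) (a * f x + b * g x) =
  a * \int[mu]_(x in I01) f x + b * \int[mu]_(x in I01) g x.
Proof.
move=> /LfunI fi /LfunI gi.
rewrite RintegralD ?RintegralZl//.
  exact: (integrableZl mI a fi).
exact: (integrableZl mI b gi).
Qed.

Lemma cintegralZD (a : C) f g : cLfun 1 f -> cLfun 1 g ->
  cintegral I01 (fun x => a * f x + g x) = a * cintegral I01 f + cintegral I01 g.
Proof.
move=> [fR fI] [gR gI]; rewrite /cintegral; apply/eqP; rewrite eq_complex.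
have p1 : (1 <= 1 :> \bar R)%E by [].
apply/andP; split; apply/eqP.
  rewrite ReD ReZ/=.
  under eq_Rintegral do rewrite ReD ReZ -[Re (g _)]mul1r -mulNr.
  have F := Lfun_lin p1 (Re a) (- Im a) fR fI.
  under eq_Rintegral do rewrite -[_ * Re (f _) + _]mul1r.
  by rewrite (Rint_lin 1 1 F gR) Rint_lin// !mul1r mulNr.
rewrite ImD ImZ/=.
under eq_Rintegral do rewrite ImD ImZ -[Im (g _)]mul1r.
have F := Lfun_lin p1 (Re a) (Im a) fI fR.
under eq_Rintegral do rewrite -[_ * Im (f _) + _]mul1r.
by rewrite (Rint_lin 1 1 F gI) Rint_lin// !mul1r.
Qed.

Lemma cLfun_sum p (I : Type) (r : seq I) (F : I -> R -> C) : (1 <= p)%E ->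
  (forall i, cLfun p (F i)) -> cLfun p (fun x => \sum_(i <- r) F i x).
Proof.
move=> p1 Fp; elim: r => [|i r IH].
  by apply: cLfun_ext (cLfun0 p1) => x; rewrite big_nil.
by apply: cLfun_ext (cLfunZD 1 p1 (Fp i) IH) => x; rewrite big_cons mul1r.
Qed.

Lemma cintegral_conj f : cLfun 1 f ->
  cintegral I01 (fun x => (f x)^*%C) = (cintegral I01 f)^*%C.
Proof.
move=> [fR fI]; rewrite /cintegral /=; congr (_ +i* _).
  by apply: eq_Rintegral => x _; case: (f x).
rewrite -mulN1r -(RintegralZl _ mI (LfunI fI)).
by apply: eq_Rintegral => x _; case: (f x) => a b /=; rewrite mulN1r.
Qed.

Let Rint_eq0 (f : R -> R) : {ae mu, forall x, I01 x -> f x = 0} ->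
  f \_ I01 \in Lfun mu 1 -> \int[mu]_(x in I01) f x = 0.
Proof.
move=> f0 /LfunI fi; rewrite /Rintegral.
rewrite (@ae_eq_integral _ _ _ mu I01 (cst 0%E) _ mI (measurable_int _ fi)).
  by rewrite integral0.
  exact: measurable_cst.
apply: (@filterS _ _ (ae_filter_ringOfSetsType mu) _ _ _ f0) => x /= fx x01.
by rewrite fx.
Qed.

Lemma cintegral_ae0 f : cLfun 1 f -> {ae mu, forall x, I01 x -> f x = 0} ->
  cintegral I01 f = 0.
Proof.
move=> [fR fI] f0; rewrite /cintegral !Rint_eq0//;
  apply: (@filterS _ _ (ae_filter_ringOfSetsType mu) _ _ _ f0) => x fx x01;
  by rewrite fx.
Qed.

Lemma cintegral_gt0 f : cLfun 1 f -> (forall x, 0 <= f x) ->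
  ~ {ae mu, forall x, I01 x -> f x = 0} -> 0 < cintegral I01 f.
Proof.
move=> [fR fI] f0 fn0.
have [Rf0 If0] : (forall x, 0 <= Re (f x)) /\ (forall x, Im (f x) = 0).
  by split=> x; have := f0 x; rewrite lecE => /andP[/eqP ? ?].
rewrite ltcE /= (_ : \int[mu]_(x in I01) Im _ = 0) ?eqxx/=; last first.
  by apply: Rint_eq0 => //; apply: aeW => x _.
rewrite lt_neqAle Rintegral_ge0// andbT; apply/eqP => /esym i0.
apply: fn0; have fi := LfunI fR.
have [+ _] := ae_eq_integral_abs mu mI (measurable_int _ fi).
have i0' : (\int[mu]_(x in I01) `|(EFin \o (fun y => Re (f y))) x|)%E = 0%E.
  under eq_integral do rewrite /= ger0_norm//.
  rewrite -[LHS]fineK; first by rewrite -/(Rintegral _ _ _) i0.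
  exact: integrable_fin_num.
move=> /(_ i0'); apply: (@filterS _ _ (ae_filter_ringOfSetsType mu)) => x /= fx x01.
have [{}fx] := fx x01.
by apply/eqP; rewrite eq_complex/= fx If0 !eqxx.
Qed.

End ComplexLebesgue.
Local Open Scope quotient_scope.

Section L2Space.
Context {R : realType}.
Local Notation C := R[i].
Local Notation mu := (@lebesgue_measure R).
Local Notation I01 := (I01 R).
Variable n : nat.

Let two1 : (1 <= 2%:E :> \bar R)%E. Proof. by rewrite lee_fin ler1n. Qed.

Definition L2pred : {pred R -> 'cV[C]_n} := fun f => `[< mxLfun 2%:E f >].

Lemma L2pred_submod : submod_closed L2pred.
Proof.
split=> [|a f g /asboolP f2 /asboolP g2]; apply/asboolP => i j.
  by apply: cLfun_ext (cLfun0 two1) => x; rewrite /= mxE.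
by apply: cLfun_ext (cLfunZD a two1 (f2 i j) (g2 i j)) => x; rewrite !mxE.
Qed.

HB.instance Definition _ :=
  GRing.isSubmodClosed.Build C (R -> 'cV[C]_n) L2pred L2pred_submod.

Record L2fun := MkL2fun { L2fun_val :> R -> 'cV[C]_n; _ : L2fun_val \in L2pred }.

HB.instance Definition _ := [isSub for L2fun_val].
HB.instance Definition _ := [Choice of L2fun by <:].
HB.instance Definition _ := [SubChoice_isSubLmodule of L2fun by <:].

Definition L2null : {pred L2fun} :=
  fun f => `[< {ae mu, forall x, I01 x -> f x = 0} >].

Lemma L2null_submod : submod_closed L2null.
Proof.
split=> [|a f g /asboolP f0 /asboolP g0]; apply/asboolP.
  by apply: aeW => x _.
apply: (@filterS2 _ _ (ae_filter_ringOfSetsType mu) _ _ _ _ f0 g0) => x fx gx x01.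
by rewrite /= !fctE (fx x01) (gx x01) scaler0 addr0.
Qed.

HB.instance Definition _ :=
  GRing.isSubmodClosed.Build C L2fun L2null L2null_submod.

Definition L2 : Type := Quotient.quot L2null.
HB.instance Definition _ := Choice.on L2.
HB.instance Definition _ := EqQuotient.on L2.
HB.instance Definition _ := GRing.Zmodule.on L2.

Definition L2pi (f : L2fun) : L2 := \pi f.
Definition L2repr (u : L2) : L2fun := repr u.

Let L2reprK u : L2pi (L2repr u) = u.
Proof. exact: reprK. Qed.

Lemma L2piP (f g : L2fun) :
  L2pi f = L2pi g <-> {ae mu, forall x, I01 x -> f x = g x}.
Proof.
have -> : (L2pi f = L2pi g) <-> (f - g \in L2null).
  by rewrite Quotient.idealrBE; split=> [/eqP|/eqP].
have FF := ae_filter_ringOfSetsType mu.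
split=> [/asboolP|] fg; [|apply/asboolP]; apply: (@filterS _ _ FF _ _ _ fg) => x /= + x01.
  by move=> /(_ x01) /eqP; rewrite subr_eq0 => /eqP.
by move=> /(_ x01); rewrite !fctE => ->; rewrite subrr.
Qed.

Lemma L2piD (f g : L2fun) : L2pi (f + g) = L2pi f + L2pi g.
Proof. exact (@pi_addr _ _ _ _ _ (Quotient.quot L2null) f g). Qed.

Definition L2scale (a : C) (u : L2) : L2 := L2pi (a *: L2repr u).

Let L2pi_scale (a : C) (f : L2fun) : L2pi (a *: f) = L2scale a (L2pi f).
Proof.
apply/L2piP; have /L2piP := esym (L2reprK (L2pi f)).
apply: (@filterS _ _ (ae_filter_ringOfSetsType mu)) => x /= fx x01.
by rewrite !fctE fx.
Qed.

Let L2scaleA a b u : L2scale a (L2scale b u) = L2scale (a * b) u.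
Proof. by rewrite -[u]L2reprK -!L2pi_scale scalerA. Qed.

Let L2scale1 : left_id 1 L2scale.
Proof. by move=> u; rewrite -[u]L2reprK -!L2pi_scale scale1r. Qed.

Let L2scaleDr : right_distributive L2scale +%R.
Proof.
move=> a u v; rewrite -[u]L2reprK -[v]L2reprK.
by rewrite -L2piD -!L2pi_scale scalerDr L2piD.
Qed.

Let L2scaleDl u : {morph L2scale^~ u : a b / a + b}.
Proof. by move=> a b; rewrite -[u]L2reprK -!L2pi_scale scalerDl L2piD. Qed.

HB.instance Definition _ :=
  GRing.Zmodule_isLmodule.Build C L2 L2scaleA L2scale1 L2scaleDr L2scaleDl.

Lemma L2piZ (a : C) (f : L2fun) : L2pi (a *: f) = a *: L2pi f.
Proof. exact: L2pi_scale. Qed.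

(* The class of f; the junk value 0 when f is not square integrable. *)
Definition L2class (f : R -> 'cV[C]_n) : L2 := L2pi (insubd 0 f).

Definition L2fun_dot (f g : L2fun) : C :=
  cintegral I01 (fun x => \sum_i f x i 0 * (g x i 0)^*).

Definition L2dot (u v : L2) : C := L2fun_dot (L2repr u) (L2repr v).

Let dotL1 (f g : L2fun) : cLfun 1 (fun x => \sum_i f x i 0 * (g x i 0)^*).
Proof.
apply: cLfun_sum => // i; apply: cLfunM.
  by case: f => f /= /asboolP; exact.
by apply: cLfun_conj => //; case: g => g /= /asboolP; exact.
Qed.

Let L2fun_dotZDl a (f g h : L2fun) :
  L2fun_dot (a *: f + g) h = a * L2fun_dot f h + L2fun_dot g h.
Proof.
rewrite -cintegralZD//; congr cintegral; apply/funext => x.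
rewrite mulr_sumr -big_split/=; apply: eq_bigr => i _.
by rewrite !fctE !mxE mulrDl mulrA.
Qed.

Let L2fun_dotC (f g : L2fun) : L2fun_dot f g = (L2fun_dot g f)^*.
Proof.
rewrite -[RHS]cintegral_conj//; congr cintegral; apply/funext => x.
rewrite rmorph_sum; apply: eq_bigr => i _.
by rewrite rmorphM mulrC; congr (_ * _); exact/esym/conjCK.
Qed.

Let L2fun_dot_pil (f g h : L2fun) :
  L2pi f = L2pi g -> L2fun_dot f h = L2fun_dot g h.
Proof.
move=> /L2piP fg; rewrite -[f](subrK g) -[f - g]scale1r L2fun_dotZDl mul1r.
rewrite [X in X + _]cintegral_ae0 ?add0r//.
apply: (@filterS _ _ (ae_filter_ringOfSetsType mu) _ _ _ fg) => x fx x01.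
by rewrite big1// => i _; rewrite /= !fctE fx// subrr mxE mul0r.
Qed.

Lemma L2dotE (f g : L2fun) : L2dot (L2pi f) (L2pi g) = L2fun_dot f g.
Proof.
rewrite /L2dot (L2fun_dot_pil _ (L2reprK _)).
by rewrite L2fun_dotC (L2fun_dot_pil _ (L2reprK _)) -L2fun_dotC.
Qed.

Let L2dotC (u v : L2) : L2dot u v = (-1) ^+ false * (L2dot v u)^*.
Proof. by rewrite mul1r /L2dot L2fun_dotC. Qed.

Let L2dotZDl a (u v w : L2) : L2dot (a *: u + v) w = a * L2dot u w + L2dot v w.
Proof.
rewrite -[u]L2reprK -[v]L2reprK -[w]L2reprK -L2piZ -L2piD !L2dotE.
exact: L2fun_dotZDl.
Qed.

Let L2dot_bilinear : bilinear_for
  (GRing.Scale.Law.clone _ _ ( *%R : C -> C -> C) _)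
  (GRing.Scale.Law.clone _ _ (Num.conj \; *%R : C -> C -> C) _) L2dot.
Proof.
split=> u a v w /=; first exact: L2dotZDl.
have dC (x y : L2) : L2dot x y = (L2dot y x)^* by rewrite /L2dot L2fun_dotC.
rewrite [LHS]dC L2dotZDl rmorphD rmorphM /=.
by congr (_ * _ + _); exact/esym/dC.
Qed.

Let L2dot_gt0 (u : L2) : u != 0 -> 0 < L2dot u u.
Proof.
move=> un0; apply: cintegral_gt0 => // [x|u0].
  by apply: sumr_ge0 => i _; exact: mul_conjC_ge0.
move/negP: un0; apply; apply/eqP; rewrite -[u]L2reprK.
transitivity (L2pi 0); last by rewrite -(scale0r 0) L2piZ scale0r.
apply/L2piP.
apply: (@filterS _ _ (ae_filter_ringOfSetsType mu) _ _ _ u0) => x + x01 => /(_ x01).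
move=> /eqP; rewrite psumr_eq0 => [/allP s0|i _]; last exact: mul_conjC_ge0.
apply/colP => i; have := s0 i; rewrite mem_index_enum => /(_ isT) /=.
by rewrite mul_conjC_eq0 => /eqP ->; rewrite mxE.
Qed.

HB.instance Definition _ :=
  bilinear_isBilinear.Build C L2 L2 C _ _ L2dot L2dot_bilinear.
HB.instance Definition _ :=
  isHermitianSesquilinear.Build C L2 false Num.conj L2dot L2dotC.
HB.instance Definition _ := isDotProduct.Build C L2 L2dot L2dot_gt0.

End L2Space.
Arguments L2 : clear implicits.

(* Operator theory on a complex Hilbert space given by its carrier H and its
   inner product dot; used below with H = L2 R n, whose inner product L2dot is
   an instance of {dot L2 R n for conjC}. *)
Section HilbertOperators.
Context {R : realType} {H : lmodType R[i]}.
Variable dot : H -> H -> R[i].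

Definition hilbert_norm (u : H) : R[i] := sqrtC (dot u u).

Definition bounded_op (T : H -> H) : Prop :=
  linear T /\
  exists M : R, forall u, hilbert_norm (T u) <= M%:C * hilbert_norm u.

Definition adjoint_op (T S : H -> H) : Prop :=
  bounded_op S /\ forall u v, dot (T u) v = dot u (S v).

(* The order of R[i] makes 0 <= z mean that z is real and nonnegative. *)
Definition positive_op (A : H -> H) : Prop :=
  bounded_op A /\ forall u, 0 <= dot (A u) u.

(* A = |T| := (T^* T)^(1/2), the unique positive square root of T^* T. *)
Definition absolute_value_op (T A : H -> H) : Prop :=
  positive_op A /\
  exists2 S, adjoint_op T S & forall u, A (A u) = S (T u).

(* Bases are indexed by nat: H is meant to be infinite-dimensional and
   separable. *)
Definition orthonormal_basis (e : nat -> H) : Prop :=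
  (forall j k, dot (e j) (e k) = (j == k)%:R) /\
  (forall u, (forall k, dot u (e k) = 0) -> u = 0).

(* tr |T| < +oo *)
Definition trace_class (T : H -> H) : Prop :=
  bounded_op T /\
  exists2 A, absolute_value_op T A &
    forall e, orthonormal_basis e ->
      (\sum_(0 <= k <oo) (Re (dot (A (e k)) (e k)))%:E < +oo)%E.

Definition has_trace (T : H -> H) (t : R[i]) : Prop :=
  forall e, orthonormal_basis e ->
    (fun N => \sum_(k < N) dot (T (e k)) (e k) : R[i]^o) @ \oo --> (t : R[i]^o).

(* An unbounded operator A is given by its graph, the set of pairs (u, A u)
   with u in the domain of A. *)
Definition shift_op (A : set (H * H)) (l : R[i]) : set (H * H) :=
  [set uv | A (uv.1, uv.2 + l *: uv.1)].

Definition is_resolvent (A : set (H * H)) (l : R[i]) (S : H -> H) : Prop :=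
  bounded_op S /\ forall u v, shift_op A l (u, v) <-> u = S v.

Definition resolvent_set (A : set (H * H)) : set R[i] :=
  [set l | exists S, is_resolvent A l S].

Definition resolvent (A : set (H * H)) (l : R[i]) : H -> H :=
  xget (fun=> 0) [set S | is_resolvent A l S].

End HilbertOperators.

Section BoundaryValueProblem.
Context {R : realType}.

(* Y belongs to W^{1,1}([0, 1]), with derivative Y': in dimension one these are
   exactly the primitives of integrable functions, and Y is the absolutely
   continuous representative, so that Y 0 and Y 1 make sense. *)
Definition W11_deriv m p (Y Y' : R -> 'M[R[i]]_(m, p)) : Prop :=
  mxLfun 1%:E Y' /\
  forall x, 0 <= x <= 1 -> Y x = Y 0 + mxintegral `[0, x] Y'.

Definition diff_expr n p (B : 'M[R[i]]_n) (Q : R -> 'M[R[i]]_n)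
    (Y Y' : R -> 'M[R[i]]_(n, p)) : R -> 'M[R[i]]_(n, p) :=
  fun x => - 'i%C *: (invmx B *m Y' x) + Q x *m Y x.

(* The graph of L_{C,D}(Q). *)
Definition bvp_op n (B : 'M[R[i]]_n) (Q : R -> 'M[R[i]]_n)
    (C D : 'M[R[i]]_n) : set (L2 R n * L2 R n) :=
  [set uv | exists y y' : R -> 'cV[R[i]]_n,
    [/\ W11_deriv y y', mxLfun 2%:E (diff_expr B Q y y'),
        C *m y 0 + D *m y 1 = 0,
        uv.1 = L2class y & uv.2 = L2class (diff_expr B Q y y')]].

Definition fundamental_solution n (B : 'M[R[i]]_n) (Q : R -> 'M[R[i]]_n)
    (l : R[i]) (Phi : R -> 'M[R[i]]_n) : Prop :=
  exists Phi' : R -> 'M[R[i]]_n,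
    [/\ W11_deriv Phi Phi', Phi 0 = 1%:M &
        {ae @lebesgue_measure R, forall x, I01 R x ->
           diff_expr B Q Phi Phi' x = l *: Phi x}].

End BoundaryValueProblem.

(* Main.v *)
(* Let Phi be the fundamental matrix and Psi its inverse.  Variation of
   constants gives the resolvent as
     u |-> Phi(x) (z(x) + K z(1)),  z(x) = int_0^x Psi (iB) u,
     K = - (C + D Phi(1))^-1 D Phi(1).
   The term K z(1) has finite rank and trace tr int_0^1 Phi K Psi iB, which is
   tr int_0^1 (Phi (C + D Phi(1))^-1 C Phi^-1 - 1) iB.  In the difference of
   two resolvents the remaining terms combine, by variation of constants once
   more, into Phi1(x) int_0^x Psi1 (A1 - A2) Phi2 z2, where A_j is the
   coefficient matrix of Phi_j' = A_j Phi_j.  This is an integral over s in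
   [0, 1] of rank one operators u |-> N(s) <u, q_s> p_s with N integrable, p_s
   supported on [s, 1] and q_s on [0, s], so it is nuclear with trace 0 although
   the individual resolvents need not be nuclear.  A nuclear operator T is trace
   class in the sense of tr |T|: |T| is built by the square root iteration and
   compared with T through contractions approximating the polar
   decomposition. *)

Require Import Defs.
From HB Require Import structures.
From mathcomp Require Import all_boot all_order all_algebra.
From mathcomp Require Import all_classical all_reals all_analysis.
From mathcomp Require Import complex measurable_realfun.
From mathcomp Require Import ring lra.

Set Implicit Arguments.
Unset Strict Implicit.
Unset Printing Implicit Defensive.

Import Order.TTheory GRing.Theory Num.Theory.
Import numFieldNormedType.Exports.

Local Open Scope classical_set_scope.
Local Open Scope ring_scope.
Local Open Scope complex_scope.

(** * Operators on a Hilbert space *)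

(** The kernel of a single resolvent jumps across the diagonal by Phi Psi iB = iB, which is what
    obstructs a nuclear bound. The jump depends on B alone, hence cancels in the difference; the
    terms - iB left over in the traces of the two finite rank parts cancel for the same reason. As Q
    is only integrable, derivatives exist merely almost everywhere: functions in W^{1,1} are handled
    through their primitives, and the product rule is Fubini on a triangle. The two halves of the
    proof meet in [nuclear_bounded], a bound on sum |beta(e_k, f_k)| uniform over orthonormal e and
    over f that only satisfy Bessel's inequality. Integrals of rank one forms have it, by Bessel's
    inequality for e and for f; it passes to tr |T| because contractions turn orthonormal families
    into Bessel ones. The trace is computed along each basis by Parseval, and adjoints are exhibited
    as explicit kernels. *)

Section ComplexModulus.
Context {R : realType}.
Implicit Types z w : R[i].
Local Notation normc := Normc.normc.
Local Notation Re := complex.Re.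
Local Notation Im := complex.Im.

Lemma normc_ge0 z : 0 <= normc z.
Proof. by case: z => a b /=; exact: sqrtr_ge0. Qed.

Lemma normc_sqr z : normc z ^+ 2 = Re z ^+ 2 + Im z ^+ 2.
Proof. by case: z => a b /=; rewrite sqr_sqrtr// addr_ge0// sqr_ge0. Qed.

Lemma normc_conj z : normc z^*%C = normc z.
Proof. by case: z => a b /=; rewrite sqrrN. Qed.

Lemma normc_real (x : R) : normc x%:C = `|x|.
Proof. by rewrite /= expr0n/= addr0 sqrtr_sqr. Qed.

Lemma mulcJE z : z * z^*%C = (normc z ^+ 2)%:C.
Proof. by rewrite -sqr_normc -[`|z|]/((normc z)%:C) -rmorphXn. Qed.

Lemma Re_le_normc z : `|Re z| <= normc z.
Proof.
rewrite -(@ler_pXn2r _ 2)// ?nnegrE ?normc_ge0//.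
by rewrite real_normK ?num_real// normc_sqr lerDl sqr_ge0.
Qed.

Lemma Im_le_normc z : `|Im z| <= normc z.
Proof.
rewrite -(@ler_pXn2r _ 2)// ?nnegrE ?normc_ge0//.
by rewrite real_normK ?num_real// normc_sqr lerDr sqr_ge0.
Qed.

Lemma normc_le_ReIm z : normc z <= `|Re z| + `|Im z|.
Proof.
rewrite -(@ler_pXn2r _ 2)// ?nnegrE ?normc_ge0 ?addr_ge0//.
rewrite normc_sqr sqrrD !real_normK ?num_real// lerD2r lerDl.
by rewrite mulrn_wge0// mulr_ge0.
Qed.

Lemma normcD z w : normc (z + w) <= normc z + normc w.
Proof. exact: le_normcD. Qed.

Lemma normcB_sym z w : normc (z - w) = normc (w - z).
Proof. by rewrite -(normcN (w - z)) opprB. Qed.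

Lemma Re_addc z w : Re (z + w) = Re z + Re w.
Proof. by case: z w => [? ?] []. Qed.

Lemma Im_addc z w : Im (z + w) = Im z + Im w.
Proof. by case: z w => [? ?] []. Qed.

Lemma Re_oppc z : Re (- z) = - Re z. Proof. by case: z. Qed.

Lemma Im_oppc z : Im (- z) = - Im z. Proof. by case: z. Qed.

Lemma Re_mulc z w : Re (z * w) = Re z * Re w - Im z * Im w.
Proof. by case: z w => [? ?] []. Qed.

Lemma Im_mulc z w : Im (z * w) = Re z * Im w + Im z * Re w.
Proof. by case: z w => [? ?] []. Qed.

Lemma Re_sum (I : Type) (r : seq I) (P : pred I) (F : I -> R[i]) :
  Re (\sum_(i <- r | P i) F i) = \sum_(i <- r | P i) Re (F i).
Proof. by elim/big_rec2: _ => [//|i y x _ <-]; rewrite Re_addc. Qed.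

Lemma Im_sum (I : Type) (r : seq I) (P : pred I) (F : I -> R[i]) :
  Im (\sum_(i <- r | P i) F i) = \sum_(i <- r | P i) Im (F i).
Proof. by elim/big_rec2: _ => [//|i y x _ <-]; rewrite Im_addc. Qed.

Lemma complex_ext z w : Re z = Re w -> Im z = Im w -> z = w.
Proof. by case: z w => [? ?] [? ?] /= -> ->. Qed.

Lemma conjc_realM (t : R) z : (t%:C * z)^*%C = t%:C * z^*%C.
Proof. by case: z => a b; apply: complex_ext => /=; ring. Qed.

Lemma cvgC_normc (z_ : nat -> R[i]) z :
  (fun k => normc (z_ k - z)) @ \oo --> (0 : R) ->
  (z_ : nat -> R[i]^o) @ \oo --> (z : R[i]^o).
Proof.
move=> /cvgrPdist_lt h; apply/(@cvgrPdist_lt _ R[i]^o).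
move=> e e0; have [eR] : e = (Re e)%:C /\ 0 < Re e.
  by move: e0; case: e => a b; rewrite ltcE/= => /andP[/eqP -> ->].
move=> /h; rewrite eR; apply: filterS => k.
rewrite sub0r normrN ger0_norm ?normc_ge0// => hk.
by rewrite [`|_|]/(normc _)%:C ltcR normcB_sym.
Qed.

End ComplexModulus.

Section LinearMaps.
Context {K : pzRingType} {U V : lmodType K}.
Variable T : U -> V.
Hypothesis linT : linear T.

Lemma linmapD u v : T (u + v) = T u + T v.
Proof. by have := linT 1 u v; rewrite !scale1r. Qed.

Lemma linmap0 : T 0 = 0.
Proof. by apply: (addrI (T 0)); rewrite -linmapD !addr0. Qed.

Lemma linmapZ a u : T (a *: u) = a *: T u.
Proof. by have := linT a u 0; rewrite linmap0 !addr0. Qed.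

Lemma linmapN u : T (- u) = - T u.
Proof. by rewrite -scaleN1r linmapZ scaleN1r. Qed.

Lemma linmapB u v : T (u - v) = T u - T v.
Proof. by rewrite linmapD linmapN. Qed.

Lemma linmap_sum (I : Type) (r : seq I) (P : pred I) (F : I -> U) :
  T (\sum_(i <- r | P i) F i) = \sum_(i <- r | P i) T (F i).
Proof.
elim/big_rec2: _ => [|i y x _ <-]; first exact: linmap0.
exact: linmapD.
Qed.

End LinearMaps.

(** Evaluation at the minimiser t = 1/q; for q = 0 the expression is affine in t, and a positive s
    would allow the value -1. The factor s in the quadratic term comes from testing with t z v where
    |z|^2 = s, as in [CauchySchwarz_op]. *)
Lemma discriminant_le (R : realFieldType) (p q s : R) :
  0 <= q -> 0 <= s -> (forall t, 0 <= p - 2 * t * s + t ^+ 2 * s * q) ->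
  s <= p * q.
Proof.
rewrite le_eqVlt => /predU1P[<-|q0] s0 h.
  rewrite mulr0; rewrite leNgt; apply/negP => s_gt0.
  have := h ((p + 1) / (2 * s)).
  rewrite mulr0 addr0 (_ : 2 * _ * s = p + 1); first by rewrite leNgt; lra.
  by field; rewrite lt0r_neq0.
have := h q^-1.
rewrite (_ : _ - _ + _ = p - s / q); last by field; rewrite lt0r_neq0.
by rewrite subr_ge0 ler_pdivrMr.
Qed.

(** * Norm, Cauchy-Schwarz inequality and convergence in an inner product space *)

Section InnerProduct.
Context {R : realType} {H : lmodType R[i]}.
Variable dot : {dot H for Num.conj}.
Local Notation normc := Normc.normc.
Local Notation Re := complex.Re.
Local Notation Im := complex.Im.
Implicit Types u v w : H.

Lemma dot_conj u v : dot u v = (dot v u)^*%C.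
Proof. by rewrite hermC mul1r. Qed.

Lemma dotDl u v w : dot (u + v) w = dot u w + dot v w.
Proof. exact: linearDl. Qed.

Lemma dotZl a u w : dot (a *: u) w = a * dot u w.
Proof. by rewrite linearZl_LR. Qed.

Lemma dotDr u v w : dot w (u + v) = dot w u + dot w v.
Proof. by rewrite dot_conj dotDl rmorphD/= -!dot_conj. Qed.

Lemma dotZr a u w : dot w (a *: u) = a^*%C * dot w u.
Proof. by rewrite dot_conj dotZl rmorphM/= -!dot_conj. Qed.

Lemma dot0l w : dot 0 w = 0.
Proof. by rewrite -(scale0r 0) dotZl mul0r. Qed.

Lemma dot0r w : dot w 0 = 0.
Proof. by rewrite dot_conj dot0l conjc0. Qed.

Lemma dotNl u w : dot (- u) w = - dot u w.
Proof. by rewrite -scaleN1r dotZl mulN1r. Qed.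

Lemma dotNr u w : dot w (- u) = - dot w u.
Proof. by rewrite dot_conj dotNl rmorphN/= -dot_conj. Qed.

Lemma dotBl u v w : dot (u - v) w = dot u w - dot v w.
Proof. by rewrite dotDl dotNl. Qed.

Lemma dotBr u v w : dot w (u - v) = dot w u - dot w v.
Proof. by rewrite dotDr dotNr. Qed.

Lemma dot_suml (I : Type) (r : seq I) (P : pred I) (F : I -> H) w :
  dot (\sum_(i <- r | P i) F i) w = \sum_(i <- r | P i) dot (F i) w.
Proof.
elim/big_rec2: _ => [|i y x _ <-]; first exact: dot0l.
exact: dotDl.
Qed.

Lemma dot_sumr (I : Type) (r : seq I) (P : pred I) (F : I -> H) w :
  dot w (\sum_(i <- r | P i) F i) = \sum_(i <- r | P i) dot w (F i).
Proof.
elim/big_rec2: _ => [|i y x _ <-]; first exact: dot0r.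
exact: dotDr.
Qed.

(** The norm as an element of [R], where order and limits are available; [hilbert_normE] links it to
    the complex-valued [hilbert_norm]. *)
Definition hn u : R := Num.sqrt (Re (dot u u)).

Lemma hn_ge0 u : 0 <= hn u. Proof. exact: sqrtr_ge0. Qed.

Lemma hn_sqr u : hn u ^+ 2 = Re (dot u u).
Proof.
rewrite sqr_sqrtr//.
by have := dnorm_ge0 dot u; rewrite lecE => /andP[].
Qed.

Lemma dotuu u : dot u u = (hn u ^+ 2)%:C.
Proof.
rewrite hn_sqr; have := dnorm_ge0 dot u.
by case: (dot u u) => a b; rewrite lecE/= => /andP[/eqP ->].
Qed.

Lemma hilbert_normE u : hilbert_norm dot u = (hn u)%:C.
Proof.
rewrite /hilbert_norm dotuu; apply/eqP; rewrite rmorphXn.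
rewrite (sqrCK _)//.
by rewrite ler0c hn_ge0.
Qed.

Lemma hn_eq0 u : hn u = 0 -> u = 0.
Proof.
move=> hu; apply/eqP; rewrite -(dnorm_eq0 dot); apply/eqP.
by rewrite dotuu hu expr0n.
Qed.

Lemma dot_inj u v : (forall w, dot u w = dot v w) -> u = v.
Proof.
move=> uv; apply/eqP; rewrite -subr_eq0 -(dnorm_eq0 dot).
by rewrite dotBl uv subrr.
Qed.

Definition symmetric_op (A : H -> H) := forall u v, dot (A u) v = dot u (A v).

Lemma symmetric_op_real A u : symmetric_op A -> dot (A u) u = (Re (dot (A u) u))%:C.
Proof.
move=> sA; apply: complex_ext => //=.
have : Im (dot (A u) u) = - Im (dot (A u) u).
  by rewrite {1}dot_conj -sA; case: (dot (A u) u).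
by move=> h; lra.
Qed.

(** The semidefinite form of A is nonnegative at u - t <A u, v> v for every real t. [A = id] gives
    the usual inequality, and general A serves [symmetric_contraction]. *)
Lemma CauchySchwarz_op A u v : linear A -> symmetric_op A ->
  (forall w, 0 <= Re (dot (A w) w)) ->
  normc (dot (A u) v) ^+ 2 <= Re (dot (A u) u) * Re (dot (A v) v).
Proof.
move=> lA sA A0; apply: discriminant_le => // [|t].
  by rewrite exprn_ge0// normc_ge0.
set z := dot (A u) v.
have := A0 (u - (t%:C * z) *: v).
have -> : dot (A (u - (t%:C * z) *: v)) (u - (t%:C * z) *: v) =
   dot (A u) u - (t%:C + t%:C) * (z * z^*%C) + t%:C ^+ 2 * (z * z^*%C) * dot (A v) v.
  rewrite (linmapB lA) (linmapZ lA) dotBl !dotBr !dotZl !dotZr -/z.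
  have -> : dot (A v) u = z^*%C by rewrite dot_conj -sA.
  rewrite conjc_realM.
  by ring.
rewrite mulcJE (symmetric_op_real u sA) (symmetric_op_real v sA).
set p := Re (dot (A u) u); set q := Re (dot (A v) v).
set s := normc z ^+ 2.
rewrite [X in Re X](_ : _ = (p - (t + t) * s + t ^+ 2 * s * q)%:C).
  by have <- : t + t = 2 * t by ring.
by apply: complex_ext; rewrite ?expr2 /=; ring.
Qed.

Lemma CauchySchwarz_hn u v : normc (dot u v) <= hn u * hn v.
Proof.
rewrite -(@ler_pXn2r _ 2)// ?nnegrE ?normc_ge0 ?mulr_ge0 ?hn_ge0//.
rewrite exprMn !hn_sqr.
apply: (@CauchySchwarz_op id) => // w; rewrite -hn_sqr.
by rewrite exprn_ge0// hn_ge0.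
Qed.

Lemma hn0 : hn 0 = 0.
Proof. by rewrite /hn dot0l sqrtr0. Qed.

Lemma hnZ a u : hn (a *: u) = normc a * hn u.
Proof.
apply/eqP; rewrite -(@eqrXn2 _ 2)// ?mulr_ge0 ?hn_ge0 ?normc_ge0//.
rewrite exprMn [X in X == _]hn_sqr dotZl dotZr mulrA mulcJE dotuu Re_mulc/=.
by rewrite mulr0 subr0.
Qed.

Lemma hnN u : hn (- u) = hn u.
Proof. by rewrite /hn dotNl dotNr opprK. Qed.

Lemma hnB_sym u v : hn (u - v) = hn (v - u).
Proof. by rewrite -hnN opprB. Qed.

Lemma hnD u v : hn (u + v) <= hn u + hn v.
Proof.
rewrite -(@ler_pXn2r _ 2)// ?nnegrE ?addr_ge0 ?hn_ge0//.
rewrite hn_sqr dotDl !dotDr !Re_addc -!hn_sqr sqrrD.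
have h1 := le_trans (ler_norm _) (Re_le_normc (dot u v)).
have h2 := le_trans (ler_norm _) (Re_le_normc (dot v u)).
have h3 := CauchySchwarz_hn u v; have h4 := CauchySchwarz_hn v u.
rewrite -mulr_natl.
by have := mulrC (hn u) (hn v) => h5; lra.
Qed.

(** Cauchy-Schwarz for the form of A, with v = A u, reads |A u|^4 <= <A u, u> <A (A u), A u> <=
    |u|^2 |A u|^2. *)
Lemma symmetric_contraction A : linear A -> symmetric_op A ->
  (forall w, 0 <= Re (dot (A w) w) <= hn w ^+ 2) -> forall u, hn (A u) <= hn u.
Proof.
move=> lA sA A01 u.
have A0 w : 0 <= Re (dot (A w) w) by have /andP[] := A01 w.
have := @CauchySchwarz_op A u (A u) lA sA A0.
rewrite dotuu normc_real ger0_norm ?exprn_ge0 ?hn_ge0// => h.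
have [->|Au0] := eqVneq (hn (A u)) 0; first exact: hn_ge0.
have {}Au0 : 0 < hn (A u) by rewrite lt_neqAle eq_sym Au0 hn_ge0.
rewrite -(@ler_pXn2r _ 2)// ?nnegrE ?hn_ge0//.
rewrite -(@ler_pM2r _ (hn (A u) ^+ 2)) ?exprn_gt0// -expr2.
apply: le_trans h _; apply: ler_pM => //.
  by have /andP[] := A01 u.
by have /andP[] := A01 (A u).
Qed.

Definition hcvg (u_ : nat -> H) u := (fun k => hn (u_ k - u)) @ \oo --> (0 : R).

Lemma hcvg_squeeze (u_ : nat -> H) u (r : nat -> R) :
  (forall k, hn (u_ k - u) <= r k) -> r @ \oo --> (0 : R) -> hcvg u_ u.
Proof.
move=> ur r0; apply: (squeeze_cvgr _ (cvg_cst 0) r0).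
by apply: nearW => k; rewrite hn_ge0 ur.
Qed.

Lemma hcvg_unique (u_ : nat -> H) u v : hcvg u_ u -> hcvg u_ v -> u = v.
Proof.
move=> hu hv; apply/eqP; rewrite -subr_eq0; apply/eqP/hn_eq0.
have h : (fun k => hn (u_ k - u) + hn (u_ k - v)) @ \oo --> (0 + 0 : R).
  exact: cvgD.
have c : (fun _ : nat => hn (u - v)) @ \oo --> (0 : R).
  apply: (squeeze_cvgr _ (cvg_cst 0)); last by rewrite -[0]addr0; exact: h.
  apply: nearW => k; rewrite hn_ge0/=.
  rewrite (_ : u - v = (u_ k - v) - (u_ k - u)); last by rewrite [RHS]addrC opprB addrA subrK.
  by rewrite addrC; apply: le_trans (hnD _ _) _; rewrite hnN.
by rewrite -(cvg_lim (@norm_hausdorff _ R) c) lim_cst.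
Qed.

Lemma hcvgZD a (u_ v_ : nat -> H) u v : hcvg u_ u -> hcvg v_ v ->
  hcvg (fun k => a *: u_ k + v_ k) (a *: u + v).
Proof.
move=> hu hv.
apply: (@hcvg_squeeze _ _ (fun k => normc a * hn (u_ k - u) + hn (v_ k - v))).
  move=> k; rewrite opprD addrACA -scalerBr -hnZ; exact: hnD.
rewrite -[X in _ --> X](addr0 0) -[X in _ --> X + 0](mulr0 (normc a)).
by apply: cvgD => //; apply: cvgM => //; exact: cvg_cst.
Qed.

Lemma hcvg_dot (u_ : nat -> H) u v : hcvg u_ u ->
  (fun k => normc (dot (u_ k) v - dot u v)) @ \oo --> (0 : R).
Proof.
move=> hu; apply: (squeeze_cvgr _ (cvg_cst 0)); last first.
  rewrite -(mul0r (hn v)); apply: cvgM; [exact: hu|exact: cvg_cst].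
apply: nearW => k; rewrite normc_ge0/= -dotBl; exact: CauchySchwarz_hn.
Qed.

Lemma hcvg_dot_unique (u_ : nat -> H) u v (z : R[i]) : hcvg u_ u ->
  (fun k => normc (dot (u_ k) v - z)) @ \oo --> (0 : R) -> dot u v = z.
Proof.
move=> hu /cvgC_normc h2; have /cvgC_normc h1 := hcvg_dot v hu.
by rewrite -(cvg_lim (@norm_hausdorff _ R[i]^o) h1) -(cvg_lim (@norm_hausdorff _ R[i]^o) h2).
Qed.

Definition hilbert_complete := forall u_ : nat -> H,
  (forall e : R, 0 < e -> exists N, forall m k, (N <= m)%N -> (N <= k)%N ->
     hn (u_ m - u_ k) <= e) ->
  exists u, hcvg u_ u.

End InnerProduct.

(** * The iteration behind the square root of a positive operator *)

Section OperatorPolynomials.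
Context {R : realType} {H : lmodType R[i]}.
Variable dot : {dot H for Num.conj}.
Local Notation hn := (hn dot).

(* Polynomials in X with nonnegative coefficients, together with their value
   at 1, which bounds the norm of the operator when X is a contraction.  The
   iterates of Y |-> (X + Y^2) / 2 and their increments are of this form, so
   they converge because the scalar iteration at X = 1 does. *)
Inductive pos_poly (X : H -> H) : (H -> H) -> R -> Prop :=
| PosPoly0 : pos_poly X (fun=> 0) 0
| PosPolyX : pos_poly X X 1
| PosPolyD P Q p q : pos_poly X P p -> pos_poly X Q q ->
    pos_poly X (fun u => P u + Q u) (p + q)
| PosPolyM P Q p q : pos_poly X P p -> pos_poly X Q q ->
    pos_poly X (fun u => P (Q u)) (p * q)
| PosPolyZ c P p : 0 <= c -> pos_poly X P p ->
    pos_poly X (fun u => c%:C *: P u) (c * p).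

Variable X : H -> H.
Hypothesis linX : linear X.
Hypothesis symX : symmetric_op dot X.
Hypothesis contrX : forall u, hn (X u) <= hn u.

Lemma pos_poly_linear P p : pos_poly X P p -> linear P.
Proof.
elim=> {P p} [||P Q p q _ lP _ lQ|P Q p q _ lP _ lQ|c P p c0 _ lP] a u v.
- by rewrite scaler0 addr0.
- exact: linX.
- by rewrite lP lQ scalerDr addrACA.
- by rewrite lQ lP.
- by rewrite lP scalerDr !scalerA mulrC.
Qed.

Lemma pos_poly_ge0 P p : pos_poly X P p -> 0 <= p.
Proof.
elim=> {P p} [||P Q p q _ lP _ lQ|P Q p q _ lP _ lQ|c P p c0 _ lP] //.
- by rewrite addr_ge0.
- by rewrite mulr_ge0.
- by rewrite mulr_ge0.
Qed.

Lemma pos_poly_bound P p : pos_poly X P p -> forall u, hn (P u) <= p * hn u.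
Proof.
elim=> {P p} [||P Q p q _ lP _ lQ|P Q p q hP lP _ lQ|c P p c0 _ lP] u.
- by rewrite hn0 mul0r.
- by rewrite mul1r.
- by rewrite mulrDl; apply: le_trans (hnD _ _ _) _; rewrite lerD.
- apply: le_trans (lP _) _; rewrite -mulrA ler_wpM2l//.
  exact: pos_poly_ge0 hP.
- by rewrite hnZ normc_real ger0_norm// -mulrA ler_wpM2l.
Qed.

Lemma pos_poly_commX P p : pos_poly X P p -> forall u, P (X u) = X (P u).
Proof.
elim=> {P p} [||P Q p q _ lP _ lQ|P Q p q _ lP _ lQ|c P p c0 _ lP] u //.
- by rewrite (linmap0 linX).
- by rewrite lP lQ (linmapD linX).
- by rewrite lQ lP.
- by rewrite lP (linmapZ linX).
Qed.

(** Commutation is what makes a product of two such operators symmetric and what lets a difference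
    of squares factor in [pos_poly_sqrt_iterS]. *)
Lemma pos_poly_comm P p Q q : pos_poly X P p -> pos_poly X Q q ->
  forall u, P (Q u) = Q (P u).
Proof.
move=> hP hQ; have lQ := pos_poly_linear hQ.
elim: hP => {P p} [||P P' p p' _ lP _ lP'|P P' p p' _ lP _ lP'|c P p c0 _ lP] u.
- by rewrite (linmap0 lQ).
- by rewrite (pos_poly_commX hQ).
- by rewrite lP lP' (linmapD lQ).
- by rewrite lP' lP.
- by rewrite lP (linmapZ lQ).
Qed.

Lemma pos_poly_symmetric P p : pos_poly X P p -> symmetric_op dot P.
Proof.
elim=> {P p} [||P Q p q _ lP _ lQ|P Q p q hP lP hQ lQ|c P p c0 _ lP] u v.
- by rewrite dot0l dot0r.
- exact: symX.
- by rewrite dotDl dotDr lP lQ.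
- by rewrite lP lQ (pos_poly_comm hP hQ).
- by rewrite dotZl dotZr lP conjc_real.
Qed.

(** A fixed point Y of Y |-> (X + Y^2) / 2 satisfies (1 - Y)^2 = 1 - X, so 1 - Y is a square root of
    1 - X. *)
Fixpoint sqrt_iter k : H -> H :=
  if k is k'.+1 then
    fun u => (2^-1)%:C *: (X u + sqrt_iter k' (sqrt_iter k' u))
  else fun=> 0.

Lemma sqrt_iterS k u : sqrt_iter k.+1 u =
  (2^-1)%:C *: (X u + sqrt_iter k (sqrt_iter k u)).
Proof. by []. Qed.

Fixpoint sqrt_iter1 k : R :=
  if k is k'.+1 then 2^-1 * (1 + sqrt_iter1 k' * sqrt_iter1 k') else 0.

Lemma pos_poly_sqrt_iter k : pos_poly X (sqrt_iter k) (sqrt_iter1 k).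
Proof.
elim: k => [|k IH]; first exact: PosPoly0.
apply: (@PosPolyZ X _ (fun u => X u + _) (1 + _)); first by rewrite invr_ge0.
apply: PosPolyD; first exact: PosPolyX.
exact: PosPolyM.
Qed.

(** Since the iterates commute, Y_{k+2} - Y_{k+1} = (Y_{k+1} - Y_k) (Y_{k+1} + Y_k) / 2, and
    nonnegativity of the coefficients is inherited from one increment to the next. *)
Lemma pos_poly_sqrt_iterS k : pos_poly X
  (fun u => sqrt_iter k.+1 u - sqrt_iter k u)
  (sqrt_iter1 k.+1 - sqrt_iter1 k).
Proof.
elim: k => [|k IH].
  rewrite subr0 (_ : (fun u => _) = sqrt_iter 1).
    exact: pos_poly_sqrt_iter.
  by apply/funext => u; rewrite subr0.
have := PosPolyZ (c := 2^-1) _ (PosPolyM IH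
  (PosPolyD (pos_poly_sqrt_iter k.+1) (pos_poly_sqrt_iter k))).
rewrite invr_ge0 => /(_ (ler0n _ _)).
set P := (X in pos_poly _ X _); set p := (X in pos_poly _ _ X) => hP.
rewrite (_ : _ - _ = p); last by rewrite /p/=; ring.
rewrite (_ : (fun u => _) = P)//; apply/funext => u; rewrite /P.
have lk := pos_poly_linear (pos_poly_sqrt_iter k).
have lk1 := pos_poly_linear (pos_poly_sqrt_iter k.+1).
have -> : sqrt_iter k.+2 u - sqrt_iter k.+1 u = (2^-1)%:C *:
    (sqrt_iter k.+1 (sqrt_iter k.+1 u) - sqrt_iter k (sqrt_iter k u)).
  rewrite (sqrt_iterS k.+1) [X in _ - X](sqrt_iterS k) -scalerBr.
  by rewrite opprD addrACA subrr add0r.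
rewrite (linmapD lk1) (linmapD lk).
rewrite (pos_poly_comm (pos_poly_sqrt_iter k) (pos_poly_sqrt_iter k.+1)).
by rewrite opprD addrA addrK.
Qed.

Lemma pos_poly_sqrt_iterB k m : (k <= m)%N -> pos_poly X
  (fun u => sqrt_iter m u - sqrt_iter k u) (sqrt_iter1 m - sqrt_iter1 k).
Proof.
move=> /subnK <-; elim: (m - k)%N => [|j IH].
  rewrite add0n subrr (_ : (fun u => _) = fun=> 0); first exact: PosPoly0.
  by apply/funext => u; rewrite subrr.
have := PosPolyD (pos_poly_sqrt_iterS (j + k)) IH.
set P := (X in pos_poly _ X _); set p := (X in pos_poly _ _ X) => hP.
rewrite addSn (_ : _ - _ = p); last by rewrite /p addrA subrK.
rewrite (_ : (fun u => _) = P)//; apply/funext => u; rewrite /P.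
by rewrite addrA subrK.
Qed.

Lemma sqrt_iter1_le1 k : sqrt_iter1 k <= 1.
Proof.
elim: k => [|k IH] //=.
have h0 := pos_poly_ge0 (pos_poly_sqrt_iter k).
have : sqrt_iter1 k * sqrt_iter1 k <= 1 by rewrite mulr_ile1.
by move=> ?; lra.
Qed.

(** The scalar iteration increases, its increments being values at 1 of a [pos_poly], and stays
    below 1; r is the distance to its limit. *)
Lemma sqrt_iter1_cvg : exists2 r : nat -> R, r @ \oo --> (0 : R) &
  forall k m, (k <= m)%N -> sqrt_iter1 m - sqrt_iter1 k <= r k.
Proof.
have nd : nondecreasing_seq sqrt_iter1.
  apply/nondecreasing_seqP => k.
  by rewrite -subr_ge0; exact: pos_poly_ge0 (pos_poly_sqrt_iterS k).
have cv : cvgn sqrt_iter1.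
  apply: nondecreasing_is_cvgn => //; exists 1 => _ [k _ <-].
  exact: sqrt_iter1_le1.
exists (fun k => limn sqrt_iter1 - sqrt_iter1 k).
  rewrite -(subrr (limn sqrt_iter1)); apply: cvgB; [exact: cvg_cst|exact: cv].
move=> k m _; rewrite lerD2r.
exact: nondecreasing_cvgn_le.
Qed.

Hypothesis complete : hilbert_complete dot.

Lemma sqrt_iter_limit : exists Y : H -> H,
  [/\ linear Y, symmetric_op dot Y, forall u, hn (Y u) <= hn u &
      forall u, Y u + Y u = X u + Y (Y u)].
Proof.
have [r r0 rP] := sqrt_iter1_cvg.
have Yex u : exists v, hcvg dot (sqrt_iter^~ u) v.
  apply: complete => e e0.
  have /cvgrPdist_lt /(_ _ e0) : (fun k => r k * hn u) @ \oo --> (0 : R).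
    by rewrite -(mul0r (hn u)); apply: cvgM => //; exact: cvg_cst.
  case=> N _ hN; exists N.
  have key m k : (N <= k)%N -> (k <= m)%N ->
      hn (sqrt_iter m u - sqrt_iter k u) <= e.
    move=> Nk km.
    apply: le_trans (pos_poly_bound (pos_poly_sqrt_iterB km) u) _.
    apply: le_trans (ler_wpM2r (hn_ge0 _ _) (rP _ _ km)) _.
    have := hN k Nk; rewrite /= sub0r normrN => /ltW; apply: le_trans.
    exact: ler_norm.
  move=> m k Nm Nk; case: (leqP k m) => [|/ltnW] km; first exact: key.
  by rewrite hnB_sym; exact: key.
have [Y hY] := choice Yex.
have linY : linear Y.
  move=> a u v; apply: (hcvg_unique (hY _)).
  rewrite (_ : sqrt_iter^~ _ = fun k => a *: sqrt_iter k u + sqrt_iter k v).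
    exact: hcvgZD.
  apply/funext => k; exact: (pos_poly_linear (pos_poly_sqrt_iter k)).
have bk k u : hn (sqrt_iter k u) <= hn u.
  apply: le_trans (pos_poly_bound (pos_poly_sqrt_iter k) u) _.
  by rewrite ler_piMl ?hn_ge0// sqrt_iter1_le1.
exists Y; split=> // [u v|u|u].
- have h1 := hcvg_dot v (hY u).
  have h2 := hcvg_dot u (hY v).
  apply: (hcvg_dot_unique (hY u)).
  rewrite (_ : (fun k => _) = fun k => Normc.normc (dot (sqrt_iter k v) u - dot (Y v) u)) //.
  apply/funext => k; rewrite (pos_poly_symmetric (pos_poly_sqrt_iter k)).
  by rewrite dot_conj [dot u (Y v)]dot_conj -rmorphB normc_conj.
- have h : (fun k => hn u + hn (sqrt_iter k u - Y u)) @ \oo --> hn u + 0.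
    by apply: cvgD; [exact: cvg_cst|exact: hY].
  rewrite -[leRHS]addr0; apply: (cvgr_to_ge h).
  apply: nearW => k.
  apply: (@le_trans _ _ (hn (sqrt_iter k u - (sqrt_iter k u - Y u)))).
    by rewrite subKr.
  by apply: le_trans (hnD _ _ _) _; rewrite hnN lerD.
(* Composition passes to the strong limit because the iterates are contractions: the error splits as
   Y_k (Y_k u - Y u) + (Y_k (Y u) - Y (Y u)). *)
have YYu : hcvg dot (fun k => sqrt_iter k (sqrt_iter k u)) (Y (Y u)).
  apply: (@hcvg_squeeze _ _ _ _ _
    (fun k => hn (sqrt_iter k u - Y u) + hn (sqrt_iter k (Y u) - Y (Y u)))).
    move=> k; have lk := pos_poly_linear (pos_poly_sqrt_iter k).
    rewrite -(subrKA (sqrt_iter k (Y u))) -(linmapB lk).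
    by apply: le_trans (hnD _ _ _) _; rewrite lerD.
  by rewrite -[0](addr0 0); apply: cvgD; exact: hY.
have h1 : hcvg dot (fun k => (2^-1)%:C *: (X u + sqrt_iter k (sqrt_iter k u)))
    ((2^-1)%:C *: (X u + Y (Y u))).
  have hX : hcvg dot (fun=> X u) (X u).
    by rewrite /hcvg subrr hn0; exact: cvg_cst.
  (* The constant sequence X u enters with the coefficients 2^-1 - 1 and 1, whose sum is 2^-1, to
     fit the shape of [hcvgZD]. *)
  have := hcvgZD (2^-1)%:C YYu (hcvgZD (2^-1 - 1)%:C hX hX).
  rewrite (_ : (fun k => _) = (fun k => (2^-1)%:C *: (X u + sqrt_iter k (sqrt_iter k u)))).
    rewrite (_ : _ + _ = (2^-1)%:C *: (X u + Y (Y u)))//.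
    by rewrite -{2}[X u]scale1r -scalerDl rmorphB subrK -scalerDr addrC.
  apply/funext => k.
  by rewrite -{2}[X u]scale1r -scalerDl rmorphB subrK -scalerDr addrC.
have h2 : hcvg dot (fun k => (2^-1)%:C *: (X u + sqrt_iter k (sqrt_iter k u))) (Y u).
  by have := hY u; rewrite /hcvg -(@cvg_shiftS _ (fun k => hn (sqrt_iter k u - Y u))).
have e2 : (2 : R)%:C = 1 + 1 :> R[i] by apply: complex_ext => //=; rewrite addr0.
have -> : Y u + Y u = (2 : R)%:C *: Y u by rewrite e2 scalerDl scale1r.
by rewrite {1}(hcvg_unique h2 h1) scalerA -rmorphM divff ?scale1r// pnatr_eq0.
Qed.

End OperatorPolynomials.

(** * Square roots, nuclear bounds and the trace class; Parseval's identity *)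

Section TraceClass.
Context {R : realType} {H : lmodType R[i]}.
Variable dot : {dot H for Num.conj}.
Hypothesis complete : hilbert_complete dot.
Local Notation Re := complex.Re.
Local Notation normc := Normc.normc.
Local Notation hn := (hn dot).

Lemma bounded_opP (T : H -> H) : linear T ->
  (exists M, forall u, hn (T u) <= M * hn u) -> bounded_op dot T.
Proof.
move=> lT [M hM]; split=> //; exists M => u.
by rewrite !hilbert_normE -rmorphM lecR.
Qed.

Lemma bounded_op_hn (T : H -> H) : bounded_op dot T ->
  exists2 M, 0 < M & forall u, hn (T u) <= M * hn u.
Proof.
move=> [_ [M hM]]; exists (`|M| + 1); first by rewrite ltr_wpDl.
move=> u; have := hM u; rewrite !hilbert_normE -rmorphM lecR => h.
apply: le_trans h _; rewrite ler_wpM2r ?hn_ge0//.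
by apply: le_trans (ler_norm _) _; rewrite lerDl.
Qed.

(** Scaling makes X = 1 - K / M^2 a symmetric contraction. With Y the limit of the iteration, A = M
    (1 - Y) satisfies A^2 = M^2 (1 - X) = K, and A is positive because Y is a contraction. *)
Lemma positive_sqrt (K : H -> H) (M : R) : 0 < M -> linear K -> symmetric_op dot K ->
  (forall u, 0 <= Re (dot (K u) u) <= M ^+ 2 * hn u ^+ 2) ->
  exists A, [/\ positive_op dot A, symmetric_op dot A & forall u, A (A u) = K u].
Proof.
move=> M0 lK sK bK; have M2 : 0 < M ^+ 2 by rewrite exprn_gt0.
pose m := (M ^+ 2)^-1.
have m0 : 0 < m by rewrite invr_gt0.
pose X u := u - m%:C *: K u.
have lX : linear X.
  move=> a u v; rewrite /X lK scalerDr !scalerA opprD addrACA scalerBr scalerA.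
  by rewrite [a * _]mulrC.
have sX : symmetric_op dot X.
  by move=> u v; rewrite dotBl dotBr dotZl dotZr conjc_real sK.
have ReX u : Re (dot (X u) u) = hn u ^+ 2 - m * Re (dot (K u) u).
  by rewrite dotBl dotZl Re_addc Re_oppc -hn_sqr Re_mulc/= mul0r subr0.
have cX : forall u, hn (X u) <= hn u.
  apply: symmetric_contraction => // w; rewrite ReX.
  have /andP[h1 h2] := bK w.
  rewrite subr_ge0 gerBl mulr_ge0 ?(ltW m0)//.
  by rewrite andbT mulrC ler_pdivrMr// mulrC.
have [Y [lY sY cY eY]] := sqrt_iter_limit lX sX cX complete.
pose A u := M%:C *: (u - Y u).
have lA : linear A.
  move=> a u v; rewrite /A lY opprD addrACA -scalerBr scalerDr !scalerA.
  by rewrite [a * _]mulrC.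
have sA : symmetric_op dot A.
  by move=> u v; rewrite dotZl dotZr conjc_real dotBl dotBr sY.
exists A; split=> // [|u].
  split.
    apply: bounded_opP => //; exists (M * 2) => u.
    rewrite hnZ normc_real ger0_norm ?(ltW M0)// -mulrA ler_wpM2l ?(ltW M0)//.
    apply: le_trans (hnD _ _ _) _; rewrite hnN mulr_natl mulr2n lerD2l; exact: cY.
  move=> u; rewrite (symmetric_op_real u sA) ler0c dotZl dotBl Re_mulc/= mul0r subr0.
  rewrite mulr_ge0 ?(ltW M0)// Re_addc Re_oppc subr_ge0 -hn_sqr.
  apply: le_trans (le_trans (ler_norm _) (Re_le_normc _)) _.
  apply: le_trans (CauchySchwarz_hn _ _ _) _.
  by rewrite expr2 ler_wpM2r ?hn_ge0.
rewrite /A (linmapZ lY) (linmapB lY) -scalerBr scalerA -rmorphM -expr2.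
rewrite (_ : _ - _ = m%:C *: K u).
  by rewrite scalerA -rmorphM mulfV ?scale1r// lt0r_neq0.
have -> : m%:C *: K u = u - X u by rewrite subKr.
have -> : X u = Y u + Y u - Y (Y u) by rewrite eY addrK.
by rewrite !opprB addrACA opprD [RHS]addrA.
Qed.

Definition orthonormal_seq (e : nat -> H) := forall j k, dot (e j) (e k) = (j == k)%:R.

(** Orthonormality weakened to Bessel's inequality, the property that survives the application of a
    contraction. *)
Definition bessel_seq N (f : nat -> H) :=
  forall g, \sum_(k < N) normc (dot (f k) g) ^+ 2 <= hn g ^+ 2.

(** Let w be the combination of the e_k with coefficients <g, U e_k>. Then <g, U w> = |w|^2 is the
    sum to be estimated, and Cauchy-Schwarz with |U w| <= |w| gives |w|^2 <= |g| |w|. This avoids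
    the adjoint of U. *)
Lemma orthonormal_contraction_bessel N (e : nat -> H) (U : H -> H) :
  orthonormal_seq e -> linear U -> (forall u, hn (U u) <= hn u) ->
  bessel_seq N (fun k => U (e k)).
Proof.
move=> one lU cU g.
pose w := \sum_(k < N) dot g (U (e k)) *: e k.
set S := \sum_(k < N) _.
have S0 : 0 <= S by apply: sumr_ge0 => k _; rewrite exprn_ge0// normc_ge0.
have SE : S = \sum_(k < N) normc (dot g (U (e k))) ^+ 2.
  by apply: eq_bigr => k _; rewrite dot_conj normc_conj.
have h1 : dot g (U w) = S%:C.
  rewrite (linmap_sum lU) dot_sumr SE rmorph_sum/=.
  by apply: eq_bigr => k _; rewrite (linmapZ lU) dotZr mulrC mulcJE.
have h2 : hn w ^+ 2 = S.
  rewrite hn_sqr dot_suml Re_sum SE; apply: eq_bigr => k _.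
  rewrite dotZl dot_sumr (bigD1 k)//= big1 => [|j /negbTE jk].
    by rewrite addr0 dotZr one eqxx mulr1 mulcJE.
  by rewrite dotZr one eq_sym (inj_eq val_inj) jk mulr0.
have : S <= hn g * hn w.
  have := CauchySchwarz_hn dot g (U w); rewrite h1 normc_real ger0_norm// => h.
  by apply: le_trans h _; rewrite ler_wpM2l ?hn_ge0.
rewrite -h2 expr2 => h3.
have [->|w0] := eqVneq (hn w) 0; first by rewrite mul0r exprn_ge0// hn_ge0.
have {}w0 : 0 < hn w by rewrite lt_neqAle eq_sym w0 hn_ge0.
move: h3; rewrite ler_pM2r// => h3.
by rewrite expr2 ler_pM ?hn_ge0.
Qed.

Lemma orthonormal_bessel N (e : nat -> H) : orthonormal_seq e -> bessel_seq N e.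
Proof. by move=> one; apply: (@orthonormal_contraction_bessel N e id). Qed.

(** The second family ranges over Bessel sequences because in [trace_absolute_value_bounded] it is
    the image of an orthonormal sequence under a contraction U m, where m varies; hence also the
    uniformity of C. *)
Definition nuclear_bounded (beta : H -> H -> R[i]) := exists C : R,
  forall N e f, orthonormal_seq e -> bessel_seq N f ->
    \sum_(k < N) normc (beta (e k) (f k)) <= C.

(* With A playing the role of |T| and Z = 1 - A / c, the operators
   U m = T (1 + Z + ... + Z^(m-1)) / c are contractions which stand in for the
   partial isometry of the polar decomposition: Re <T e, U m e> is
   <A e, e> - <A Z^m e, e>, where the subtracted terms A Z^j = c (Z^j - Z^(j+1))
   telescope, so that for j < m they average to at most c |e|^2 / m. *)
Lemma trace_absolute_value_bounded (T A : H -> H) :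
  linear T -> bounded_op dot A -> symmetric_op dot A ->
  (forall u, 0 <= Re (dot (A u) u)) ->
  (forall u v, dot (T u) (T v) = dot (A u) (A v)) ->
  nuclear_bounded (fun u v => dot (T u) v) ->
  exists C, forall N e, orthonormal_seq e -> \sum_(k < N) Re (dot (A (e k)) (e k)) <= C.
Proof.
move=> lT bA sA A0 TA [C hC]; exists C => N e one.
have [lA _] := bA.
have [c c0 cA] := bounded_op_hn bA.
pose Z u := u - (c^-1)%:C *: A u.
have cV0 : 0 < c^-1 by rewrite invr_gt0.
have lZ : linear Z.
  move=> a u v; rewrite /Z lA scalerDr !scalerA opprD addrACA scalerBr scalerA.
  by rewrite [a * _]mulrC.
have sZ : symmetric_op dot Z.
  by move=> u v; rewrite dotBl dotBr dotZl dotZr conjc_real sA.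
have ReZ u : Re (dot (Z u) u) = hn u ^+ 2 - c^-1 * Re (dot (A u) u).
  by rewrite dotBl dotZl Re_addc Re_oppc -hn_sqr Re_mulc/= mul0r subr0.
have Z01 w : 0 <= Re (dot (Z w) w) <= hn w ^+ 2.
  rewrite ReZ subr_ge0 gerBl mulr_ge0 ?(ltW cV0)// andbT mulrC ler_pdivrMr//.
  apply: le_trans (le_trans (ler_norm _) (Re_le_normc _)) _.
  apply: le_trans (CauchySchwarz_hn _ _ _) _.
  by rewrite expr2 -mulrA [hn w * c]mulrC mulrCA mulrA ler_wpM2r ?hn_ge0.
have cZ := symmetric_contraction lZ sZ Z01.
pose Zn j := iter j Z.
have ZnS j u : Zn j.+1 u = Z (Zn j u) by [].
have ZnD i j u : Zn (i + j)%N u = Zn i (Zn j u) by exact: iterD.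
have ZnC j u : Zn j (Z u) = Z (Zn j u) by rewrite -ZnS /Zn iterSr.
have lZn j : linear (Zn j).
  by elim: j => [//|j IH] a u v; rewrite !ZnS IH lZ.
have sZn j : symmetric_op dot (Zn j).
  by elim: j => [//|j IH] u v; rewrite ZnS sZ IH ZnC.
have cZn i u : hn (Zn i u) <= hn u.
  by elim: i => [//|i IH]; exact: le_trans (cZ _) IH.
have Zn01 j w : 0 <= Re (dot (Zn j w) w) <= hn w ^+ 2.
  (* Powers of Z are positive by parity: <Z^(2i) w, w> = |Z^i w|^2, and <Z^(2i+1) w, w> is the form
     of Z at Z^i w. *)
  have [i [->|->]] : exists i, j = (i + i)%N \/ j = (i + i).+1.
    exists j./2; rewrite addnn; have h := odd_double_half j.
    by case: (odd j) h => h; [right|left]; rewrite -[LHS]h.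
  - rewrite ZnD sZn -hn_sqr exprn_ge0 ?hn_ge0//=.
    by rewrite ler_pXn2r// nnegrE hn_ge0.
  - rewrite ZnS ZnD -ZnC -ZnC sZn ZnC; have /andP[-> h] /= := Z01 (Zn i w).
    by apply: le_trans h _; rewrite ler_pXn2r// nnegrE hn_ge0.
pose U m u := T ((c^-1)%:C *: \sum_(j < m) Zn j u).
have AU m u : A ((c^-1)%:C *: \sum_(j < m) Zn j u) = u - Zn m u.
  rewrite (linmapZ lA) (linmap_sum lA) scaler_sumr.
  rewrite (eq_bigr (fun j : 'I_m => - (Zn j.+1 u - Zn j u))); last first.
    by move=> j _; rewrite ZnS /Z opprB subKr.
  rewrite sumrN -(big_mkord xpredT (fun j => Zn j.+1 u - Zn j u)).
  by rewrite telescope_sumr// opprB.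
have lU m : linear (U m).
  move=> a u v; rewrite /U -lT; congr T.
  rewrite (eq_bigr (fun j : 'I_m => a *: Zn j u + Zn j v)) => [|j _]; last exact: lZn.
  by rewrite big_split/= -scaler_sumr scalerDr !scalerA [a * _]mulrC.
have cU m u : hn (U m u) <= hn u.
  (* As |T x| = |A x|, the norm of U m u is that of (1 - Z^m) u, and 1 - Z^m is symmetric with form
     between 0 and |u|^2. *)
  have -> : hn (U m u) = hn (u - Zn m u) by rewrite -AU /hn /U TA.
  apply: (@symmetric_contraction _ _ dot (fun u => u - Zn m u)) => {u} [a u v|u v|u].
  - by rewrite lZn opprD addrACA -scalerBr.
  - by rewrite dotBl dotBr sZn.
  - rewrite dotBl Re_addc Re_oppc -hn_sqr; have /andP[h1 h2] := Zn01 m u.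
    by rewrite subr_ge0 h2/= gerBl.
pose d m u := Re (dot (A (Zn m u)) u).
have TU m u : Re (dot (T u) (U m u)) = Re (dot (A u) u) - d m u.
  by rewrite TA AU dotBr Re_addc Re_oppc; congr (_ - _); rewrite /d sA [dot u _]dot_conj; case: (dot (A _) u).
have dE m u : d m u = c * (Re (dot (Zn m u) u) - Re (dot (Zn m.+1 u) u)).
  rewrite ZnS /Z dotBl Re_addc Re_oppc opprB addrCA subrr addr0 dotZl Re_mulc/= mul0r subr0.
  by rewrite mulrA divff ?mul1r// lt0r_neq0.
set S := \sum_(k < N) _.
have SC m : S <= C + \sum_(k < N) d m (e k).
  rewrite -lerBlDr -sumrB; under eq_bigr do rewrite -TU.
  apply: le_trans (hC N e _ one (orthonormal_contraction_bessel N one (lU m) (cU m))).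
  apply: ler_sum => k _; apply: le_trans (ler_norm _) _; exact: Re_le_normc.
have SC' m : m%:R * (S - C) <= c * N%:R.
  rewrite mulr_natl -{1}(card_ord m) -sumr_const.
  apply: (@le_trans _ _ (\sum_(j < m) \sum_(k < N) d j (e k))).
    by apply: ler_sum => j _; rewrite lerBlDl.
  have -> : c * N%:R = \sum_(k < N) c by rewrite sumr_const card_ord mulr_natr.
  rewrite exchange_big/=; apply: ler_sum => k _.
  rewrite (eq_bigr (fun j : 'I_m => - (c * (Re (dot (Zn j.+1 (e k)) (e k)) -
     Re (dot (Zn j (e k)) (e k)))))); last first.
    by move=> j _; rewrite dE -mulrN opprB.
  rewrite sumrN -mulr_sumr.
  rewrite -(big_mkord xpredT (fun j => Re (dot (Zn j.+1 (e k)) (e k)) -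
     Re (dot (Zn j (e k)) (e k)))) telescope_sumr// -mulrN opprB.
  rewrite -[leRHS]mulr1 ler_wpM2l ?(ltW c0)//.
  have /andP[h _] := Zn01 m (e k).
  by rewrite [Zn 0 _]/= one eqxx/= gerBl.
rewrite leNgt; apply/negP => CS.
have SC0 : 0 < S - C by rewrite subr_gt0.
(* An integer m above c N / (S - C) contradicts m (S - C) <= c N. *)
have := SC' (Num.bound (c * N%:R / (S - C))).
rewrite -ler_pdivlMr// leNgt => /negP; apply.
by apply: archi_boundP; rewrite divr_ge0 ?mulr_ge0 ?(ltW c0) ?(ltW SC0).
Qed.

(** Linearity of S follows from nondegeneracy of [dot], and its bound from |S u|^2 = <T (S u), u> <=
    M |S u| |u|. *)
Lemma adjoint_exists_bounded (T S : H -> H) : bounded_op dot T ->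
  (forall u v, dot (T u) v = dot u (S v)) -> adjoint_op dot T S.
Proof.
move=> bT TS; split=> //; have [M M0 hM] := bounded_op_hn bT.
apply: bounded_opP.
  move=> a u v; apply: (@dot_inj _ _ dot) => w.
  by rewrite dot_conj -TS dotDr dotZr !TS dotDl dotZl (rmorphD conjc) (rmorphM conjc)/= conjcK -!dot_conj.
exists M => u.
have := CauchySchwarz_hn dot (T (S u)) u.
rewrite TS dotuu normc_real ger0_norm ?exprn_ge0 ?hn_ge0// => h.
have {}h : hn (S u) ^+ 2 <= M * hn (S u) * hn u.
  by apply: le_trans h _; rewrite ler_wpM2r ?hn_ge0.
have [->|S0] := eqVneq (hn (S u)) 0; first by rewrite mulr_ge0 ?hn_ge0 ?(ltW M0).
have {}S0 : 0 < hn (S u) by rewrite lt_neqAle eq_sym S0 hn_ge0.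
by move: h; rewrite expr2 mulrAC ler_pM2r.
Qed.

Lemma trace_class_nuclear (T S : H -> H) : bounded_op dot T ->
  (forall u v, dot (T u) v = dot u (S v)) ->
  nuclear_bounded (fun u v => dot (T u) v) -> trace_class dot T.
Proof.
move=> bT TS nT; split=> //.
have aT := adjoint_exists_bounded bT TS.
have [M M0 hM] := bounded_op_hn bT.
have [[lT _] [[lS _] _]] := (bT, aT).
have [A [pA sA AA]] : exists A, [/\ positive_op dot A, symmetric_op dot A &
    forall u, A (A u) = S (T u)].
  apply: (positive_sqrt M0).
  - by move=> a u v; rewrite lT lS.
  - by move=> u v; rewrite -TS dot_conj -TS -dot_conj.
  - move=> u; rewrite dot_conj -TS -dot_conj -hn_sqr exprn_ge0 ?hn_ge0//=.
    by rewrite -exprMn ler_pXn2r// nnegrE ?mulr_ge0 ?hn_ge0 ?(ltW M0).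
exists A; first by split=> //; exists S.
have A0 u : 0 <= Re (dot (A u) u).
  by have := pA.2 u; rewrite lecE => /andP[].
have [|C hC] := trace_absolute_value_bounded lT pA.1 sA A0 _ nT.
  by move=> u v; rewrite TS -AA sA.
move=> e [one _]; apply: (@le_lt_trans _ _ C%:E); last exact: ltry.
apply: lime_le.
  by apply: is_cvg_nneseries => k _ _; rewrite lee_fin.
apply: nearW => N; rewrite sumEFin lee_fin big_mkord; exact: hC.
Qed.

(** The partial expansions s of u are Cauchy, since |s m - s k|^2 = b m - b k with b monotone and
    bounded by |u|^2; by maximality of e their limit is u. The bound uniform in N supplies the
    majorant for dominated convergence in [nuclear_form_integral]. *)
Lemma parseval (e : nat -> H) u v : orthonormal_basis dot e ->
  (forall N, normc (\sum_(k < N) dot u (e k) * dot (e k) v) <= hn u * hn v) /\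
  (fun N => normc (\sum_(k < N) dot u (e k) * dot (e k) v - dot u v)) @ \oo --> (0 : R).
Proof.
move=> [one maxe].
pose s N := \sum_(k < N) dot u (e k) *: e k.
have sv N w : \sum_(k < N) dot u (e k) * dot (e k) w = dot (s N) w.
  by rewrite dot_suml; apply: eq_bigr => k _; rewrite dotZl.
have se N k : dot (s N) (e k) = if (k < N)%N then dot u (e k) else 0.
  rewrite -sv; case: ifPn => kN.
    rewrite (bigD1 (Ordinal kN))//= big1 => [|j /negbTE jk].
      by rewrite addr0 one eqxx mulr1.
    by rewrite one; move: jk; rewrite -val_eqE/= => ->; rewrite mulr0.
  rewrite big1// => j _; rewrite one (_ : (j == k :> nat) = false) ?mulr0//.
  by apply/negbTE; apply: contra kN => /eqP <-.
pose b N := \sum_(k < N) normc (dot (e k) u) ^+ 2.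
have ss k m : (k <= m)%N -> dot (s m) (s k) = (b k)%:C.
  move=> km; rewrite {2}/s dot_sumr rmorph_sum/=; apply: eq_bigr => j _.
  rewrite dotZr se (leq_trans (ltn_ord j) km) mulrC mulcJE.
  by rewrite [dot u _]dot_conj normc_conj.
have sb k m : (k <= m)%N -> hn (s m - s k) ^+ 2 = b m - b k.
  move=> km; rewrite hn_sqr dotBl !dotBr (ss _ _ km) !(ss _ _ (leqnn _)) [dot (s k) _]dot_conj.
  by rewrite (ss _ _ km) conjc_real subrr subr0 -rmorphB.
have bu N : b N <= hn u ^+ 2 by exact: (orthonormal_bessel N one).
have su N : hn (s N) <= hn u.
  by rewrite -(@ler_pXn2r _ 2)// ?nnegrE ?hn_ge0// hn_sqr (ss N N (leqnn N)); exact: bu.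
split=> [N|].
  rewrite sv; apply: le_trans (CauchySchwarz_hn _ _ _) _.
  by rewrite ler_wpM2r ?hn_ge0.
have nd : nondecreasing_seq b.
  apply/nondecreasing_seqP => k; rewrite /b big_ord_recr/= lerDl.
  by rewrite exprn_ge0// normc_ge0.
have cv : cvgn b.
  by apply: nondecreasing_is_cvgn => //; exists (hn u ^+ 2) => _ [k _ <-].
have [w sw] : exists w, hcvg dot s w.
  apply: complete => eps eps0; have eps2 : 0 < eps ^+ 2 by rewrite exprn_gt0.
  have /cvgrPdist_lt /(_ _ eps2) [N _ hN] := cv.
  exists N.
  have key m k : (N <= k)%N -> (k <= m)%N -> hn (s m - s k) <= eps.
    move=> Nk km; rewrite -(@ler_pXn2r _ 2)// ?nnegrE ?hn_ge0 ?(ltW eps0)//.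
    rewrite sb//; apply: (@le_trans _ _ (limn b - b k)).
      by rewrite lerD2r; exact: nondecreasing_cvgn_le.
    by apply: le_trans (ler_norm _) (ltW (hN k Nk)).
  move=> m k Nm Nk; case: (leqP k m) => [|/ltnW] km; first exact: key.
  by rewrite hnB_sym; exact: key.
suff uw : u = w.
  rewrite {2}uw (_ : (fun N => _) = fun N => normc (dot (s N) v - dot w v)).
    exact: hcvg_dot.
  by apply/funext => N; rewrite sv.
apply/eqP; rewrite -subr_eq0; apply/eqP/maxe => k; rewrite dotBl.
rewrite (hcvg_dot_unique sw (z := dot u (e k))) ?subrr//.
apply: cvg_near_cst; exists k.+1 => // N /= kN.
by rewrite se kN subrr Normc.normc0.
Qed.

End TraceClass.

(** * Primitives of integrable functions *)

Section RealPrimitives.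
Context {R : realType}.
Local Notation mu := (@lebesgue_measure R).
Local Notation I01 := (I01 R).
Local Notation L1 f := (mu.-integrable I01 (EFin \o f)).
Implicit Types f g h : R -> R.

Lemma measurable_I01 : measurable I01.
Proof. exact: measurable_itv. Qed.
Local Hint Resolve measurable_I01 : core.

Lemma I01P x : I01 x <-> 0 <= x <= 1.
Proof. by rewrite /Defs.I01/= in_itv. Qed.

Lemma mu_I01 : mu I01 = 1%:E.
Proof. by rewrite lebesgue_measure_itv/= lte_fin ltr01 sube0. Qed.

Lemma L1_ext f g : (forall x, I01 x -> f x = g x) -> L1 f -> L1 g.
Proof. by move=> fg; apply: eq_integrable => // x /set_mem /fg /= ->. Qed.

Lemma L1D f g : L1 f -> L1 g -> L1 (fun x => f x + g x).
Proof. exact: integrableD. Qed.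

Lemma L1Z a f : L1 f -> L1 (fun x => a * f x).
Proof. exact: integrableZl. Qed.

Lemma L1N f : L1 f -> L1 (fun x => - f x).
Proof. by move=> /(L1Z (-1)); apply: L1_ext => x _; rewrite mulN1r. Qed.

Lemma L1B f g : L1 f -> L1 g -> L1 (fun x => f x - g x).
Proof. by move=> fi gi; apply: L1D => //; exact: L1N. Qed.

Lemma L1_0 : L1 (fun=> 0).
Proof. exact: integrable0. Qed.

Lemma L1_sum (I : Type) (r : seq I) (F : I -> R -> R) :
  (forall i, L1 (F i)) -> L1 (fun x => \sum_(i <- r) F i x).
Proof.
move=> Fi; elim: r => [|i r IH].
  by apply: L1_ext L1_0 => x _; rewrite big_nil.
by apply: L1_ext (L1D (Fi i) IH) => x _; rewrite big_cons.
Qed.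

Lemma L1_norm f : L1 f -> L1 (fun x => `|f x|).
Proof. exact: integrable_norm. Qed.

Lemma L1_measurable f : L1 f -> measurable_fun I01 f.
Proof. by move=> /measurable_int /measurable_EFinP. Qed.

Lemma le_L1 f g : measurable_fun I01 f -> L1 g ->
  (forall x, I01 x -> `|f x| <= g x) -> L1 f.
Proof.
move=> mf gi fg; apply: (le_integrable _ _ _ gi) => //.
  exact/measurable_EFinP.
move=> x /fg fgx; rewrite /= lee_fin; apply: le_trans fgx _; exact: ler_norm.
Qed.

(** These functions are multipliers of both L^1 and L^2, and every primitive is one of them
    ([prim_mbd]). *)
Definition mbd f := measurable_fun I01 f /\
  exists M : R, forall x, I01 x -> `|f x| <= M.

Lemma mbd_ext f g : (forall x, I01 x -> f x = g x) -> mbd f -> mbd g.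
Proof.
move=> fg [mf [M hM]]; split.
  by apply: eq_measurable_fun mf => x /set_mem /fg.
by exists M => x x01; rewrite -fg// hM.
Qed.

Lemma mbd_cst a : mbd (fun=> a).
Proof. by split; [exact: measurable_cst|exists `|a|]. Qed.

Lemma mbdD f g : mbd f -> mbd g -> mbd (fun x => f x + g x).
Proof.
move=> [mf [M hM]] [mg [N hN]]; split; first exact: measurable_funD.
exists (M + N) => x x01; apply: le_trans (ler_normD _ _) _.
by rewrite lerD ?hM ?hN.
Qed.

Lemma mbdM f g : mbd f -> mbd g -> mbd (fun x => f x * g x).
Proof.
move=> [mf [M hM]] [mg [N hN]]; split; first exact: measurable_funM.
by exists (M * N) => x x01; rewrite normrM ler_pM ?hM ?hN.
Qed.

Lemma mbdN f : mbd f -> mbd (fun x => - f x).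
Proof.
by move=> /(mbdM (mbd_cst (-1))); apply: mbd_ext => x _; rewrite mulN1r.
Qed.

Lemma mbdB f g : mbd f -> mbd g -> mbd (fun x => f x - g x).
Proof. by move=> ? ?; apply: mbdD => //; exact: mbdN. Qed.

Lemma mbd_sum (I : Type) (r : seq I) (F : I -> R -> R) :
  (forall i, mbd (F i)) -> mbd (fun x => \sum_(i <- r) F i x).
Proof.
move=> Fi; elim: r => [|i r IH].
  by apply: mbd_ext (mbd_cst 0) => x _; rewrite big_nil.
by apply: mbd_ext (mbdD (Fi i) IH) => x _; rewrite big_cons.
Qed.

Lemma measurable_le_ind (x : R) : measurable_fun setT (fun t : R => (t <= x)%R%:R : R).
Proof.
have -> : (fun t : R => (t <= x)%R%:R) = \1_(`]-oo, x]) :> (R -> R).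
  by apply/funext => t; rewrite indicE mem_setE in_itv.
by apply: measurable_indic; exact: measurable_itv.
Qed.

Lemma mbd_le_ind (x : R) : mbd (fun t => (t <= x)%R%:R).
Proof.
split; first exact: measurable_funS (measurable_le_ind x).
by exists 1 => t _; case: (t <= x); rewrite ?normr1 ?normr0.
Qed.

Lemma L1M f g : L1 f -> mbd g -> L1 (fun x => f x * g x).
Proof.
move=> fi [mg [M hM]]; apply: (le_L1 (g := fun x => M * `|f x|)).
- by apply: measurable_funM => //; exact: L1_measurable.
- exact/L1Z/L1_norm.
- by move=> x x01; rewrite normrM mulrC ler_wpM2r// hM.
Qed.

Lemma mbd_L1 f : mbd f -> L1 f.
Proof.
move=> [mf [M hM]]; apply: measurable_bounded_integrable => //.
  by apply: (@le_lt_trans _ _ 1%E); [rewrite -mu_I01|exact: ltry].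
exists M; rewrite num_real; split=> // N MN x x01.
exact: le_trans (hM x x01) (ltW MN).
Qed.

Definition prim f (x : R) : R := \int[mu]_(t in `[0, x]) f t.

Lemma primE f x : I01 x -> prim f x = \int[mu]_(t in I01) (f t * (t <= x)%R%:R).
Proof.
move=> /I01P /andP[x0 x1].
have -> : \int[mu]_(t in I01) (f t * (t <= x)%R%:R) =
    \int[mu]_(t in I01) ((f \_ `]-oo, x]) t).
  apply: eq_Rintegral => t _; rewrite patchE mem_setE in_itv/=.
  by case: (t <= x); rewrite ?mulr1 ?mulr0.
rewrite -Rintegral_mkcondr; congr Rintegral.
apply/seteqP; split => t /=; rewrite /Defs.I01/= !in_itv/=.
  by move=> /andP[-> tx]; rewrite tx (le_trans tx x1).
by move=> [/andP[-> _] ->].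
Qed.

Lemma prim1 f : prim f 1 = \int[mu]_(t in I01) f t.
Proof. by []. Qed.

Lemma prim0 f : prim f 0 = 0.
Proof. by rewrite /prim set_itv1 Rintegral_set1. Qed.

Lemma L1_itv f x : I01 x -> L1 f -> mu.-integrable `[0, x] (EFin \o f).
Proof.
move=> /I01P /andP[x0 x1]; apply: integrableS => //.
by move=> t; rewrite /Defs.I01/= !in_itv/= => /andP[-> /le_trans ->].
Qed.

Lemma primD f g x : I01 x -> L1 f -> L1 g ->
  prim (fun t => f t + g t) x = prim f x + prim g x.
Proof. by move=> x01 fi gi; rewrite /prim RintegralD//; exact: L1_itv. Qed.

Lemma primZ a f x : I01 x -> L1 f -> prim (fun t => a * f t) x = a * prim f x.
Proof. by move=> x01 fi; rewrite /prim RintegralZl//; exact: L1_itv. Qed.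

Lemma primN f x : I01 x -> L1 f -> prim (fun t => - f t) x = - prim f x.
Proof.
move=> x01 fi; rewrite -mulN1r -primZ//.
by apply: eq_Rintegral => t _; rewrite mulN1r.
Qed.

Lemma eq_prim f g x : I01 x -> (forall t, I01 t -> f t = g t) ->
  prim f x = prim g x.
Proof.
move=> /I01P /andP[x0 x1] fg; apply: eq_Rintegral => t.
by rewrite mem_setE in_itv/= => /andP[t0 tx]; apply: fg; apply/I01P; rewrite t0 (le_trans tx).
Qed.

Lemma prim_sum (I : Type) (r : seq I) (F : I -> R -> R) x : I01 x ->
  (forall i, L1 (F i)) ->
  prim (fun t => \sum_(i <- r) F i t) x = \sum_(i <- r) prim (F i) x.
Proof.
move=> x01 Fi; elim: r => [|i r IH].
  rewrite big_nil (@eq_prim _ (fun t => 0 * 0))//.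
    by rewrite primZ ?mul0r//; exact: L1_0.
  by move=> t _; rewrite big_nil mul0r.
rewrite big_cons -IH -primD//; last exact: L1_sum.
by apply: eq_prim => // t _; rewrite big_cons.
Qed.

Lemma le_prim f g x : I01 x -> L1 f -> L1 g ->
  (forall t, I01 t -> f t <= g t) -> prim f x <= prim g x.
Proof.
move=> x01 fi gi fg; apply: le_Rintegral => //; try exact: L1_itv.
move: x01 => /I01P /andP[x0 x1] t /=; rewrite in_itv/= => /andP[t0 tx].
by apply: fg; apply/I01P; rewrite t0 (le_trans tx).
Qed.

Lemma le_norm_prim f x : I01 x -> L1 f -> `|prim f x| <= prim (fun t => `|f t|) x.
Proof. by move=> x01 fi; apply: le_normr_Rintegral => //; exact: L1_itv. Qed.

Lemma prim_ge0 f x : (forall t, I01 t -> 0 <= f t) -> I01 x -> 0 <= prim f x.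
Proof.
move=> f0 /I01P /andP[x0 x1]; apply: Rintegral_ge0 => t /=; rewrite in_itv/=.
by move=> /andP[t0 tx]; apply/f0/I01P; rewrite t0 (le_trans tx).
Qed.

Lemma prim_le1 f x : L1 f -> (forall t, I01 t -> 0 <= f t) -> I01 x ->
  prim f x <= prim f 1.
Proof.
move=> fi f0 x01; rewrite primE// prim1; apply: le_Rintegral => //.
  exact: L1M fi (mbd_le_ind x).
by move=> t t01; case: (t <= x); rewrite ?mulr1 ?mulr0// f0.
Qed.

Lemma prim_mbd f : L1 f -> mbd (prim f).
Proof.
move=> fi; split.
  apply: subspace_continuous_measurable_fun => //.
  exact: (parameterized_integral_continuous ler01 fi).
exists (prim (fun t => `|f t|) 1) => x x01; apply: le_trans (le_norm_prim x01 fi) _.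
by apply: prim_le1 => //; exact: L1_norm.
Qed.

Lemma prim_dominated_cvg (f_ : nat -> R -> R) f g x : I01 x ->
  (forall k, measurable_fun I01 (f_ k)) ->
  (forall t, I01 t -> f_ ^~ t @ \oo --> f t) ->
  L1 g -> (forall k t, I01 t -> `|f_ k t| <= g t) ->
  L1 f /\ (fun k => prim (f_ k) x) @ \oo --> prim f x.
Proof.
move=> x01 mf cf gi fg.
have mf' : measurable_fun I01 f.
  exact: (measurable_fun_cvg mf cf).
have fL1 : L1 f.
  apply: (le_L1 mf' gi) => t t01.
  have h : (fun k => `|f_ k t|) @ \oo --> `|f t| by apply: cvg_norm; exact: cf.
  by apply: (cvgr_to_le h); apply: nearW => k; exact: fg.
split=> //.
have sub : `[0, x] `<=` I01.
  move: x01 => /I01P /andP[x0 x1].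
  by move=> t; rewrite /Defs.I01/= !in_itv/= => /andP[-> /le_trans ->].
have [] := @dominated_convergence _ _ R mu `[0, x] (measurable_itv _)
  (fun k => EFin \o f_ k) (EFin \o f) (EFin \o g).
- by move=> k; apply/measurable_EFinP; exact: measurable_funS (mf k).
- by apply/measurable_EFinP; exact: measurable_funS mf'.
- by apply: aeW => t tx; apply: cvg_EFin; [exact: nearW|exact: cf (sub _ tx)].
- exact: L1_itv.
- by apply: aeW => t k tx; rewrite /= lee_fin; exact: fg (sub _ tx).
move=> _ _ h; apply: fine_cvg; rewrite fineK//.
exact: integrable_fin_num (L1_itv x01 fL1).
Qed.

(** The two closed half-lines share only the point t, which is null. *)
Lemma Rintegral_ind_split (u : R -> R) (t : R) : mu.-integrable setT (EFin \o u) ->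
  \int[mu]_s (u s * (t <= s)%R%:R) = \int[mu]_s u s - \int[mu]_s (u s * (s <= t)%R%:R).
Proof.
move=> ui.
have indE (v : R -> R) (A : set R) : \int[mu]_s (v \_ A) s = \int[mu]_(s in A) v s.
  by rewrite [RHS]Rintegral_mkcond.
have e1 : (fun s => u s * (t <= s)%R%:R) = u \_ `[t, +oo[.
  apply/funext => s; rewrite patchE mem_setE in_itv/= andbT.
  by case: (t <= s); rewrite ?mulr1 ?mulr0.
have e2 : (fun s => u s * (s <= t)%R%:R) = u \_ `]-oo, t].
  apply/funext => s; rewrite patchE mem_setE in_itv/=.
  by case: (s <= t); rewrite ?mulr1 ?mulr0.
rewrite e1 e2 !indE.
have ii (A : set R) : measurable A -> mu.-integrable A (EFin \o u).
  by move=> mA; apply: integrableS ui.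
rewrite -(@Rintegral_itv_obnd_cbnd _ t +oo%O u); last exact: ii.
apply/eqP; rewrite eq_sym subr_eq addrC eq_sym; apply/eqP.
rewrite -Rintegral_setU//.
- congr Rintegral; apply/seteqP; split => s //= _; rewrite !in_itv/= andbT.
  by case: (lerP s t) => _; [left|right].
- by apply: ii; apply: measurableU.
- apply/disj_setPS => s [] /=; rewrite !in_itv/= andbT => st ts.
  by move: (le_lt_trans st ts); rewrite ltxx.
Qed.

(** Fubini for u(s) v(t) on the half-plane t <= s. Joint integrability comes from the majorant
    |u(s)| |v|_1 of the inner integral of the absolute value. *)
Lemma Fubini_triangle (u v : R -> R) :
  mu.-integrable setT (EFin \o u) -> mu.-integrable setT (EFin \o v) ->
  \int[mu]_s (u s * \int[mu]_t (v t * (t <= s)%R%:R)) =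
  \int[mu]_t (v t * \int[mu]_s (u s * (t <= s)%R%:R)).
Proof.
move=> ui vi.
have mu_ : measurable_fun setT u by move/measurable_int/measurable_EFinP: ui.
have mv_ : measurable_fun setT v by move/measurable_int/measurable_EFinP: vi.
pose D : set (R * R) := [set z | (z.2 <= z.1)%R].
have mD : measurable_fun setT (fun z : R * R => (z.2 <= z.1)%R%:R : R).
  have -> : (fun z : R * R => (z.2 <= z.1)%R%:R) =
      (fun x : R => (x <= 0)%R%:R : R) \o (fun z : R * R => z.2 - z.1).
    by apply/funext => z /=; rewrite subr_le0.
  apply: measurableT_comp; first exact: measurable_le_ind.
  exact: measurable_funB.
pose h (z : R * R) := (u z.1 * v z.2 * (z.2 <= z.1)%R%:R)%:E.
have mh : measurable_fun setT h.
  apply/measurable_EFinP; apply: measurable_funM => //; apply: measurable_funM.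
    exact: measurableT_comp.
  exact: measurableT_comp.
have vs s : mu.-integrable setT (EFin \o (fun t => v t * (t <= s)%R%:R)).
  apply: (le_integrable _ _ _ vi) => //.
    by apply/measurable_EFinP; apply: measurable_funM => //; exact: measurable_le_ind.
  move=> t _ /=; rewrite lee_fin normrM ler_piMr//.
  by case: (t <= s); rewrite ?normr1 ?normr0.
have us t : mu.-integrable setT (EFin \o (fun s => u s * (t <= s)%R%:R)).
  apply: (le_integrable _ _ _ ui) => //.
    apply/measurable_EFinP; apply: measurable_funM => //.
    have -> : (fun s => (t <= s)%R%:R : R) = (fun x => (x <= 0)%R%:R) \o (fun s => t - s).
      by apply/funext => s /=; rewrite subr_le0.
    apply: measurableT_comp; first exact: measurable_le_ind.
    exact: measurable_funB.
  move=> s _ /=; rewrite lee_fin normrM ler_piMr//.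
  by case: (t <= s); rewrite ?normr1 ?normr0.
have ih : (mu \x mu)%E.-integrable setT h.
  apply/integrable12ltyP => //.
  apply: (@le_lt_trans _ _ (\int[mu]_s (`|u s| * fine (\int[mu]_t `|v t|%:E))%:E)%E).
    apply: ge0_le_integral => //.
    - by move=> s _; apply: integral_ge0.
    - apply: (@measurable_fun_fubini_tonelli_F _ _ _ _ _ mu (fun z => `|h z|)%E) => //.
      exact: measurableT_comp.
    - apply/measurable_EFinP; apply: measurable_funM => //; exact: measurableT_comp.
    move=> s _; rewrite EFinM fineK; last first.
      have /integrableP[_ hv] := vi; rewrite ge0_fin_numE//; exact: integral_ge0.
    rewrite -ge0_integralZl//; last first.
      by apply/measurable_EFinP; exact: measurableT_comp.
    apply: ge0_le_integral => //.
    - apply: measurableT_comp => //; apply: measurableT_comp => //.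
    - apply/measurable_EFinP; apply: measurable_funM => //; exact: measurableT_comp.
    move=> t _; rewrite /h /= lee_fin normrM normrM ler_piMr ?mulr_ge0//.
    by case: (t <= s); rewrite ?normr1 ?normr0.
  have iu := integrable_norm ui.
  have /integrableP[_] := integrableZr measurableT (fine (\int[mu]_t `|v t|%:E)%E) iu.
  apply: le_lt_trans; apply: ge0_le_integral => //.
  - by move=> s _; rewrite lee_fin mulr_ge0// fine_ge0// integral_ge0.
  - apply/measurable_EFinP; apply: measurable_funM => //; exact: measurableT_comp.
  - by apply: measurableT_comp => //; exact: (measurable_int _ (integrableZr measurableT _ iu)).
  - by move=> s _; rewrite /= lee_fin ler_norm.
have := Fubini ih; rewrite /Rintegral => F.
transitivity (fine (\int[mu]_x \int[mu]_y h (x, y))%E); last rewrite F; congr fine.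
- apply: eq_integral => s _; rewrite EFinM fineK; last exact: integrable_fin_num (vs s).
  rewrite -integralZl//; last exact: vs.
  by apply: eq_integral => t _; rewrite /h/= -EFinM mulrA.
- apply: eq_integral => t _; rewrite EFinM fineK; last exact: integrable_fin_num (us t).
  rewrite -integralZl//; last exact: us.
  by apply: eq_integral => s _; rewrite /h/= -EFinM mulrA [u s * v t]mulrC.
Qed.

(** The product rule in integrated form: the left side is an integral over the square [0, x]^2,
    which the diagonal cuts into two triangles. *)
Lemma prim_mul f g x : I01 x -> L1 f -> L1 g ->
  prim f x * prim g x = prim (fun s => f s * prim g s + prim f s * g s) x.
Proof.
move=> x01 fi gi; have /I01P/andP[x0 x1] := x01.
have pf := prim_mbd fi; have pg := prim_mbd gi.
pose u := f \_ `[0, x]; pose v := g \_ `[0, x].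
have ui : mu.-integrable setT (EFin \o u).
  rewrite -restrict_EFin.
  exact: ((@integrable_mkcond _ _ R mu _ _ (measurable_itv _)).1 (L1_itv x01 fi)).
have vi : mu.-integrable setT (EFin \o v).
  rewrite -restrict_EFin.
  exact: ((@integrable_mkcond _ _ R mu _ _ (measurable_itv _)).1 (L1_itv x01 gi)).
have key (w : R -> R) s : s \in `[0, x] ->
    \int[mu]_t ((w \_ `[0, x]) t * (t <= s)%R%:R) = prim w s.
  rewrite in_itv/= => /andP[s0 sx]; rewrite /prim [RHS]Rintegral_mkcond.
  apply: eq_Rintegral => t _; rewrite !patchE !mem_setE !in_itv/=.
  case: (lerP t s) => ts; last by rewrite mulr0 andbF.
  by rewrite mulr1 (le_trans ts sx).
have := Fubini_triangle ui vi.
under [X in _ = X -> _]eq_Rintegral do rewrite Rintegral_ind_split//.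
have e1 : \int[mu]_s (u s * \int[mu]_t (v t * (t <= s)%R%:R)) =
    prim (fun s => f s * prim g s) x.
  rewrite /prim [RHS]Rintegral_mkcond; apply: eq_Rintegral => s _.
  rewrite /u !patchE mem_setE; case: ifPn => sx; last by rewrite mul0r.
  by rewrite key.
have e2 : \int[mu]_t (v t * (\int[mu]_s u s - \int[mu]_s (u s * (s <= t)%R%:R))) =
    prim (fun t => prim f x * g t - prim f t * g t) x.
  rewrite /prim [RHS]Rintegral_mkcond; apply: eq_Rintegral => s _.
  rewrite /v !patchE mem_setE; case: ifPn => sx; last by rewrite mul0r.
  by rewrite key// -[X in g s * (X - _)]Rintegral_mkcond mulrBr mulrC [g s * _]mulrC.
rewrite e1 e2 => E.
rewrite primD//; last 2 first.
- exact: L1M.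
- by apply: L1_ext (L1M gi pf) => s _; rewrite mulrC.
rewrite E -primZ// -primD//; last 2 first.
- apply: L1B; first exact: L1Z.
  by apply: L1_ext (L1M gi pf) => s _; rewrite mulrC.
- by apply: L1_ext (L1M gi pf) => s _; rewrite mulrC.
by apply: eq_prim => // s _; rewrite subrK.
Qed.

End RealPrimitives.

(** * Linear systems with integrable coefficients, by Picard iteration *)

Section RealLinearODE.
Context {R : realType}.
Local Notation mu := (@lebesgue_measure R).
Local Notation I01 := (I01 R).
Local Notation L1 f := (mu.-integrable I01 (EFin \o f)).
Variables (I : finType) (a : I -> I -> R -> R) (c : I -> R).
Hypothesis a_L1 : forall i j, L1 (a i j).

Let alpha t := \sum_i \sum_j `|a i j t|.
Let A := prim alpha.
Let C := \sum_i `|c i|.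

Let alpha_L1 : L1 alpha.
Proof. by do 2 (apply: L1_sum => ?); exact: L1_norm. Qed.

Let alpha_ge0 t : 0 <= alpha t.
Proof. by do 2 (apply: sumr_ge0 => ? _). Qed.

Let A_ge0 x : I01 x -> 0 <= A x.
Proof. exact: prim_ge0. Qed.

Let A_mbd k : mbd (fun t => A t ^+ k).
Proof.
elim: k => [|k IH]; first by apply: mbd_ext (mbd_cst 1).
by apply: mbd_ext (mbdM (prim_mbd alpha_L1) IH) => x _; rewrite exprS.
Qed.

(** Integrated form of (A^(k+1))' = (k+1) alpha A^k, obtained by applying the product rule to A and
    A^(k+1). It produces the factorial in [picard_bound]. *)
Lemma prim_exprS k x : I01 x ->
  prim (fun t => alpha t * A t ^+ k) x = A x ^+ k.+1 / k.+1%:R.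
Proof.
elim: k x => [|k IH] x x01.
  rewrite expr1 divr1; apply: eq_prim => // t _; by rewrite expr0 mulr1.
have gL1 : L1 (fun t => k.+1%:R * (alpha t * A t ^+ k)) by apply: L1Z; exact: L1M.
have prim_g t : I01 t -> prim (fun t => k.+1%:R * (alpha t * A t ^+ k)) t = A t ^+ k.+1.
  move=> t01; rewrite primZ//; last exact: L1M.
  by rewrite IH// mulrC divfK// pnatr_eq0.
have := prim_mul x01 alpha_L1 gL1; rewrite prim_g// -/A -exprS => ->.
rewrite [in RHS](@eq_prim _ _ (fun t => k.+2%:R * (alpha t * A t ^+ k.+1))) => [|//|t t01].
  rewrite primZ//; last exact: L1M.
  by rewrite [RHS]mulrC mulKf// pnatr_eq0.
by rewrite prim_g// exprS -[k.+2]addn1 natrD; ring.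
Qed.

(** The k-th term of the Neumann series, that is, the increment between successive Picard
    approximations; the approximations themselves are the partial sums S N in [linear_ode_real]. *)
Fixpoint picard k (i : I) : R -> R :=
  if k is k'.+1 then fun x => \sum_j prim (fun t => a i j t * picard k' j t) x
  else fun=> c i.

Let picard_mbd k i : mbd (picard k i).
Proof.
elim: k i => [|k IH] i; first exact: mbd_cst.
by apply: mbd_sum => j; apply: prim_mbd; exact: L1M.
Qed.

Let apicard_L1 k i j : L1 (fun t => a i j t * picard k j t).
Proof. exact: L1M. Qed.

Lemma picard_bound k i x : I01 x -> `|picard k i x| <= C * (A x ^+ k / k`!%:R).
Proof.
elim: k i x => [|k IH] i x x01.
  by rewrite expr0 divr1 mulr1 /C (bigD1 i)//= lerDl sumr_ge0.
apply: le_trans (ler_norm_sum _ _ _) _ => /=.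
pose b t := C / k`!%:R * (alpha t * A t ^+ k).
have bL1 : L1 b by apply: L1Z; exact: L1M.
apply: (@le_trans _ _ (prim b x)); last first.
  rewrite /b primZ//; last exact: L1M.
  rewrite prim_exprS// factS natrM invfM.
  by rewrite [leRHS](_ : _ = C / k`!%:R * (A x ^+ k.+1 / k.+1%:R)) //; ring.
apply: (@le_trans _ _ (\sum_j prim (fun t => `|a i j t * picard k j t|) x)).
  by apply: ler_sum => j _; exact: le_norm_prim.
rewrite -prim_sum//; last by move=> j; exact: L1_norm.
apply: le_prim => // [|t t01]; first by apply: L1_sum => j; exact: L1_norm.
have -> : b t = alpha t * (C * (A t ^+ k / k`!%:R)) by rewrite /b; ring.
apply: (@le_trans _ _ ((\sum_j `|a i j t|) * (C * (A t ^+ k / k`!%:R)))).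
  rewrite mulr_suml; apply: ler_sum => j _; rewrite normrM ler_wpM2l//; exact: IH.
apply: ler_wpM2r; first exact: le_trans (IH i t t01).
rewrite [leRHS](bigD1 i)//= lerDl; apply: sumr_ge0 => ? _; exact: sumr_ge0.
Qed.

(** On [0, 1] the Neumann series is dominated by the exponential series at A 1. The same bound, C
    exp(A 1), lets dominated convergence carry the integral equation to the limit. *)
Lemma linear_ode_real : exists y : I -> R -> R, forall i, mbd (y i) /\
  forall x, I01 x -> y i x = c i + \sum_j prim (fun t => a i j t * y j t) x.
Proof.
pose A1 := A 1.
have C0 : 0 <= C by exact: sumr_ge0.
have I1 : I01 1 by apply/I01P; rewrite ler01 lexx.
have A10 : 0 <= A1 by exact: A_ge0.
have bnd k i x : I01 x -> `|picard k i x| <= C * exp_coeff A1 k.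
  move=> x01; apply: le_trans (picard_bound k i x01) _.
  rewrite ler_wpM2l// /exp_coeff ler_wpM2r ?invr_ge0//.
  by apply: lerXn2r; rewrite ?nnegrE ?A_ge0//; exact: prim_le1.
pose S N i x := \sum_(k < N) picard k i x.
have S_mbd N i : mbd (S N i) by apply: mbd_sum => k; exact: picard_mbd.
have S_bnd N i x : I01 x -> `|S N i x| <= C * expR A1.
  move=> x01; apply: le_trans (ler_norm_sum _ _ _) _ => /=.
  apply: (@le_trans _ _ (\sum_(k < N) C * exp_coeff A1 k)).
    by apply: ler_sum => k _; exact: bnd.
  rewrite -mulr_sumr ler_wpM2l// -(big_mkord xpredT (exp_coeff A1)).
  apply: nondecreasing_cvgn_le; last exact: is_cvg_series_exp_coeff.
  by apply: nondecreasing_series => k _ _; rewrite exp_coeff_ge0.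
have S_cvg i x : I01 x -> cvgn (fun N => S N i x).
  move=> x01.
  have -> : (fun N => S N i x) = series (fun k => picard k i x).
    by apply/funext => N; rewrite /S /series/= big_mkord.
  apply: normed_cvg.
  apply: (@series_le_cvg _ _ (fun k => C * exp_coeff A1 k)) => [k|k|k|].
  - exact: normr_ge0.
  - by rewrite mulr_ge0// exp_coeff_ge0.
  - exact: bnd.
  - have -> : series (fun k => C * exp_coeff A1 k) = (fun N => C * series (exp_coeff A1) N).
      by apply/funext => N; rewrite /series/= -mulr_sumr.
    by apply: is_cvgM; [exact: is_cvg_cst|exact: is_cvg_series_exp_coeff].
(* Outside [I01] the value 0 is a mere default; the equation and the bound are claimed on [I01]. *)
pose y i x := if x \in I01 then limn (fun N => S N i x) else 0.
have S_y i x : I01 x -> (fun N => S N i x) @ \oo --> y i x.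
  by move=> x01; rewrite /y mem_set//; exact: S_cvg.
have int_y i j x : I01 x -> L1 (fun t => a i j t * y j t) /\
    (fun N => prim (fun t => a i j t * S N j t) x) @ \oo --> prim (fun t => a i j t * y j t) x.
  move=> x01; apply: (@prim_dominated_cvg _ _ _ (fun t => `|a i j t| * (C * expR A1))) => //.
  - move=> N; apply: measurable_funM; first exact: L1_measurable.
    by have [] := S_mbd N j.
  - by move=> t t01; apply: cvgM; [exact: cvg_cst|exact: S_y].
  - by apply: L1M; [exact: L1_norm|exact: mbd_cst].
  - by move=> N t t01; rewrite normrM ler_wpM2l// S_bnd.
have eqy i x : I01 x -> y i x = c i + \sum_j prim (fun t => a i j t * y j t) x.
  move=> x01.
  have h1 : (fun N => S N.+1 i x) @ \oo --> y i x.
    by rewrite (cvg_shiftS (fun N => S N i x)); exact: S_y.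
  have h2 : (fun N => S N.+1 i x) @ \oo --> c i + \sum_j prim (fun t => a i j t * y j t) x.
    have -> : (fun N => S N.+1 i x) =
        (fun N => c i + \sum_j prim (fun t => a i j t * S N j t) x).
      apply/funext => N; rewrite /S big_ord_recl/=; congr (_ + _).
      rewrite exchange_big/=; apply: eq_bigr => j _.
      rewrite -prim_sum//; apply: eq_prim => // t _.
      by rewrite mulr_sumr.
    apply: cvgD; first exact: cvg_cst.
    by apply: (cvg_big (@add_continuous R)) => j _; have [] := int_y i j x x01.
  by rewrite -(cvg_lim (@norm_hausdorff _ R) h1) (cvg_lim (@norm_hausdorff _ R) h2).
exists y => i; split; last exact: eqy.
apply: (@mbd_ext _ (fun x => c i + \sum_j prim (fun t => a i j t * y j t) x)).
  by move=> x x01; rewrite -eqy.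
apply: mbdD; first exact: mbd_cst.
by apply: mbd_sum => j; apply: prim_mbd; have [] := int_y i j 1 I1.
Qed.

End RealLinearODE.

(** * Square integrable real functions on [0, 1] *)

Section SquareIntegrable.
Context {R : realType}.
Local Notation mu := (@lebesgue_measure R).
Local Notation I01 := (I01 R).
Local Notation L1 f := (mu.-integrable I01 (EFin \o f)).
Implicit Types f g : R -> R.

Lemma Lfun1P f : f \_ I01 \in Lfun mu 1 <-> L1 f.
Proof.
split.
  move=> /Lfun1_integrable; rewrite -restrict_EFin => fi.
  exact: ((@integrable_mkcond _ _ R mu _ _ measurable_I01).2 fi).
move=> fi; apply/Lfun1_integrable; rewrite -restrict_EFin.
exact: ((@integrable_mkcond _ _ R mu _ _ measurable_I01).1 fi).
Qed.

Lemma Lfun2P f : f \_ I01 \in Lfun mu 2%:E <->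
  measurable_fun I01 f /\ L1 (fun x => f x ^+ 2).
Proof.
split=> [f2|[mf fi]].
  split.
    move: (f2); rewrite inE => /andP[+ _]; rewrite inE/= => mf.
    by apply/(measurable_restrictT _ measurable_I01).
  apply/Lfun1P; apply/Lfun1_integrable.
  have := Lfun2_integrable_sqr f2.
  rewrite (_ : (fun x => (f \_ I01) x ^+ 2) = (fun x => f x ^+ 2) \_ I01)//.
  by apply/funext => x; rewrite !patchE; case: ifPn => // _; rewrite expr0n.
rewrite inE; apply/andP; split; rewrite inE/=.
  by apply/(measurable_restrictT _ measurable_I01).
rewrite /finite_norm unlock /Lnorm; apply: poweR_lty.
have /Lfun1_integrable /integrableP[_] := (Lfun1P _).2 fi.
apply: le_lt_trans; rewrite le_eqVlt; apply/orP; left; apply/eqP.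
apply: eq_integral => x _ /=; rewrite powR_mulrn// !patchE.
by case: ifPn => _; rewrite ?normrX//= normr0 expr0n.
Qed.

Definition r2 f := measurable_fun I01 f /\ L1 (fun x => f x ^+ 2).

Lemma r2M f g : mbd f -> r2 g -> r2 (fun x => f x * g x).
Proof.
move=> fb [mg gi]; split; first by have [mf _] := fb; exact: measurable_funM.
by apply: L1_ext (L1M gi (mbdM fb fb)) => x _; rewrite exprMn mulrC expr2.
Qed.

Lemma r2_mul f g : r2 f -> r2 g -> L1 (fun x => f x * g x).
Proof.
move=> [mf fi] [mg gi]; apply: (le_L1 (g := fun x => f x ^+ 2 + g x ^+ 2)).
- exact: measurable_funM.
- exact: L1D.
move=> x _; rewrite ler_norml.
have := sqr_ge0 (f x + g x); have := sqr_ge0 (f x - g x).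
have := sqr_ge0 (f x); have := sqr_ge0 (g x).
by rewrite !expr2 => *; apply/andP; split; nra.
Qed.

Lemma r2D f g : r2 f -> r2 g -> r2 (fun x => f x + g x).
Proof.
move=> hf hg; split.
  by have [mf _] := hf; have [mg _] := hg; exact: measurable_funD.
apply: L1_ext (L1D (L1D hf.2 (L1Z 2 (r2_mul hf hg))) hg.2) => x _.
by ring.
Qed.

Lemma mbd_r2 f : mbd f -> r2 f.
Proof.
move=> fb; split; first by have [] := fb.
by apply: L1_ext (mbd_L1 (mbdM fb fb)) => x _; rewrite expr2.
Qed.

Lemma r2_L1 f : r2 f -> L1 f.
Proof.
by move=> /(r2_mul (mbd_r2 (mbd_cst 1))); apply: L1_ext => x _; rewrite mul1r.
Qed.

End SquareIntegrable.

(** * Complex-valued integrable functions, their primitives and scalar W^{1,1} *)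

Section ComplexPrimitives.
Context {R : realType}.
Local Notation C := R[i].
Local Notation mu := (@lebesgue_measure R).
Local Notation I01 := (I01 R).
Local Notation L1 f := (mu.-integrable I01 (EFin \o f)).
Local Notation Re := complex.Re.
Local Notation Im := complex.Im.
Implicit Types f g : R -> C.

Lemma cLfun1P f : cLfun 1 f <-> L1 (fun x => Re (f x)) /\ L1 (fun x => Im (f x)).
Proof. by split=> -[fR fI]; split; apply/Lfun1P. Qed.

Lemma cLfun2P f : cLfun 2%:E f <-> r2 (fun x => Re (f x)) /\ r2 (fun x => Im (f x)).
Proof. by split=> -[fR fI]; split; apply/Lfun2P. Qed.

Definition cmbd f := mbd (fun x => Re (f x)) /\ mbd (fun x => Im (f x)).

Lemma cLfun1_ext f g : (forall x, I01 x -> f x = g x) -> cLfun 1 f -> cLfun 1 g.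
Proof.
move=> fg /cLfun1P[fR fI]; apply/cLfun1P; split.
  by apply: L1_ext fR => x /fg ->.
by apply: L1_ext fI => x /fg ->.
Qed.

Lemma cmbd_ext f g : (forall x, I01 x -> f x = g x) -> cmbd f -> cmbd g.
Proof.
by move=> fg [fR fI]; split; [apply: mbd_ext fR|apply: mbd_ext fI] => x /fg ->.
Qed.

Lemma cmbd_cst a : cmbd (fun=> a).
Proof. by split; exact: mbd_cst. Qed.

Lemma cmbdD f g : cmbd f -> cmbd g -> cmbd (fun x => f x + g x).
Proof.
move=> [fR fI] [gR gI]; split.
  by apply: mbd_ext (mbdD fR gR) => x _; rewrite Re_addc.
by apply: mbd_ext (mbdD fI gI) => x _; rewrite Im_addc.
Qed.

Lemma cmbdM f g : cmbd f -> cmbd g -> cmbd (fun x => f x * g x).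
Proof.
move=> [fR fI] [gR gI]; split.
  by apply: mbd_ext (mbdB (mbdM fR gR) (mbdM fI gI)) => x _; rewrite Re_mulc.
by apply: mbd_ext (mbdD (mbdM fR gI) (mbdM fI gR)) => x _; rewrite Im_mulc.
Qed.

Lemma cmbd_conj f : cmbd f -> cmbd (fun x => (f x)^*%C).
Proof.
move=> [fR fI]; split; first by apply: mbd_ext fR => x _; case: (f x).
by apply: mbd_ext (mbdN fI) => x _; case: (f x).
Qed.

Lemma cmbd_sum (I : Type) (r : seq I) (F : I -> R -> C) :
  (forall i, cmbd (F i)) -> cmbd (fun x => \sum_(i <- r) F i x).
Proof.
move=> Fi; elim: r => [|i r IH].
  by apply: cmbd_ext (cmbd_cst 0) => x _; rewrite big_nil.
by apply: cmbd_ext (cmbdD (Fi i) IH) => x _; rewrite big_cons.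
Qed.

Lemma cmbd_le_ind (x : R) : cmbd (fun t => (t <= x)%R%:R).
Proof.
split.
  by apply: mbd_ext (mbd_le_ind x) => t _; case: (t <= x).
by apply: mbd_ext (mbd_cst 0) => t _; case: (t <= x).
Qed.

Lemma cLfun1M f g : cLfun 1 f -> cmbd g -> cLfun 1 (fun x => f x * g x).
Proof.
move=> /cLfun1P[fR fI] [gR gI]; apply/cLfun1P; split.
  by apply: L1_ext (L1B (L1M fR gR) (L1M fI gI)) => x _; rewrite Re_mulc.
by apply: L1_ext (L1D (L1M fR gI) (L1M fI gR)) => x _; rewrite Im_mulc.
Qed.

Lemma cLfun2M f g : cmbd f -> cLfun 2%:E g -> cLfun 2%:E (fun x => f x * g x).
Proof.
move=> [fR fI] /cLfun2P[gR gI]; apply/cLfun2P; split.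
  rewrite (_ : (fun x => _) = fun x => Re (f x) * Re (g x) + (- Im (f x)) * Im (g x)).
    by apply: r2D; apply: r2M => //; exact: mbdN.
  by apply/funext => x; rewrite Re_mulc mulNr.
rewrite (_ : (fun x => _) = fun x => Re (f x) * Im (g x) + Im (f x) * Re (g x)).
  by apply: r2D; exact: r2M.
by apply/funext => x; rewrite Im_mulc.
Qed.

Lemma cmbd_cLfun1 f : cmbd f -> cLfun 1 f.
Proof. by move=> [fR fI]; apply/cLfun1P; split; exact: mbd_L1. Qed.

Lemma cmbd_cLfun2 f : cmbd f -> cLfun 2%:E f.
Proof. by move=> [fR fI]; apply/cLfun2P; split; exact: mbd_r2. Qed.

Lemma cLfun21 f : cLfun 2%:E f -> cLfun 1 f.
Proof. by move=> /cLfun2P[fR fI]; apply/cLfun1P; split; exact: r2_L1. Qed.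

Lemma cLfun1D f g : cLfun 1 f -> cLfun 1 g -> cLfun 1 (fun x => f x + g x).
Proof.
move=> fi gi; apply: cLfun_ext (cLfunZD 1 (lexx _) fi gi) => x.
by rewrite mul1r.
Qed.

Definition cprim f (x : R) : C := cintegral `[0, x] f.

Lemma cprimE f x : cprim f x = prim (fun t => Re (f t)) x +i* prim (fun t => Im (f t)) x.
Proof. by []. Qed.

Lemma Re_cprim f x : Re (cprim f x) = prim (fun t => Re (f t)) x.
Proof. by []. Qed.

Lemma Im_cprim f x : Im (cprim f x) = prim (fun t => Im (f t)) x.
Proof. by []. Qed.

Lemma cprim0 f : cprim f 0 = 0.
Proof. by rewrite cprimE !prim0. Qed.

Lemma eq_cprim f g x : I01 x -> (forall t, I01 t -> f t = g t) ->
  cprim f x = cprim g x.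
Proof. by move=> x01 fg; rewrite !cprimE; congr (_ +i* _); apply: eq_prim => // t /fg ->. Qed.

Lemma cprimD f g x : I01 x -> cLfun 1 f -> cLfun 1 g ->
  cprim (fun t => f t + g t) x = cprim f x + cprim g x.
Proof.
move=> x01 /cLfun1P[fR fI] /cLfun1P[gR gI]; apply: complex_ext.
  by rewrite Re_addc /= -primD//; apply: eq_prim => // t _; rewrite Re_addc.
by rewrite Im_addc /= -primD//; apply: eq_prim => // t _; rewrite Im_addc.
Qed.

Lemma cprimZ a f x : I01 x -> cLfun 1 f -> cprim (fun t => a * f t) x = a * cprim f x.
Proof.
move=> x01 /cLfun1P[fR fI]; apply: complex_ext.
  rewrite Re_mulc /= -!primZ// -primN; [|exact: x01|exact: L1Z].
  rewrite -primD//; [|exact: L1Z|by apply: L1N; exact: L1Z].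
  by apply: eq_prim => // t _; rewrite Re_mulc.
rewrite Im_mulc /= -!primZ// -primD//; [|exact: L1Z|exact: L1Z].
by apply: eq_prim => // t _; rewrite Im_mulc.
Qed.

Lemma cprim_sum (I : Type) (r : seq I) (F : I -> R -> C) x : I01 x ->
  (forall i, cLfun 1 (F i)) ->
  cprim (fun t => \sum_(i <- r) F i t) x = \sum_(i <- r) cprim (F i) x.
Proof.
move=> x01 Fi; elim: r => [|i r IH].
  rewrite big_nil (@eq_cprim _ (fun t => 0 * 0))// => [|t _].
    by rewrite cprimZ ?mul0r//; exact: cLfun0.
  by rewrite big_nil mul0r.
rewrite big_cons -IH -cprimD//; last exact: cLfun_sum.
by apply: eq_cprim => // t _; rewrite big_cons.
Qed.

Lemma cprim_mbd f : cLfun 1 f -> cmbd (cprim f).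
Proof. by move=> /cLfun1P[fR fI]; split; exact: prim_mbd. Qed.

Lemma cprim_mul f g x : I01 x -> cLfun 1 f -> cLfun 1 g ->
  cprim f x * cprim g x = cprim (fun s => f s * cprim g s + cprim f s * g s) x.
Proof.
move=> x01 /cLfun1P[fR fI] /cLfun1P[gR gI].
have L (u v : R -> R) : L1 u -> L1 v -> L1 (fun s => u s * prim v s + prim u s * v s).
  move=> ui vi; apply: L1D; first by apply: L1M => //; exact: prim_mbd.
  by apply: L1_ext (L1M vi (prim_mbd ui)) => t _; rewrite mulrC.
apply: complex_ext.
  rewrite Re_mulc [LHS]/= !prim_mul// -primN; [|exact: x01|exact: L].
  rewrite -primD//; [|exact: L|by apply: L1N; exact: L].
  by apply: eq_prim => // t _; rewrite Re_addc !Re_mulc !Re_cprim !Im_cprim; ring.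
rewrite Im_mulc [LHS]/= !prim_mul// -primD//; [|exact: L|exact: L].
by apply: eq_prim => // t _; rewrite Im_addc !Im_mulc !Re_cprim !Im_cprim; ring.
Qed.

Definition cW11 f f' := cLfun 1 f' /\ forall x, I01 x -> f x = f 0 + cprim f' x.

Lemma cW11_mbd f f' : cW11 f f' -> cmbd f.
Proof.
move=> [f'i fE]; apply: (@cmbd_ext (fun x => f 0 + cprim f' x)).
  by move=> x /fE.
by apply: cmbdD; [exact: cmbd_cst|exact: cprim_mbd].
Qed.

Lemma cW11D f f' g g' : cW11 f f' -> cW11 g g' ->
  cW11 (fun x => f x + g x) (fun x => f' x + g' x).
Proof.
move=> [f'i fE] [g'i gE]; split; first exact: cLfun1D.
by move=> x x01; rewrite cprimD// (fE _ x01) (gE _ x01) addrACA.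
Qed.

Lemma cW11_cst a : cW11 (fun=> a) (fun=> 0).
Proof.
split=> [|x x01]; first exact: cLfun0.
rewrite (@eq_cprim _ (fun t => 0 * 0)) => [|//|t _]; last by rewrite mul0r.
by rewrite cprimZ ?mul0r ?addr0//; exact: cLfun0.
Qed.

Lemma cW11_sum (I : Type) (r : seq I) (F F' : I -> R -> C) :
  (forall i, cW11 (F i) (F' i)) ->
  cW11 (fun x => \sum_(i <- r) F i x) (fun x => \sum_(i <- r) F' i x).
Proof.
move=> Fi; elim: r => [|i r IH].
  rewrite (_ : (fun x => _) = fun=> 0); last by apply/funext => x; rewrite big_nil.
  rewrite [X in cW11 _ X](_ : _ = fun=> 0); last by apply/funext => x; rewrite big_nil.
  exact: cW11_cst.
rewrite (_ : (fun x => _) = fun x => F i x + \sum_(j <- r) F j x); last first.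
  by apply/funext => x; rewrite big_cons.
rewrite [X in cW11 _ X](_ : _ = fun x => F' i x + \sum_(j <- r) F' j x); last first.
  by apply/funext => x; rewrite big_cons.
exact: cW11D.
Qed.

Lemma cW11M f f' g g' : cW11 f f' -> cW11 g g' ->
  cW11 (fun x => f x * g x) (fun x => f' x * g x + f x * g' x).
Proof.
move=> Wf Wg; have [f'i fE] := Wf; have [g'i gE] := Wg.
have f'g : cLfun 1 (fun x => f' x * g x) by apply: cLfun1M => //; exact: cW11_mbd Wg.
have fg' : cLfun 1 (fun x => f x * g' x).
  by apply: cLfun_ext (cLfun1M g'i (cW11_mbd Wf)) => x; rewrite mulrC.
split=> [|x x01]; first exact: cLfun1D.
have pf := cprim_mbd f'i; have pg := cprim_mbd g'i.
have h1 : cLfun 1 (fun s => f' s * cprim g' s) by exact: cLfun1M.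
have h2 : cLfun 1 (fun s => cprim f' s * g' s).
  by apply: cLfun_ext (cLfun1M g'i pf) => s; rewrite mulrC.
have h3 : cLfun 1 (fun s => f' s * g 0) by apply: cLfun1M => //; exact: cmbd_cst.
have h4 : cLfun 1 (fun s => f 0 * g' s).
  by apply: cLfun_ext (cLfun1M g'i (cmbd_cst (f 0))) => s; rewrite mulrC.
(* Writing f and g as initial value plus primitive separates the terms with constants from the
   product of two primitives, which is [cprim_mul]. *)
rewrite (@eq_cprim _ (fun s => (f' s * g 0 + f 0 * g' s) +
   (f' s * cprim g' s + cprim f' s * g' s))) => [|//|s s01]; last first.
  by rewrite (fE s s01) (gE s s01); ring.
rewrite cprimD//; [|exact: cLfun1D|exact: cLfun1D].
rewrite -cprim_mul// cprimD// cprimZ//.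
rewrite (@eq_cprim _ (fun s => g 0 * f' s)) => [|//|s _]; last by rewrite mulrC.
by rewrite cprimZ// (fE x x01) (gE x x01); ring.
Qed.

Lemma cW11_prim f : cLfun 1 f -> cW11 (cprim f) f.
Proof. by move=> fi; split=> // x x01; rewrite cprim0 add0r. Qed.

Lemma cW11_ext f f1 f' f1' : (forall x, 0 <= x <= 1 -> f x = f1 x) ->
  (forall x, I01 x -> f' x = f1' x) -> cW11 f f' -> cW11 f1 f1'.
Proof.
move=> ff ff' [f'i fE]; split; first exact: cLfun1_ext f'i.
move=> x x01; rewrite -(ff x) ?(I01P x).1// -(ff 0) ?lexx ?ler01//.
by rewrite fE//; congr (_ + _); exact: eq_cprim.
Qed.

End ComplexPrimitives.

(** * Matrix-valued functions and fundamental matrices *)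

Section MatrixFunctions.
Context {R : realType}.
Local Notation C := R[i].
Local Notation mu := (@lebesgue_measure R).
Local Notation I01 := (I01 R).
Local Notation L1 f := (mu.-integrable I01 (EFin \o f)).
Local Notation Re := complex.Re.
Local Notation Im := complex.Im.

Lemma I01_0 : I01 0. Proof. by apply/I01P; rewrite lexx ler01. Qed.

Lemma I01_1 : I01 1. Proof. by apply/I01P; rewrite lexx ler01. Qed.

Definition mxmbd m n (F : R -> 'M[C]_(m, n)) := forall i j, cmbd (fun x => F x i j).

Definition mxprim m n (F : R -> 'M[C]_(m, n)) (x : R) := mxintegral `[0, x] F.

Lemma mxprimE m n (F : R -> 'M[C]_(m, n)) x i j :
  mxprim F x i j = cprim (fun t => F t i j) x.
Proof. by rewrite mxE. Qed.

Lemma eq_mxprim m n (F G : R -> 'M[C]_(m, n)) x : I01 x ->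
  (forall t, I01 t -> F t = G t) -> mxprim F x = mxprim G x.
Proof.
by move=> x01 FG; apply/matrixP => i j; rewrite !mxprimE; apply: eq_cprim => // t /FG ->.
Qed.

Lemma mxprim0 m n (F : R -> 'M[C]_(m, n)) : mxprim F 0 = 0.
Proof. by apply/matrixP => i j; rewrite mxprimE cprim0 mxE. Qed.

Lemma mxmbd_cst m n (A : 'M[C]_(m, n)) : mxmbd (fun=> A).
Proof. by move=> i j; exact: cmbd_cst. Qed.

Lemma mxmbdD m n (F G : R -> 'M[C]_(m, n)) : mxmbd F -> mxmbd G ->
  mxmbd (fun x => F x + G x).
Proof.
by move=> Fb Gb i j; apply: cmbd_ext (cmbdD (Fb i j) (Gb i j)) => x _; rewrite mxE.
Qed.

Lemma mxmbd_mulmx m n p (F : R -> 'M[C]_(m, n)) (G : R -> 'M[C]_(n, p)) :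
  mxmbd F -> mxmbd G -> mxmbd (fun x => F x *m G x).
Proof.
move=> Fb Gb i j; apply: cmbd_ext (cmbd_sum _ _) => [x _|k]; first by rewrite mxE.
exact: cmbdM.
Qed.

Lemma mxmbdN m n (F : R -> 'M[C]_(m, n)) : mxmbd F -> mxmbd (fun x => - F x).
Proof.
move=> Fb i j; apply: cmbd_ext (cmbdM (cmbd_cst (-1)) (Fb i j)) => x _.
by rewrite mxE mulN1r.
Qed.

Lemma mxmbd_prim m n (F : R -> 'M[C]_(m, n)) : mxLfun 1 F -> mxmbd (mxprim F).
Proof.
move=> Fi i j; apply: cmbd_ext (cprim_mbd (Fi i j)) => x _; by rewrite mxprimE.
Qed.

Lemma mxL1D m n (F G : R -> 'M[C]_(m, n)) : mxLfun 1 F -> mxLfun 1 G ->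
  mxLfun 1 (fun x => F x + G x).
Proof.
by move=> Fi Gi i j; apply: cLfun_ext (cLfun1D (Fi i j) (Gi i j)) => x; rewrite mxE.
Qed.

Lemma mxL1N m n (F : R -> 'M[C]_(m, n)) : mxLfun 1 F -> mxLfun 1 (fun x => - F x).
Proof.
move=> Fi i j; apply: cLfun_ext (cLfun1M (Fi i j) (cmbd_cst (-1))) => x.
by rewrite mxE mulrN1.
Qed.

Lemma mxL1_mulmxr m n p (F : R -> 'M[C]_(m, n)) (G : R -> 'M[C]_(n, p)) :
  mxLfun 1 F -> mxmbd G -> mxLfun 1 (fun x => F x *m G x).
Proof.
move=> Fi Gb i j; apply: cLfun_ext (cLfun_sum _ (lexx _) _) => [x|k].
  by rewrite mxE.
exact: cLfun1M.
Qed.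

Lemma mxL1_mulmxl m n p (F : R -> 'M[C]_(m, n)) (G : R -> 'M[C]_(n, p)) :
  mxmbd F -> mxLfun 1 G -> mxLfun 1 (fun x => F x *m G x).
Proof.
move=> Fb Gi i j; apply: cLfun_ext (cLfun_sum _ (lexx _) _) => [x|k].
  by rewrite mxE.
by apply: cLfun_ext (cLfun1M (Gi k j) (Fb i k)) => x; rewrite mulrC.
Qed.

Lemma mxL2_mulmx m n p (F : R -> 'M[C]_(m, n)) (G : R -> 'M[C]_(n, p)) :
  mxmbd F -> mxLfun 2%:E G -> mxLfun 2%:E (fun x => F x *m G x).
Proof.
move=> Fb Gi i j; apply: cLfun_ext (cLfun_sum _ _ _) => [x|//|k].
- by rewrite mxE.
- by rewrite lee_fin ler1n.
exact: cLfun2M.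
Qed.

Lemma mxL2D m n (F G : R -> 'M[C]_(m, n)) : mxLfun 2%:E F -> mxLfun 2%:E G ->
  mxLfun 2%:E (fun x => F x + G x).
Proof.
move=> Fi Gi i j; apply: cLfun_ext (cLfunZD 1 _ (Fi i j) (Gi i j)) => [x|].
  by rewrite mxE mul1r.
by rewrite lee_fin ler1n.
Qed.

Lemma mxL21 m n (F : R -> 'M[C]_(m, n)) : mxLfun 2%:E F -> mxLfun 1 F.
Proof. by move=> Fi i j; exact: cLfun21. Qed.

Lemma mxmbd_L2 m n (F : R -> 'M[C]_(m, n)) : mxmbd F -> mxLfun 2%:E F.
Proof. by move=> Fi i j; exact: cmbd_cLfun2. Qed.

Lemma mxmbd_L1 m n (F : R -> 'M[C]_(m, n)) : mxmbd F -> mxLfun 1 F.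
Proof. by move=> Fi i j; exact: cmbd_cLfun1. Qed.

Lemma mxprimD m n (F G : R -> 'M[C]_(m, n)) x : I01 x ->
  mxLfun 1 F -> mxLfun 1 G -> mxprim (fun t => F t + G t) x = mxprim F x + mxprim G x.
Proof.
move=> x01 Fi Gi; apply/matrixP => i j; rewrite [RHS]mxE !mxprimE -cprimD//.
by apply: eq_cprim => // t _; rewrite mxE.
Qed.

Lemma mxprim_mulmxl m n p (A : 'M[C]_(m, n)) (F : R -> 'M[C]_(n, p)) x : I01 x ->
  mxLfun 1 F -> mxprim (fun t => A *m F t) x = A *m mxprim F x.
Proof.
move=> x01 Fi; apply/matrixP => i j; rewrite [RHS]mxE !mxprimE.
rewrite (eq_bigr (fun k => cprim (fun t => A i k * F t k j) x)); last first.
  by move=> k _; rewrite mxprimE cprimZ.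
rewrite -cprim_sum//; first by apply: eq_cprim => // t _; rewrite mxE.
move=> k; apply: cLfun_ext (cLfun1M (Fi k j) (cmbd_cst (A i k))) => t.
by rewrite mulrC.
Qed.

Lemma mxprim_mulmxr m n p (A : 'M[C]_(n, p)) (F : R -> 'M[C]_(m, n)) x : I01 x ->
  mxLfun 1 F -> mxprim (fun t => F t *m A) x = mxprim F x *m A.
Proof.
move=> x01 Fi; apply/matrixP => i j; rewrite [RHS]mxE !mxprimE.
rewrite (eq_bigr (fun k => cprim (fun t => F t i k * A k j) x)); last first.
  move=> k _; rewrite mxprimE mulrC -cprimZ//.
  by apply: eq_cprim => // t _; rewrite mulrC.
rewrite -cprim_sum//; first by apply: eq_cprim => // t _; rewrite mxE.
by move=> k; exact: cLfun1M (Fi i k) (cmbd_cst (A k j)).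
Qed.

Lemma W11_derivP m n (Y Y' : R -> 'M[C]_(m, n)) :
  W11_deriv Y Y' <-> forall i j, cW11 (fun x => Y x i j) (fun x => Y' x i j).
Proof.
split=> [[Y'i YE] i j|h].
  split=> [|x /I01P x01]; first exact: Y'i.
  by rewrite YE// mxE mxE.
split=> [i j|x x01]; first by have [] := h i j.
by apply/matrixP => i j; rewrite !mxE; have [_ ->] := h i j; last exact/I01P.
Qed.

Lemma W11_mbd m n (Y Y' : R -> 'M[C]_(m, n)) : W11_deriv Y Y' -> mxmbd Y.
Proof. by move=> /W11_derivP h i j; exact: cW11_mbd (h i j). Qed.

Lemma W11_ext m n (Y Z Y' Z' : R -> 'M[C]_(m, n)) :
  (forall x, I01 x -> Y x = Z x) -> (forall x, I01 x -> Y' x = Z' x) ->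
  W11_deriv Y Y' -> W11_deriv Z Z'.
Proof.
move=> YZ YZ' /W11_derivP h; apply/W11_derivP => i j.
by apply: cW11_ext (h i j) => x; [move=> /I01P /YZ ->|move=> /YZ' ->].
Qed.

Lemma W11_cst m n (A : 'M[C]_(m, n)) : W11_deriv (fun=> A) (fun=> 0).
Proof.
apply/W11_derivP => i j.
by apply: cW11_ext (cW11_cst (A i j)) => x _ //; rewrite mxE.
Qed.

Lemma W11D m n (Y Y' Z Z' : R -> 'M[C]_(m, n)) : W11_deriv Y Y' -> W11_deriv Z Z' ->
  W11_deriv (fun x => Y x + Z x) (fun x => Y' x + Z' x).
Proof.
move=> /W11_derivP hY /W11_derivP hZ; apply/W11_derivP => i j.
by apply: cW11_ext (cW11D (hY i j) (hZ i j)) => x _; rewrite mxE.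
Qed.

Lemma W11_mulmx m n p (Y Y' : R -> 'M[C]_(m, n)) (Z Z' : R -> 'M[C]_(n, p)) :
  W11_deriv Y Y' -> W11_deriv Z Z' ->
  W11_deriv (fun x => Y x *m Z x) (fun x => Y' x *m Z x + Y x *m Z' x).
Proof.
move=> /W11_derivP hY /W11_derivP hZ; apply/W11_derivP => i j.
apply: cW11_ext (cW11_sum _ (fun k => cW11M (hY i k) (hZ k j))) => x _.
  by rewrite mxE.
by rewrite !mxE big_split.
Qed.

Lemma W11N m n (Y Y' : R -> 'M[C]_(m, n)) : W11_deriv Y Y' ->
  W11_deriv (fun x => - Y x) (fun x => - Y' x).
Proof.
move=> hY; apply: W11_ext (W11_mulmx (W11_cst (- 1%:M)) hY) => x _.
  by rewrite mulNmx mul1mx.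
by rewrite mul0mx add0r mulNmx mul1mx.
Qed.

Lemma W11_trmx m n (Y Y' : R -> 'M[C]_(m, n)) : W11_deriv Y Y' ->
  W11_deriv (fun x => (Y x)^T) (fun x => (Y' x)^T).
Proof.
move=> /W11_derivP hY; apply/W11_derivP => i j.
by apply: cW11_ext (hY j i) => x _; rewrite mxE.
Qed.

Lemma W11_prim m n (F : R -> 'M[C]_(m, n)) : mxLfun 1 F -> W11_deriv (mxprim F) F.
Proof.
move=> Fi; apply/W11_derivP => i j.
by apply: cW11_ext (cW11_prim (Fi i j)) => x _ //; rewrite mxprimE.
Qed.

Lemma W11_prim_eq m n (Y Y' : R -> 'M[C]_(m, n)) x : I01 x -> W11_deriv Y Y' ->
  Y x = Y 0 + mxprim Y' x.
Proof. by move=> /I01P x01 [_ ->]. Qed.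

(** Integration from 0 to t on the factor G becomes integration from t to x on F. With x = 1 this
    computes the adjoint of a Volterra operator, as used in [dot_Phi_prim]. *)
Lemma mxprim_by_parts m n p (F : R -> 'M[C]_(m, n)) (G : R -> 'M[C]_(n, p)) x :
  I01 x -> mxLfun 1 F -> mxLfun 1 G ->
  mxprim (fun t => F t *m mxprim G t) x =
  mxprim (fun t => (mxprim F x - mxprim F t) *m G t) x.
Proof.
move=> x01 Fi Gi.
have FG : mxLfun 1 (fun t => F t *m mxprim G t).
  by apply: mxL1_mulmxr => //; exact: mxmbd_prim.
have FG' : mxLfun 1 (fun t => mxprim F t *m G t).
  by apply: mxL1_mulmxl => //; exact: mxmbd_prim.
have E := W11_prim_eq x01 (W11_mulmx (W11_prim Fi) (W11_prim Gi)).
rewrite !mxprim0 mul0mx add0r mxprimD// -mxprim_mulmxl// in E.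
apply: (addIr (mxprim (fun t => mxprim F t *m G t) x)).
rewrite -E -mxprimD//; last first.
  by apply: mxL1_mulmxl => //; apply: mxmbdD; [exact: mxmbd_cst|apply/mxmbdN/mxmbd_prim].
by apply: eq_mxprim => // t _; rewrite -mulmxDl subrK.
Qed.

Lemma ae_eq_mxprim m n (F G : R -> 'M[C]_(m, n)) x : I01 x ->
  mxLfun 1 F -> mxLfun 1 G -> {ae mu, forall t, I01 t -> F t = G t} ->
  mxprim F x = mxprim G x.
Proof.
move=> x01 Fi Gi FG; apply/matrixP => i j; rewrite !mxprimE.
have e (u v : R -> R) : L1 u -> L1 v -> {ae mu, forall t, I01 t -> u t = v t} ->
    prim u x = prim v x.
  move=> ui vi uv; rewrite /prim /Rintegral; congr fine.
  apply: ae_eq_integral => //.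
  - exact: measurable_int (L1_itv x01 ui).
  - exact: measurable_int (L1_itv x01 vi).
  apply: (@filterS _ _ (ae_filter_ringOfSetsType mu) _ _ _ uv) => t /= ut t0x.
  rewrite ut//; apply/I01P; move/I01P: x01 => /andP[x0 x1].
  by move: t0x; rewrite in_itv/= => /andP[-> tx]; exact: le_trans tx x1.
have /cLfun1P[FR FI] := Fi i j; have /cLfun1P[GR GI] := Gi i j.
rewrite !cprimE; congr (_ +i* _); apply: e => //;
  by apply: (@filterS _ _ (ae_filter_ringOfSetsType mu) _ _ _ FG) => t h /h ->.
Qed.

(** Reduction to a real system of twice the size: the index (i, b) denotes the real part of the i-th
    coordinate for b = false and its imaginary part for b = true, and a complex entry acts as the 2
    x 2 block of multiplication by it. Column j starts at the j-th unit vector. *)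
Lemma linear_ode n (A : R -> 'M[C]_n) : mxLfun 1 A ->
  exists2 Phi : R -> 'M[C]_n, W11_deriv Phi (fun x => A x *m Phi x) & Phi 0 = 1%:M.
Proof.
move=> Ai.
pose a (p q : 'I_n * bool) (t : R) : R :=
  match p.2, q.2 with
  | false, true => - Im (A t p.1 q.1)
  | true, false => Im (A t p.1 q.1)
  | _, _ => Re (A t p.1 q.1)
  end.
have aL1 p q : L1 (a p q).
  have /cLfun1P[AR AI] := Ai p.1 q.1.
  case: p q AR AI => [i [|]] [j [|]] //= AR AI; exact: L1N.
pose c (j : 'I_n) (p : 'I_n * bool) : R := if p.2 then 0 else (p.1 == j)%:R.
have [y hy] := choice (fun j => linear_ode_real (c j) aL1).
pose Phi x := \matrix_(i, j) (y j (i, false) x +i* y j (i, true) x) : 'M[C]_n.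
pose part (b : bool) (z : C) := if b then Im z else Re z.
have sumE j i bb x : I01 x -> \sum_q prim (fun t => a (i, bb) q t * y j q t) x =
    prim (fun t => part bb ((A t *m Phi t) i j)) x.
  move=> x01; rewrite -prim_sum//; last first.
    by move=> q; apply: L1M => //; have [] := hy j q.
  apply: eq_prim => // t _; rewrite mxE.
  have -> : part bb (\sum_k A t i k * Phi t k j) =
      \sum_k part bb (A t i k * Phi t k j).
    by case: bb; [exact: Im_sum|exact: Re_sum].
  transitivity (\sum_k \sum_b a (i, bb) (k, b) t * y j (k, b) t).
    by rewrite pair_bigA; apply: eq_bigr => -[k b] _.
  apply: eq_bigr => k _; rewrite big_bool/= /a/= mxE.
  by case: bb; rewrite /part ?Im_mulc ?Re_mulc/=; ring.
have eqPhi x i j : I01 x -> Phi x i j = (i == j)%:R + cprim (fun t => (A t *m Phi t) i j) x.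
  move=> x01; rewrite mxE; apply: complex_ext.
    rewrite Re_addc [LHS]/= (proj2 (hy j (i, false))) // sumE//; congr (_ + _).
    by rewrite /c/=; case: (i == j).
  rewrite Im_addc [LHS]/= (proj2 (hy j (i, true))) // sumE//; congr (_ + _).
  by rewrite /c/=; case: (i == j).
have Phi0 : Phi 0 = 1%:M.
  by apply/matrixP => i j; rewrite eqPhi ?cprim0 ?addr0 ?mxE//; exact: I01_0.
exists Phi => //; apply/W11_derivP => i j; split.
  apply: (mxL1_mulmxr Ai) => {}i {}j; split.
    by apply: mbd_ext (proj1 (hy j (i, false))) => x _; rewrite mxE.
  by apply: mbd_ext (proj1 (hy j (i, true))) => x _; rewrite mxE.
by move=> x x01; rewrite Phi0 eqPhi// mxE.
Qed.

(** Solving the transposed equation yields Psi with Psi' = - Psi A, and then (Psi Phi)' = 0. So the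
    inverse comes with its own W^{1,1} structure, and one Psi serves every Phi. *)
Lemma linear_ode_inverse n (A : R -> 'M[C]_n) : mxLfun 1 A ->
  exists2 Psi : R -> 'M[C]_n, W11_deriv Psi (fun x => - (Psi x *m A x)) &
  forall Phi, W11_deriv Phi (fun x => A x *m Phi x) -> Phi 0 = 1%:M ->
    forall x, I01 x -> Psi x *m Phi x = 1%:M.
Proof.
move=> Ai.
have [|Xi hXi Xi0] := @linear_ode n (fun x => - (A x)^T).
  move=> i j; apply: cLfun_ext (cLfun1M (Ai j i) (cmbd_cst (-1))) => x.
  by rewrite !mxE mulrN1.
have hPsi : W11_deriv (fun x => (Xi x)^T) (fun x => - ((Xi x)^T *m A x)).
  apply: W11_ext (W11_trmx hXi) => // x _.
  by rewrite trmx_mul linearN/= trmxK mulmxN.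
exists (fun x => (Xi x)^T) => // Phi hPhi Phi0 x x01.
rewrite (W11_prim_eq x01 (W11_mulmx hPsi hPhi)) Xi0 Phi0 trmx1 mulmx1.
rewrite (@eq_mxprim _ _ _ (fun=> 0)) => [|//|t _]; last first.
  by rewrite mulNmx mulmxA addNr.
have := W11_prim_eq x01 (W11_cst (1%:M : 'M[C]_n)).
by move=> /esym.
Qed.

End MatrixFunctions.

(** * The Hilbert space of square integrable functions *)

Section RieszFischer.
Context {R : realType}.
Local Notation mu := (@lebesgue_measure R).
Local Notation I01 := (I01 R).
Local Notation L1 f := (mu.-integrable I01 (EFin \o f)).
Local Hint Resolve measurable_I01 : core.

Lemma prim_cst (c : R) : prim (fun=> c) 1 = c.
Proof.
rewrite /prim Rintegral_cst; last exact: measurable_itv.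
by rewrite -[RHS]mulr1; congr (c * _); exact: (congr1 fine (mu_I01 (R := R))).
Qed.

(** By monotone convergence the sum of the series has integral at most 2, so it is finite almost
    everywhere. *)
Lemma summable_norms_ae_cvg (D : nat -> R -> R) :
  (forall k, L1 (D k)) -> (forall k x, 0 <= D k x) ->
  (forall k, prim (D k) 1 <= 2^-1 ^+ k) ->
  {ae mu, forall x, I01 x -> cvgn (series (D ^~ x))}.
Proof.
move=> Di D0 Dle.
pose F x := (\sum_(0 <= k <oo) (D k x)%:E)%E.
have mD k : measurable_fun I01 (fun x => (D k x)%:E) by exact: (measurable_int _ (Di k)).
have Dle' k : (\int[mu]_(x in I01) (D k x)%:E <= (2^-1 ^+ k)%:E)%E.
  rewrite -[leLHS]fineK; first by rewrite lee_fin; exact: Dle.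
  by apply: integrable_fin_num; [exact: measurable_I01|exact: Di].
have F0 x : (0 <= F x)%E by apply: nneseries_ge0 => k _ _; rewrite lee_fin.
have Fi : mu.-integrable I01 F.
  apply/integrableP; split.
    have := @ge0_emeasurable_sum _ _ R I01 (fun k x => (D k x)%:E) xpredT.
    by apply=> [k x _ _|k _]; [rewrite lee_fin|exact: mD].
  under eq_integral do rewrite gee0_abs//.
  rewrite integral_nneseries//; [|exact: measurable_I01|by move=> k x _; rewrite lee_fin].
  apply: (@le_lt_trans _ _ 2%:E); last exact: ltry.
  apply: lime_le.
    by apply: is_cvg_nneseries => k _ _; apply: integral_ge0 => x _; rewrite lee_fin.
  apply: nearW => N.
  apply: (@le_trans _ _ (\sum_(0 <= k < N) (2^-1 ^+ k)%:E)%E).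
    by apply: lee_sum => k _; exact: Dle'.
  rewrite sumEFin lee_fin.
  have := @geometric_seriesE R 1 2^-1; rewrite /series /geometric/= => /(_ _)/funeqP.
  rewrite lt_eqF ?invf_lt1 ?ltr1n// => /(_ isT N) /=.
  under eq_bigr do rewrite mul1r.
  move=> ->; rewrite mul1r.
  have -> : (1 - 2^-1 : R) = 2^-1 by lra.
  rewrite invrK -[leRHS]mul1r ler_wpM2r// gerBl exprn_ge0// invr_ge0//.
have aeF : {ae mu, forall x, I01 x -> F x \is a fin_num}.
  by apply: integrable_ae; [exact: measurable_I01|exact: Fi].
apply: (@filterS _ _ (ae_filter_ringOfSetsType mu) _ _ _ aeF) => x Fx x01.
apply: nondecreasing_is_cvgn.
  by apply: nondecreasing_series => k _ _.
exists (fine (F x)) => _ [N _ <-].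
rewrite -lee_fin fineK; last exact: Fx.
rewrite /series/= -sumEFin.
by apply: nneseries_lim_ge => k _ _; rewrite lee_fin.
Qed.

(** Riesz-Fischer at a geometric rate: the increments are summable in L^1, so the sequence converges
    almost everywhere, and Fatou's lemma passes the L^2 estimate to the limit. *)
Lemma r2_complete (g : nat -> R -> R) : (forall k, r2 (g k)) ->
  (forall k j, (k <= j)%N -> prim (fun x => (g j x - g k x) ^+ 2) 1 <= (2^-1 ^+ k) ^+ 2) ->
  exists2 h, r2 h &
    forall k, prim (fun x => (h x - g k x) ^+ 2) 1 <= (2^-1 ^+ k) ^+ 2.
Proof.
move=> gr gC.
have r2B (u v : R -> R) : r2 u -> r2 v -> r2 (fun x => u x - v x).
  move=> ur vr; rewrite (_ : (fun x => _) = fun x => u x + -1 * v x).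
    by apply: r2D => //; apply: r2M => //; exact: mbd_cst.
  by apply/funext => x; rewrite mulN1r.
have I1 : I01 1 by apply/I01P; rewrite lexx ler01.
have e0 k : 0 < 2^-1 ^+ k :> R by rewrite exprn_gt0// invr_gt0.
pose D k x := `|g k.+1 x - g k x|.
have Di k : L1 (D k) by apply: L1_norm; apply: r2_L1; exact: r2B.
have Dle k : prim (D k) 1 <= 2^-1 ^+ k.
  pose e : R := 2^-1 ^+ k; have ek : 0 < e by exact: e0.
  have sqL1 := (r2B _ _ (gr k.+1) (gr k)).2.
  have cL1 : L1 (fun=> e / 2) by exact: mbd_L1 (mbd_cst _).
  have := gC k k.+1 (leqnSn _); rewrite -/e => h.
  (* The inequality y <= e / 2 + y^2 / (2 e) stands in for Cauchy-Schwarz: integrated, with the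
     integral of y^2 at most e^2, it gives exactly e. *)
  apply: (@le_trans _ _ (prim (fun x => e / 2 + (2 * e)^-1 * (g k.+1 x - g k x) ^+ 2) 1)).
    apply: le_prim => //; first by apply: L1D => //; exact: L1Z.
    move=> x _; rewrite /D -[X in _ + _ * X]real_normK ?num_real//.
    set y := `|_|; rewrite -subr_ge0.
    have -> : e / 2 + (2 * e)^-1 * y ^+ 2 - y = (2 * e)^-1 * (y - e) ^+ 2.
      by field; rewrite lt0r_neq0.
    by rewrite mulr_ge0 ?sqr_ge0// invr_ge0 mulr_ge0// ltW.
  rewrite primD//; last exact: L1Z.
  rewrite prim_cst primZ//.
  apply: (@le_trans _ _ (e / 2 + (2 * e)^-1 * e ^+ 2)).
    by rewrite lerD2l ler_wpM2l// invr_ge0 mulr_ge0// ltW.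
  by rewrite le_eqVlt; apply/orP; left; apply/eqP; field; rewrite lt0r_neq0.
have [N [mN N0 hN]] := summable_norms_ae_cvg Di (fun k x => normr_ge0 _) Dle.
have cvg_g x : I01 x -> ~ N x -> cvgn (g ^~ x).
  move=> x01 Nx.
  have c1 : cvgn (series (D ^~ x)) by apply: contrapT => nc; apply: Nx; apply: hN => /(_ x01).
  have c2 : cvgn (series (fun k => g k.+1 x - g k x)) by exact: normed_cvg.
  have -> : g ^~ x = fun k => g 0%N x + series (fun k => g k.+1 x - g k x) k.
    by apply/funext => k; rewrite /series/= telescope_sumr// addrC subrK.
  by apply: is_cvgD => //; exact: is_cvg_cst.
(* Cutting off the exceptional null set gives convergence at every point of [0, 1], hence a
   measurable limit. *)
pose gN k x := g k x * \1_(~` N) x.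
have mgN k : measurable_fun I01 (gN k).
  apply: measurable_funM; first exact: (gr k).1.
  by apply: measurable_funTS; exact: (measurable_indic (measurableC mN)).
pose h x := limn (gN ^~ x).
have gNh x : I01 x -> gN ^~ x @ \oo --> h x.
  move=> x01; have [Nx|Nx] := pselect (N x).
    have e k : gN k x = 0 by rewrite /gN indicE memNset ?mulr0// => /(_ Nx).
    rewrite /h (_ : gN ^~ x = fun=> 0); last by apply/funext => k; exact: e.
    have c0 : (fun _ : nat => 0 : R) @ \oo --> (0 : R) by exact: cvg_cst.
    by rewrite (cvg_lim (@norm_hausdorff _ R) c0); exact: c0.
  rewrite /h (_ : gN ^~ x = g ^~ x); first exact: cvg_g.
  by apply/funext => k; rewrite /gN indicE mem_set ?mulr1.
have mh : measurable_fun I01 h by exact: (measurable_fun_cvg mgN gNh).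
have ae_prim (u v : R -> R) : measurable_fun I01 u -> measurable_fun I01 v ->
    (forall x, ~ N x -> u x = v x) ->
    (\int[mu]_(x in I01) (u x)%:E = \int[mu]_(x in I01) (v x)%:E)%E.
  move=> mu1 mv uv; apply: ae_eq_integral; [exact: measurable_I01|exact/measurable_EFinP|exact/measurable_EFinP|].
  have aeN : {ae mu, forall x, ~ N x} by exists N; split=> // x /= /contrapT.
  by apply: (@filterS _ _ (ae_filter_ringOfSetsType mu) _ _ _ aeN) => x /= Nx _; rewrite uv.
have msq (u v : R -> R) : measurable_fun I01 u -> measurable_fun I01 v ->
    measurable_fun I01 (fun x => (u x - v x) ^+ 2).
  by move=> mu1 mv; apply: measurable_funX; exact: measurable_funB.
have gNE k x : ~ N x -> gN k x = g k x.
  by move=> Nx; rewrite /gN indicE mem_set ?mulr1.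
have hle k : (\int[mu]_(x in I01) ((h x - g k x) ^+ 2)%:E <= ((2^-1 ^+ k) ^+ 2)%:E)%E.
  rewrite (ae_prim _ (fun x => (h x - gN k x) ^+ 2)); last 3 first.
  - by apply: msq => //; exact: (gr k).1.
  - exact: msq.
  - by move=> x Nx; rewrite gNE.
  (* The index is shifted by k so that the Cauchy estimate at k applies to every term. *)
  pose f j x := ((gN (j + k)%N x - gN k x) ^+ 2)%:E.
  have := @fatou _ _ R mu I01 measurable_I01 f.
  have mf j : measurable_fun I01 (f j) by apply/measurable_EFinP; exact: msq.
  have f0 j x : I01 x -> (0 <= f j x)%E by move=> _; rewrite lee_fin sqr_ge0.
  move=> /(_ mf f0).
  rewrite (@eq_integral _ _ _ mu I01 (fun x => ((h x - gN k x) ^+ 2)%:E)); last first.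
    move=> x /set_mem x01.
    have hf : f ^~ x @ \oo --> ((h x - gN k x) ^+ 2)%:E.
      apply: cvg_EFin; first exact: nearW.
      have c : (fun j => gN (j + k)%N x - gN k x) @ \oo --> h x - gN k x.
        apply: cvgB; last exact: cvg_cst.
        by rewrite (cvg_shiftn k (gN ^~ x)); exact: gNh.
      by rewrite expr2; apply: cvgM.
    by rewrite (cvg_limn_einf_sup hf).
  move=> fa; apply: (le_trans fa); rewrite limn_einf_lim.
  apply: lime_le; first exact: is_cvg_einfs.
  apply: nearW => j; apply: (@le_trans _ _ (\int[mu]_(x in I01) f j x)%E).
    by apply: ereal_inf_lbound; exists j => /=.
  rewrite /f (ae_prim _ (fun x => (g (j + k)%N x - g k x) ^+ 2)); last 3 first.
  - exact: msq.
  - by apply: msq; [exact: (gr (j + k)%N).1|exact: (gr k).1].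
  - by move=> x Nx; rewrite !gNE.
  rewrite -[leLHS]fineK.
    by rewrite lee_fin; apply: (gC k (j + k)%N); exact: leq_addl.
  by apply: integrable_fin_num; [exact: measurable_I01|exact: (r2B _ _ (gr (j + k)%N) (gr k)).2].
have hgL1 k : L1 (fun x => (h x - g k x) ^+ 2).
  apply/integrableP; split.
    by apply/measurable_EFinP; apply: msq => //; exact: (gr k).1.
  under eq_integral do rewrite gee0_abs ?lee_fin ?sqr_ge0//.
  exact: le_lt_trans (hle k) (ltry _).
have hgr k : r2 (fun x => h x - g k x).
  by split; [apply: measurable_funB => //; exact: (gr k).1|exact: hgL1].
exists h.
  rewrite (_ : h = fun x => (h x - g 0%N x) + g 0%N x); first exact: r2D.
  by apply/funext => x; rewrite subrK.
move=> k; rewrite -lee_fin /prim fineK; first exact: hle.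
by apply: integrable_fin_num; [exact: measurable_I01|exact: hgL1].
Qed.

End RieszFischer.

(** * The quotient space [L2]: representatives, norm and completeness *)

Section L2Hilbert.
Context {R : realType}.
Variable n : nat.
Local Notation C := R[i].
Local Notation mu := (@lebesgue_measure R).
Local Notation I01 := (I01 R).
Local Notation Re := complex.Re.
Local Notation Im := complex.Im.
Local Notation dot := (@L2dot R n).
Implicit Types (f g : R -> 'cV[C]_n) (u v : L2 R n).

Lemma L2classE f (f2 : mxLfun 2%:E f) : L2class f = L2pi (MkL2fun (asboolT f2)).
Proof.
by congr L2pi; apply: val_inj; rewrite insubdK//; exact: asboolT.
Qed.

Lemma L2repr_L2 u : mxLfun 2%:E (L2repr u).
Proof. by case: (L2repr u) => f /= /asboolP. Qed.

Lemma L2class_repr u : L2class (L2repr u) = u.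
Proof. by rewrite /L2class valKd; exact: reprK. Qed.

Lemma L2class_ae f g : mxLfun 2%:E f -> mxLfun 2%:E g ->
  L2class f = L2class g <-> {ae mu, forall x, I01 x -> f x = g x}.
Proof. by move=> f2 g2; rewrite !L2classE; exact: L2piP. Qed.

Lemma L2class_ext f g : mxLfun 2%:E f -> mxLfun 2%:E g ->
  (forall x, I01 x -> f x = g x) -> L2class f = L2class g.
Proof. by move=> f2 g2 fg; apply/L2class_ae => //; apply: aeW => x; exact: fg. Qed.

Lemma L2classD f g : mxLfun 2%:E f -> mxLfun 2%:E g ->
  L2class (fun x => f x + g x) = L2class f + L2class g.
Proof.
move=> f2 g2; rewrite (L2classE (mxL2D f2 g2)) !L2classE -L2piD.
by congr L2pi; exact: val_inj.
Qed.

Lemma mxL2Z (a : C) f : mxLfun 2%:E f -> mxLfun 2%:E (fun x => a *: f x).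
Proof.
move=> f2; have := mxL2_mulmx (mxmbd_cst a%:M) f2.
by congr mxLfun; apply/funext => x; rewrite mul_scalar_mx.
Qed.

Lemma L2classZ (a : C) f : mxLfun 2%:E f ->
  L2class (fun x => a *: f x) = a *: L2class f.
Proof.
move=> f2; rewrite (L2classE (mxL2Z a f2)) L2classE -L2piZ.
by congr L2pi; exact: val_inj.
Qed.

Lemma L2classB f g : mxLfun 2%:E f -> mxLfun 2%:E g ->
  L2class (fun x => f x - g x) = L2class f - L2class g.
Proof.
move=> f2 g2; rewrite -scaleN1r -L2classZ// -L2classD//; last exact: mxL2Z.
by congr L2class; apply/funext => x; rewrite scaleN1r.
Qed.

Lemma L2class0 : L2class (fun=> 0) = 0 :> L2 R n.
Proof.
have f2 : mxLfun 2%:E (fun _ : R => 0 : 'cV[C]_n) by exact: mxmbd_L2 (mxmbd_cst _).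
rewrite -(scale0r (L2class (fun=> 0))) -L2classZ//.
by congr L2class; apply/funext => x; rewrite scaler0.
Qed.

Lemma L2dot_class f g : mxLfun 2%:E f -> mxLfun 2%:E g ->
  dot (L2class f) (L2class g) = cprim (fun x => \sum_i f x i 0 * (g x i 0)^*%C) 1.
Proof. by move=> f2 g2; rewrite !L2classE L2dotE. Qed.

Lemma hn_L2class f : mxLfun 2%:E f -> hn dot (L2class f) ^+ 2 =
  \sum_i (prim (fun x => Re (f x i 0) ^+ 2) 1 + prim (fun x => Im (f x i 0) ^+ 2) 1).
Proof.
move=> f2; rewrite hn_sqr (_ : Re _ = Re (cprim (fun x => \sum_i f x i 0 * (f x i 0)^*%C) 1)); last first.
  by rewrite -L2dot_class.
rewrite Re_cprim.
have fi i : r2 (fun x => Re (f x i 0)) /\ r2 (fun x => Im (f x i 0)).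
  exact/cLfun2P.
rewrite (@eq_prim _ _ (fun x => \sum_i (Re (f x i 0) ^+ 2 + Im (f x i 0) ^+ 2))).
- rewrite prim_sum//; first last.
  + by move=> i; apply: L1D; [exact: (fi i).1.2|exact: (fi i).2.2].
  + exact: I01_1.
  apply: eq_bigr => i _; rewrite primD//; first exact: I01_1.
  + exact: (fi i).1.2.
  + exact: (fi i).2.2.
- exact: I01_1.
move=> x _; rewrite Re_sum; apply: eq_bigr => i _.
by rewrite mulcJE normc_sqr.
Qed.

Lemma L2_complete : hilbert_complete dot.
Proof.
move=> u_ cauchy.
have e0 k : 0 < 2^-1 ^+ k :> R by rewrite exprn_gt0// invr_gt0.
have [N hN] := choice (fun k => cauchy _ (e0 k)).
(* The cumulative sum lies above N j for each j <= k, so that the chosen index meets all earlier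
   tolerances as well. *)
pose phi k := (\sum_(i < k.+1) N i)%N.
have phiN k j : (k <= j)%N -> (N k <= phi j)%N.
  by move=> kj; rewrite /phi (bigD1 (Ordinal (kj : (k < j.+1)%N)))//= leq_addr.
pose v k := u_ (phi k).
have vC k j : (k <= j)%N -> hn dot (v j - v k) <= 2^-1 ^+ k.
  by move=> kj; apply: hN; exact: phiN.
pose f k : R -> 'cV[C]_n := L2repr (v k).
have f2 k : mxLfun 2%:E (f k) by exact: L2repr_L2.
have fi k i : r2 (fun x => Re (f k x i 0)) /\ r2 (fun x => Im (f k x i 0)).
  exact: ((cLfun2P _).1 (f2 k i 0)).
have mxL2B k j : mxLfun 2%:E (fun x => f j x - f k x).
  have := mxL2D (f2 j) (mxL2Z (-1) (f2 k)).
  by congr mxLfun; apply/funext => x; rewrite scaleN1r.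
have fC k j : (k <= j)%N -> \sum_i (prim (fun x => Re ((f j x - f k x) i 0) ^+ 2) 1 +
    prim (fun x => Im ((f j x - f k x) i 0) ^+ 2) 1) <= (2^-1 ^+ k) ^+ 2.
  move=> kj; rewrite -hn_L2class// L2classB// !L2class_repr.
  by apply: lerXn2r; rewrite ?nnegrE ?hn_ge0 ?(ltW (e0 k))//; exact: vC.
have prim_sq_ge0 (w : R -> R) : 0 <= prim (fun x => w x ^+ 2) 1.
  by apply: prim_ge0; [move=> t _; exact: sqr_ge0|exact: I01_1].
have fCi k j i : (k <= j)%N ->
    prim (fun x => Re ((f j x - f k x) i 0) ^+ 2) 1 <= (2^-1 ^+ k) ^+ 2 /\
    prim (fun x => Im ((f j x - f k x) i 0) ^+ 2) 1 <= (2^-1 ^+ k) ^+ 2.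
  move=> kj; have := fC k j kj; rewrite (bigD1 i)//=.
  set s := (X in _ + X); have s0 : 0 <= s by apply: sumr_ge0 => l _; rewrite addr_ge0.
  have := prim_sq_ge0 (fun x => Re ((f j x - f k x) i 0)).
  have := prim_sq_ge0 (fun x => Im ((f j x - f k x) i 0)).
  by move=> *; split; lra.
have hRex i : exists h, r2 h /\ forall k,
    prim (fun x => (h x - Re (f k x i 0)) ^+ 2) 1 <= (2^-1 ^+ k) ^+ 2.
  have [k|k j kj|h h2 hk] := @r2_complete R (fun k x => Re (f k x i 0)).
  - exact: (fi k i).1.
  - have [+ _] := fCi k j i kj; apply: le_trans; rewrite le_eqVlt; apply/orP; left.
    apply/eqP; apply: eq_prim; first exact: I01_1.
    by move=> x _; rewrite !mxE Re_addc Re_oppc.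
  - by exists h.
have hIex i : exists h, r2 h /\ forall k,
    prim (fun x => (h x - Im (f k x i 0)) ^+ 2) 1 <= (2^-1 ^+ k) ^+ 2.
  have [k|k j kj|h h2 hk] := @r2_complete R (fun k x => Im (f k x i 0)).
  - exact: (fi k i).2.
  - have [_ +] := fCi k j i kj; apply: le_trans; rewrite le_eqVlt; apply/orP; left.
    apply/eqP; apply: eq_prim; first exact: I01_1.
    by move=> x _; rewrite !mxE Im_addc Im_oppc.
  - by exists h.
have [hR hRP] := choice hRex; have [hI hIP] := choice hIex.
pose h x : 'cV[C]_n := \col_i (hR i x +i* hI i x).
have h2 : mxLfun 2%:E h.
  move=> i j; apply/cLfun2P; split.
    rewrite (_ : (fun x => _) = hR i); first exact: (hRP i).1.
    by apply/funext => x; rewrite mxE.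
  rewrite (_ : (fun x => _) = hI i); first exact: (hIP i).1.
  by apply/funext => x; rewrite mxE.
pose w := L2class h.
(* The squared norm is a sum of 2 n real contributions, each at most 4^-k; since (2 n + 1)^2 >= 2 n,
   the constant 2 n + 1 avoids a square root. *)
have hv k : hn dot (w - v k) <= (2 * n%:R + 1) * 2^-1 ^+ k.
  rewrite -(@ler_pXn2r _ 2)// ?nnegrE ?hn_ge0 ?mulr_ge0 ?addr_ge0 ?mulr_ge0 ?(ltW (e0 k))//.
  have hf2 : mxLfun 2%:E (fun x => h x - f k x).
    have := mxL2D h2 (mxL2Z (-1) (f2 k)).
    by congr mxLfun; apply/funext => x; rewrite scaleN1r.
  have -> : v k = L2class (f k) by rewrite L2class_repr.
  rewrite /w -L2classB// hn_L2class//.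
  apply: (@le_trans _ _ (\sum_(i < n) 2 * (2^-1 ^+ k) ^+ 2)).
    apply: ler_sum => i _; rewrite mulr_natl mulr2n lerD//.
      have := (hRP i).2 k; apply: le_trans; rewrite le_eqVlt; apply/orP; left.
      apply/eqP; apply: eq_prim; first exact: I01_1.
      by move=> x _; rewrite !mxE Re_addc Re_oppc.
    have := (hIP i).2 k; apply: le_trans; rewrite le_eqVlt; apply/orP; left.
    apply/eqP; apply: eq_prim; first exact: I01_1.
    by move=> x _; rewrite !mxE Im_addc Im_oppc.
  rewrite sumr_const card_ord -[leLHS]mulr_natl exprMn [leLHS]mulrA.
  rewrite ler_wpM2r ?sqr_ge0//.
  have : 0 <= n%:R :> R by [].
  by set m := n%:R => m0; nra.
exists w; apply/cvgrPdist_lt => eps eps0.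
have : geometric (2 * n%:R + 2) (2^-1 : R) @ \oo --> (0 : R).
  by apply: cvg_geometric; rewrite ger0_norm ?invr_ge0// invf_lt1 ?ltr1n.
move=> /cvgrPdist_lt /(_ _ eps0) [k _ /(_ k (leqnn k))].
rewrite sub0r normrN /geometric/= ger0_norm ?mulr_ge0 ?addr_ge0 ?mulr_ge0 ?(ltW (e0 k))//.
move=> hk; exists (N k) => // m /= Nm.
rewrite sub0r normrN ger0_norm ?hn_ge0//; apply: le_lt_trans hk.
rewrite -(subrKA (v k)); apply: le_trans (hnD _ _ _) _.
have -> : 2 * n%:R + 2 = 1 + (2 * n%:R + 1) :> R by ring.
rewrite mulrDl mul1r lerD//; first by apply: hN => //; exact: phiN.
by rewrite hnB_sym.
Qed.

End L2Hilbert.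

(** * Nuclear forms *)

Section NuclearForms.
Context {R : realType}.
Local Notation C := R[i].
Local Notation mu := (@lebesgue_measure R).
Local Notation I01 := (I01 R).
Local Notation L1 f := (mu.-integrable I01 (EFin \o f)).
Local Notation Re := complex.Re.
Local Notation Im := complex.Im.
Local Notation normc := Normc.normc.

Lemma normc_cvg0 (z_ : nat -> C) (z : C) :
  (fun k => Re (z_ k)) @ \oo --> Re z -> (fun k => Im (z_ k)) @ \oo --> Im z ->
  (fun k => normc (z_ k - z)) @ \oo --> (0 : R).
Proof.
move=> zR zI; apply: (squeeze_cvgr (h := fun k => `|Re (z_ k) - Re z| + `|Im (z_ k) - Im z|)
  _ (cvg_cst 0)).
  apply: nearW => k; rewrite normc_ge0/=.
  by have := normc_le_ReIm (z_ k - z); rewrite Re_addc Im_addc Re_oppc Im_oppc.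
rewrite -[X in _ --> X](addr0 0); apply: cvgD.
  rewrite -(normr0 R) -(subrr (Re z)); apply: cvg_norm; apply: cvgB => //; exact: cvg_cst.
rewrite -(normr0 R) -(subrr (Im z)); apply: cvg_norm; apply: cvgB => //; exact: cvg_cst.
Qed.

Lemma normc_cvg_Re (z_ : nat -> C) (z : C) :
  (fun k => normc (z_ k - z)) @ \oo --> (0 : R) -> (fun k => Re (z_ k)) @ \oo --> Re z.
Proof.
move=> h; apply/cvgrPdist_lt => e e0; move/cvgrPdist_lt: h => /(_ _ e0).
apply: filterS => k; rewrite sub0r normrN ger0_norm ?normc_ge0//; apply: le_lt_trans.
by rewrite distrC -Re_oppc -Re_addc; exact: Re_le_normc.
Qed.

Lemma normc_cvg_Im (z_ : nat -> C) (z : C) :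
  (fun k => normc (z_ k - z)) @ \oo --> (0 : R) -> (fun k => Im (z_ k)) @ \oo --> Im z.
Proof.
move=> h; apply/cvgrPdist_lt => e e0; move/cvgrPdist_lt: h => /(_ _ e0).
apply: filterS => k; rewrite sub0r normrN ger0_norm ?normc_ge0//; apply: le_lt_trans.
by rewrite distrC -Im_oppc -Im_addc; exact: Im_le_normc.
Qed.

Lemma cprim_dominated_cvg (f_ : nat -> R -> C) f g x : I01 x ->
  (forall k, cLfun 1 (f_ k)) ->
  (forall t, I01 t -> (fun k => normc (f_ k t - f t)) @ \oo --> (0 : R)) ->
  L1 g -> (forall k t, I01 t -> normc (f_ k t) <= g t) ->
  cLfun 1 f /\ (fun k => normc (cprim (f_ k) x - cprim f x)) @ \oo --> (0 : R).
Proof.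
move=> x01 fi ff gi fg.
have [||//|k t t01|RL Rc] := @prim_dominated_cvg R (fun k t => Re (f_ k t))
    (fun t => Re (f t)) g x x01.
- by move=> k; have /cLfun1P[h _] := fi k; exact: L1_measurable.
- by move=> t t01; exact: normc_cvg_Re (ff t t01).
- exact: le_trans (Re_le_normc _) (fg k t t01).
have [||//|k t t01|IL Ic] := @prim_dominated_cvg R (fun k t => Im (f_ k t))
    (fun t => Im (f t)) g x x01.
- by move=> k; have /cLfun1P[_ h] := fi k; exact: L1_measurable.
- by move=> t t01; exact: normc_cvg_Im (ff t t01).
- exact: le_trans (Im_le_normc _) (fg k t t01).
split; first exact/cLfun1P.
by apply: normc_cvg0; [exact: Rc|exact: Ic].
Qed.

(** Equivalent to the modulus, but a sum of real absolute values: its integrability and the estimate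
    of an integral reduce at once to real functions. *)
Definition norm1c (z : C) : R := `|Re z| + `|Im z|.

Lemma normc_le_norm1c z : normc z <= norm1c z.
Proof. exact: normc_le_ReIm. Qed.

Lemma norm1c_le z : norm1c z <= 2 * normc z.
Proof. by rewrite mulr_natl mulr2n lerD ?Re_le_normc ?Im_le_normc. Qed.

Lemma norm1c_L1 f : cLfun 1 f -> L1 (fun t => norm1c (f t)).
Proof. by move=> /cLfun1P[fR fI]; apply: L1D; exact: L1_norm. Qed.

Lemma normc_cprim_le f : cLfun 1 f -> normc (cprim f 1) <= prim (fun t => norm1c (f t)) 1.
Proof.
move=> /cLfun1P[fR fI]; apply: le_trans (normc_le_ReIm _) _.
rewrite Re_cprim Im_cprim primD; [|exact: I01_1|exact: L1_norm|exact: L1_norm].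
by rewrite lerD//; apply: le_norm_prim => //; exact: I01_1.
Qed.

Context {H : lmodType C}.
Variable dot : {dot H for Num.conj}.
Hypothesis complete : hilbert_complete dot.

(** Stated for forms rather than operators, so that the pieces of a decomposition of <T u, v> can be
    treated without realising each of them as an operator. *)
Definition nuclear_form (beta : H -> H -> C) (t : C) := nuclear_bounded dot beta /\
  forall e, orthonormal_basis dot e ->
    (fun N => normc (\sum_(k < N) beta (e k) (e k) - t)) @ \oo --> (0 : R).

Lemma nuclear_form_ext beta beta' t : (forall u v, beta u v = beta' u v) ->
  nuclear_form beta t -> nuclear_form beta' t.
Proof.
move=> bb; suff -> : beta = beta' by [].
by apply/funext => u; apply/funext => v.
Qed.

Lemma nuclear_formD beta beta' t t' : nuclear_form beta t -> nuclear_form beta' t' ->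
  nuclear_form (fun u v => beta u v + beta' u v) (t + t').
Proof.
move=> [[c hc] ht] [[c' hc'] ht']; split.
  exists (c + c') => N e f one bf.
  apply: (@le_trans _ _ (\sum_(k < N) (normc (beta (e k) (f k)) + normc (beta' (e k) (f k))))).
    by apply: ler_sum => k _; exact: normcD.
  by rewrite big_split lerD ?hc ?hc'.
move=> e be; apply: (squeeze_cvgr (h := fun N =>
  normc (\sum_(k < N) beta (e k) (e k) - t) + normc (\sum_(k < N) beta' (e k) (e k) - t'))
  _ (cvg_cst 0)).
  apply: nearW => N; rewrite normc_ge0/= big_split/= opprD addrACA; exact: normcD.
by rewrite -[X in _ --> X](addr0 0); apply: cvgD; [exact: ht|exact: ht'].
Qed.

Lemma nuclear_form0 : nuclear_form (fun _ _ => 0) 0.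
Proof.
split.
  by exists 0 => N e f _ _; rewrite big1// => k _; rewrite Normc.normc0.
move=> e _; rewrite (_ : (fun N => _) = fun=> 0); first exact: cvg_cst.
by apply/funext => N; rewrite big1// subrr Normc.normc0.
Qed.

Lemma nuclear_form_sum (I : Type) (r : seq I) (beta : I -> H -> H -> C) (t : I -> C) :
  (forall i, nuclear_form (beta i) (t i)) ->
  nuclear_form (fun u v => \sum_(i <- r) beta i u v) (\sum_(i <- r) t i).
Proof.
move=> bt; elim: r => [|i r IH].
  rewrite big_nil; apply: nuclear_form_ext nuclear_form0 => u v; by rewrite big_nil.
rewrite big_cons; apply: nuclear_form_ext (nuclear_formD (bt i) IH) => u v.
by rewrite big_cons.
Qed.

(* For the trace: Parseval at each s, then dominated convergence in s. *)
Lemma nuclear_form_integral (p q : R -> H) (N : R -> C) (K : R) : cLfun 1 N ->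
  (forall s, I01 s -> hn dot (p s) <= K) -> (forall s, I01 s -> hn dot (q s) <= K) ->
  (forall u, cmbd (fun s => dot u (q s))) -> (forall v, cmbd (fun s => dot (p s) v)) ->
  nuclear_form (fun u v => cprim (fun s => N s * dot u (q s) * dot (p s) v) 1)
    (cprim (fun s => N s * dot (p s) (q s)) 1).
Proof.
move=> Ni pK qK qb pb.
have hi u v : cLfun 1 (fun s => N s * dot u (q s) * dot (p s) v).
  by apply: cLfun1M => //; exact: cLfun1M.
have NK : L1 (fun s => norm1c (N s) * K ^+ 2).
  by apply: L1M; [exact: norm1c_L1|exact: mbd_cst].
have K0 : 0 <= K by exact: le_trans (hn_ge0 dot (p 0)) (pK 0 I01_0).
split.
  exists (prim (fun s => 2 * (norm1c (N s) * K ^+ 2)) 1) => m e f one bf.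
  have be := orthonormal_bessel m one.
  apply: (@le_trans _ _ (\sum_(k < m)
    prim (fun s => norm1c (N s * dot (e k) (q s) * dot (p s) (f k))) 1)).
    by apply: ler_sum => k _; exact: normc_cprim_le.
  rewrite -prim_sum; [|exact: I01_1|by move=> k; exact: norm1c_L1].
  apply: le_prim => [|||s s01]; first exact: I01_1.
  - by apply: L1_sum => k; exact: norm1c_L1.
  - exact: L1Z.
  apply: (@le_trans _ _ (\sum_(k < m) 2 * (norm1c (N s) *
      (normc (dot (e k) (q s)) * normc (dot (f k) (p s)))))).
    apply: ler_sum => k _; apply: le_trans (norm1c_le _) _.
    rewrite ler_wpM2l// !Normc.normcM -mulrA [dot (p s) _]dot_conj normc_conj.
    by rewrite ler_wpM2r ?normc_le_norm1c// mulr_ge0 ?normc_ge0.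
  rewrite -mulr_sumr ler_wpM2l// -mulr_sumr ler_wpM2l ?addr_ge0//.
  (* By a b <= (a^2 + b^2) / 2, Bessel's inequality for e at q s and for f at p s bounds the sum by
     K^2. *)
  apply: (@le_trans _ _ (\sum_(k < m) (2^-1 * normc (dot (e k) (q s)) ^+ 2 +
    2^-1 * normc (dot (f k) (p s)) ^+ 2))).
    apply: ler_sum => k _; set a := normc _; set b := normc _.
    by have := sqr_ge0 (a - b); rewrite sqrrB; lra.
  rewrite big_split/= -!mulr_sumr.
  have h1 := be (q s); have h2 := bf (p s).
  have h3 : hn dot (q s) ^+ 2 <= K ^+ 2 by apply: lerXn2r; rewrite ?nnegrE ?hn_ge0 ?qK.
  have h4 : hn dot (p s) ^+ 2 <= K ^+ 2 by apply: lerXn2r; rewrite ?nnegrE ?hn_ge0 ?pK.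
  by lra.
move=> e be.
have := @cprim_dominated_cvg (fun m s => N s * \sum_(k < m) dot (p s) (e k) * dot (e k) (q s))
  (fun s => N s * dot (p s) (q s)) _ 1 I01_1 _ _ NK.
have E m : (fun s => N s * \sum_(k < m) dot (p s) (e k) * dot (e k) (q s)) =
    (fun s => \sum_(k < m) N s * dot (e k) (q s) * dot (p s) (e k)).
  apply/funext => s; rewrite mulr_sumr; apply: eq_bigr => k _; ring.
case=> [m|s s01|m s s01|_].
- by rewrite E; apply: cLfun_sum.
- have [_ hc] := parseval complete (p s) (q s) be.
  rewrite (_ : (fun m => _) = fun m => normc (N s) *
    normc (\sum_(k < m) dot (p s) (e k) * dot (e k) (q s) - dot (p s) (q s))).
    by rewrite -(mulr0 (normc (N s))); apply: cvgM => //; exact: cvg_cst.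
  by apply/funext => m; rewrite -mulrBr Normc.normcM.
- have [hb _] := parseval complete (p s) (q s) be.
  rewrite Normc.normcM ler_pM ?normc_ge0 ?normc_le_norm1c//.
  by apply: le_trans (hb m) _; rewrite expr2 ler_pM ?hn_ge0 ?pK ?qK.
rewrite (_ : (fun k => _) = fun m => normc (\sum_(k < m)
  cprim (fun s => N s * dot (e k) (q s) * dot (p s) (e k)) 1 -
  cprim (fun s => N s * dot (p s) (q s)) 1))//.
apply/funext => m; rewrite E cprim_sum//; exact: I01_1.
Qed.

(** The case of constant families in [nuclear_form_integral], as [0, 1] has length 1. *)
Lemma nuclear_form_rank1 (p q : H) (c : C) :
  nuclear_form (fun u v => c * dot u q * dot p v) (c * dot p q).
Proof.
have cE (z : C) : cprim (fun=> z) 1 = z.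
  by rewrite cprimE !prim_cst; case: z.
have := @nuclear_form_integral (fun=> p) (fun=> q) (fun=> c) (hn dot p + hn dot q).
rewrite cE; case=> [|s _|s _|u|v|].
- exact: cmbd_cLfun1 (cmbd_cst _).
- by rewrite lerDl hn_ge0.
- by rewrite lerDr hn_ge0.
- exact: cmbd_cst.
- exact: cmbd_cst.
by move=> h1 h2; apply: nuclear_form_ext (conj h1 h2) => u v; rewrite cE.
Qed.

Lemma nuclear_form_trace_class (T S : H -> H) t : bounded_op dot T ->
  (forall u v, dot (T u) v = dot u (S v)) ->
  nuclear_form (fun u v => dot (T u) v) t -> trace_class dot T /\ has_trace dot T t.
Proof.
move=> bT TS [nb tr]; split; first exact: trace_class_nuclear bT TS nb.
by move=> e be; apply: cvgC_normc; exact: tr.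
Qed.

End NuclearForms.

(** * The boundary value problem *)

Section RowFunctionals.
Context {R : realType}.
Variable n : nat.
Local Notation C := R[i].
Local Notation I01 := (I01 R).
Local Notation dot := (@L2dot R n).

Definition adjmx m p (A : 'M[C]_(m, p)) : 'M[C]_(p, m) := (map_mx conjc A)^T.

Lemma adjmxE m p (A : 'M[C]_(m, p)) i j : adjmx A i j = (A j i)^*%C.
Proof. by rewrite !mxE. Qed.

Lemma mxL2_adj m p (F : R -> 'M[C]_(m, p)) : mxLfun 2%:E F ->
  mxLfun 2%:E (fun x => adjmx (F x)).
Proof.
move=> F2 i j; have := @cLfun_conj R 2%:E _ _ (F2 j i).
by rewrite lee_fin ler1n => /(_ isT); apply: cLfun_ext => x; rewrite adjmxE.
Qed.

Lemma mxmbd_adj m p (F : R -> 'M[C]_(m, p)) : mxmbd F -> mxmbd (fun x => adjmx (F x)).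
Proof.
by move=> Fb i j; apply: cmbd_ext (cmbd_conj (Fb j i)) => x _; rewrite adjmxE.
Qed.

Lemma L2dot_mxprim (f g : R -> 'cV[C]_n) : mxLfun 2%:E f -> mxLfun 2%:E g ->
  dot (L2class f) (L2class g) = mxprim (fun x => adjmx (g x) *m f x) 1 0 0.
Proof.
move=> f2 g2; rewrite L2dot_class// mxprimE; apply: eq_cprim; first exact: I01_1.
by move=> x _; rewrite mxE; apply: eq_bigr => i _; rewrite adjmxE mulrC.
Qed.

(** The Riesz representative of the functional u |-> int_0^1 r u; the adjoint undoes the conjugation
    of the second argument of [dot]. *)
Definition row_class (r : R -> 'rV[C]_n) : L2 R n := L2class (fun x => adjmx (r x)).

Lemma dot_row_class u r : mxmbd r ->
  dot u (row_class r) = mxprim (fun x => r x *m L2repr u x) 1 0 0.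
Proof.
move=> rb; rewrite -[u in LHS]L2class_repr L2dot_mxprim; last 2 first.
- exact: L2repr_L2.
- exact/mxmbd_L2/mxmbd_adj.
rewrite (@eq_mxprim _ _ _ _ (fun x => r x *m L2repr u x))//; first exact: I01_1.
move=> x _; congr (_ *m _); apply/matrixP => i j.
by rewrite !adjmxE conjcK.
Qed.

Lemma dot_class_repr f v : mxLfun 2%:E f ->
  dot (L2class f) v = mxprim (fun x => adjmx (L2repr v x) *m f x) 1 0 0.
Proof.
move=> f2; rewrite -[v in LHS]L2class_repr L2dot_mxprim//; exact: L2repr_L2.
Qed.

Lemma hn_indicator_le (c : R -> bool) (f : R -> 'cV[C]_n) : mxLfun 2%:E f ->
  mxLfun 2%:E (fun x => (c x)%:R *: f x) ->
  hn dot (L2class (fun x => (c x)%:R *: f x)) <= hn dot (L2class f).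
Proof.
move=> f2 cf2; rewrite -ler_sqr; [|by rewrite nnegrE hn_ge0|by rewrite nnegrE hn_ge0].
have h (a b a' b' : R) : a = a' -> b = b' -> a' <= b' -> a <= b by move=> -> ->.
apply: (h _ _ _ _ (hn_L2class cf2) (hn_L2class f2)).
apply: ler_sum => i _.
have /cLfun2P[[_ fR] [_ fI]] := f2 i 0; have /cLfun2P[[_ cR] [_ cI]] := cf2 i 0.
rewrite lerD//; apply: le_prim => //; try exact: I01_1; move=> x _; rewrite mxE.
  by case: (c x); rewrite ?mul1r// mul0r expr0n sqr_ge0.
by case: (c x); rewrite ?mul1r// mul0r expr0n sqr_ge0.
Qed.

Lemma cprim_indicator (f : R -> C) s : I01 s ->
  cprim f s = cprim (fun t => (t <= s)%R%:R * f t) 1.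
Proof.
move=> s01; rewrite !cprimE; congr (_ +i* _).
  rewrite primE//; apply: eq_prim; first exact: I01_1.
  by move=> t _; case: (t <= s); rewrite ?mulr1 ?mul1r// mulr0 mul0r.
rewrite primE//; apply: eq_prim; first exact: I01_1.
by move=> t _; case: (t <= s); rewrite ?mulr1 ?mul1r// mulr0 mul0r.
Qed.

Lemma mxprim_indicator m p (F : R -> 'M[C]_(m, p)) s : I01 s ->
  mxprim F s = mxprim (fun t => (t <= s)%R%:R *: F t) 1.
Proof.
move=> s01; apply/matrixP => i j; rewrite !mxprimE cprim_indicator//.
by apply: eq_cprim => [|t _]; [exact: I01_1|rewrite mxE].
Qed.

Lemma mxmbd_scale m p (c : R -> C) (F : R -> 'M[C]_(m, p)) : cmbd c -> mxmbd F ->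
  mxmbd (fun x => c x *: F x).
Proof. by move=> cb Fb i j; apply: cmbd_ext (cmbdM cb (Fb i j)) => x _; rewrite mxE. Qed.

Lemma cmbd_gt_ind (s : R) : cmbd (fun t => (~~ (t <= s)%R)%:R).
Proof.
apply: cmbd_ext (cmbdD (cmbd_cst 1) (cmbdM (cmbd_cst (-1)) (cmbd_le_ind s))) => t _.
by case: (t <= s); rewrite ?mulr1 ?mulr0 ?subrr ?addr0.
Qed.

Lemma mxmbd_col m p (F : R -> 'M[C]_(m, p)) j : mxmbd F -> mxmbd (fun x => col j (F x)).
Proof. by move=> Fb i k; apply: cmbd_ext (Fb i j) => x _; rewrite mxE. Qed.

Lemma mxmbd_row m p (F : R -> 'M[C]_(m, p)) i : mxmbd F -> mxmbd (fun x => row i (F x)).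
Proof. by move=> Fb k j; apply: cmbd_ext (Fb i j) => x _; rewrite mxE. Qed.

End RowFunctionals.

Section SourceCoefficients.
Context {R : realType}.
Variables (n : nat) (B : 'M[R[i]]_n) (Psi : R -> 'M[R[i]]_n).
Hypothesis Psi_mbd : mxmbd Psi.
Local Notation iB := ('i%C *: B).

(** The coefficient vector z of variation of constants, normalised by z(0) = 0. *)
Definition source_coef (u : L2 R n) (x : R) : 'cV[R[i]]_n :=
  mxprim (fun t => Psi t *m iB *m L2repr u t) x.

Lemma PsiB_mbd : mxmbd (fun t => Psi t *m iB).
Proof. by apply: mxmbd_mulmx => //; exact: mxmbd_cst. Qed.

Lemma PsiBu_L1 u : mxLfun 1 (fun t => Psi t *m iB *m L2repr u t).
Proof. by apply: mxL1_mulmxl; [exact: PsiB_mbd|apply/mxL21/L2repr_L2]. Qed.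

Lemma source_coef_mbd u : mxmbd (source_coef u).
Proof. exact: mxmbd_prim (PsiBu_L1 u). Qed.

End SourceCoefficients.

(** * The resolvent by variation of constants *)

Section BoundaryValueResolvent.
Context {R : realType}.
Variables (n : nat) (B : 'M[R[i]]_n) (lambda : R[i]).
Hypothesis B_unit : B \in unitmx.
Local Notation C := R[i].
Local Notation mu := (@lebesgue_measure R).
Local Notation I01 := (I01 R).
Local Notation dot := (@L2dot R n).
Local Notation iB := ('i%C *: B).

(** The equation - i B^-1 y' + Q y = lambda y solved for the derivative: y' = iB (lambda - Q) y. *)
Definition ode_coef (Q : R -> 'M[C]_n) (x : R) : 'M[C]_n := iB *m (lambda%:M - Q x).

Lemma ode_coef_L1 Q : mxLfun 1 Q -> mxLfun 1 (ode_coef Q).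
Proof.
move=> Qi; apply: mxL1_mulmxl; first exact: mxmbd_cst.
apply: mxL1D; last exact: mxL1N.
exact: mxmbd_L1 (mxmbd_cst _).
Qed.

Lemma mulNii : - 'i%C * 'i%C = 1 :> C.
Proof. by rewrite mulNr -expr2 sqr_i opprK. Qed.

Lemma diff_expr_ode_coef p Q (Y F : R -> 'M[C]_(n, p)) x :
  diff_expr B Q Y (fun x => ode_coef Q x *m Y x + iB *m F x) x = lambda *: Y x + F x.
Proof.
rewrite /diff_expr /ode_coef -mulmxA -mulmxDr -scalemxAl -scalemxAr mulKmx//.
rewrite scalerA mulNii scale1r mulmxBl mul_scalar_mx.
by rewrite addrAC subrK.
Qed.

(** The equation holds almost everywhere and primitives ignore null sets, so A Phi is an equally
    good derivative of Phi. From here on the equation is an identity between functions. *)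
Lemma fundamental_solution_W11 Q (Phi : R -> 'M[C]_n) : mxLfun 1 Q ->
  fundamental_solution B Q lambda Phi ->
  W11_deriv Phi (fun x => ode_coef Q x *m Phi x) /\ Phi 0 = 1%:M.
Proof.
move=> Qi [Phi' [W Phi0 ae]]; split=> //.
have AL1 : mxLfun 1 (fun x => ode_coef Q x *m Phi x).
  by apply: mxL1_mulmxr; [exact: ode_coef_L1|exact: W11_mbd W].
split=> // x x01; have xI : I01 x by exact/I01P.
rewrite (W11_prim_eq xI W); congr (_ + _).
apply: ae_eq_mxprim => //; first by have [] := W.
apply: (@filterS _ _ (ae_filter_ringOfSetsType mu) _ _ _ ae) => t h /h.
rewrite /diff_expr /ode_coef => E.
rewrite -mulmxA mulmxBl mul_scalar_mx -E addrK -scalemxAr -scalemxAl mulKVmx//.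
by rewrite scalerA [- _ * _]mulrC mulrN -mulNr mulNii scale1r.
Qed.

Variables (Q : R -> 'M[C]_n) (Cm Dm : 'M[C]_n) (Phi Psi : R -> 'M[C]_n).
Hypothesis Q_L1 : mxLfun 1 Q.
Hypothesis WPhi : W11_deriv Phi (fun x => ode_coef Q x *m Phi x).
Hypothesis Phi0 : Phi 0 = 1%:M.
Hypothesis WPsi : W11_deriv Psi (fun x => - (Psi x *m ode_coef Q x)).
Hypothesis PsiPhi : forall x, I01 x -> Psi x *m Phi x = 1%:M.

Let Phi_mbd : mxmbd Phi. Proof. exact: W11_mbd WPhi. Qed.

Let Psi_mbd : mxmbd Psi. Proof. exact: W11_mbd WPsi. Qed.

Lemma PhiPsi x : I01 x -> Phi x *m Psi x = 1%:M.
Proof. by move=> x01; exact: mulmx1C (PsiPhi x01). Qed.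

(** A vector v in the kernel of C + D Phi(1) makes Phi v a solution of the homogeneous boundary
    value problem. As the resolvent sends 0 to 0, Phi v vanishes almost everywhere; applying Psi at
    one zero gives v = 0. *)
Lemma boundary_matrix_unit :
  resolvent_set dot (bvp_op B Q Cm Dm) lambda -> Cm + Dm *m Phi 1 \in unitmx.
Proof.
move=> [S [[lS _] hS]]; rewrite -unitmx_tr unitmxE unitfE; apply/negP => /det0P[w w0 wM].
pose v := w^T; pose y x := Phi x *m v.
have Mv : (Cm + Dm *m Phi 1) *m v = 0.
  by apply: trmx_inj; rewrite trmx_mul trmxK wM trmx0.
have ymbd : mxmbd y by apply: mxmbd_mulmx => //; exact: mxmbd_cst.
have y2 : mxLfun 2%:E y by exact: mxmbd_L2.
pose y' x := ode_coef Q x *m y x + iB *m (0 : 'cV[C]_n).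
have dE : diff_expr B Q y y' = fun x => lambda *: y x.
  by apply/funext => x; rewrite (diff_expr_ode_coef Q y (fun=> 0)) addr0.
have y0 : L2class y = 0.
  have -> : 0 = S 0 by rewrite (linmap0 lS).
  apply/hS; rewrite /shift_op/= add0r; exists y, y'; split=> //.
  - apply: W11_ext (W11_mulmx WPhi (W11_cst v)) => x _ //.
    by rewrite mulmx0 addr0 /y' mulmx0 addr0 mulmxA.
  - by rewrite dE; exact: mxL2Z.
  - by rewrite /y Phi0 mul1mx mulmxA -mulmxDl.
  - by rewrite dE L2classZ.
have {}y0 : {ae mu, forall x, I01 x -> y x = 0}.
  have z2 : mxLfun 2%:E (fun _ : R => 0 : 'cV[C]_n) by exact: mxmbd_L2 (mxmbd_cst _).
  by apply/(L2class_ae y2 z2); rewrite L2class0.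
(* The interval has measure 1, so it is not contained in the null set where y may differ from 0. *)
have [x [x01 yx]] : exists x, I01 x /\ y x = 0.
  apply: contrapT => nx; move: y0 => [N [mN N0 sN]].
  have : (mu I01 <= mu N)%E.
    apply: le_measure; rewrite ?inE//; first exact: measurable_I01.
    by move=> x x01; apply: sN => /= /(_ x01) yx; apply: nx; exists x.
  by rewrite N0 mu_I01 lee_fin ler10.
move: w0; rewrite -(inj_eq (@trmx_inj _ _ _)) trmx0 -/v => /eqP; apply.
by rewrite -[v]mul1mx -(PsiPhi x01) -mulmxA -/(y x) yx mulmx0.
Qed.

Definition bvp_solution (K : 'M[C]_n) (u : L2 R n) (x : R) : 'cV[C]_n :=
  Phi x *m (source_coef B Psi u x + K *m source_coef B Psi u 1).

Lemma bvp_solution_mbd K u : mxmbd (bvp_solution K u).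
Proof.
apply: mxmbd_mulmx => //; apply: mxmbdD; [exact: source_coef_mbd|exact: mxmbd_cst].
Qed.

Lemma W11_Phi_source u (c : 'cV[C]_n) :
  W11_deriv (fun x => Phi x *m (source_coef B Psi u x + c))
    (fun x => ode_coef Q x *m (Phi x *m (source_coef B Psi u x + c)) + iB *m L2repr u x).
Proof.
have h := W11_mulmx WPhi (W11D (W11_prim (PsiBu_L1 B Psi_mbd u)) (W11_cst c)).
apply: W11_ext h => // x x01.
by rewrite addr0 -!mulmxA [Phi x *m (Psi x *m _)]mulmxA (PhiPsi x01) mul1mx.
Qed.

(** The boundary condition C y(0) + D y(1) = 0 amounts to (C + D Phi(1)) K = - D Phi(1) on z(1),
    which determines K. Membership of the resulting pair in the shifted graph then identifies it
    with S u. *)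
Lemma resolventE S u : is_resolvent dot (bvp_op B Q Cm Dm) lambda S ->
  Cm + Dm *m Phi 1 \in unitmx ->
  S u = L2class (bvp_solution (- (invmx (Cm + Dm *m Phi 1) *m Dm *m Phi 1)) u).
Proof.
move=> [_ hS] Mu; set K := - _; apply/esym/hS; rewrite /shift_op/=.
pose y := bvp_solution K u.
pose y' x := ode_coef Q x *m y x + iB *m L2repr u x.
have dE : diff_expr B Q y y' = fun x => lambda *: y x + L2repr u x.
  by apply/funext => x; rewrite (diff_expr_ode_coef Q y (L2repr u)).
have y2 : mxLfun 2%:E y by exact: mxmbd_L2 (bvp_solution_mbd K u).
have u2 := L2repr_L2 u.
exists y, y'; split=> //.
- exact: W11_Phi_source.
- by rewrite dE; apply: mxL2D => //; exact: mxL2Z.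
- rewrite /y /bvp_solution Phi0 mul1mx {1}/source_coef mxprim0 add0r.
  set w := source_coef B Psi u 1.
  have MK : (Cm + Dm *m Phi 1) *m K = - (Dm *m Phi 1).
    by rewrite mulmxN -[_ *m Dm *m _]mulmxA mulKVmx.
  transitivity ((Dm *m Phi 1 + (Cm + Dm *m Phi 1) *m K) *m w).
    rewrite [in RHS]mulmxDl [in RHS](mulmxDl Cm) [in RHS](mulmxDl (Cm *m K)).
    by rewrite !mulmxDr !mulmxA addrCA.
  by rewrite MK addrN mul0mx.
- rewrite dE L2classD//; last exact: mxL2Z.
  by rewrite L2classZ// L2class_repr addrC.
Qed.

End BoundaryValueResolvent.

Lemma eq_entry (R : Type) m n (A A' : 'M[R]_(m, n)) i j : A = A' -> A i j = A' i j.
Proof. by move=> ->. Qed.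

Lemma addmx_entry (R : nmodType) m n (A A' : 'M[R]_(m, n)) i j :
  (A + A') i j = A i j + A' i j.
Proof. by rewrite mxE. Qed.

Lemma col_mulmx (R : pzSemiRingType) m n p (A : 'M[R]_(m, n)) (A' : 'M[R]_(n, p)) j :
  col j (A *m A') = A *m col j A'.
Proof. by apply/matrixP => i k; rewrite !mxE; apply: eq_bigr => l _; rewrite mxE. Qed.

(** * Sesquilinear forms of the Volterra term and the boundary term *)

Section BoundaryValueForms.
Context {R : realType}.
Variables (n : nat) (B : 'M[R[i]]_n).
Local Notation C := R[i].
Local Notation dot := (@L2dot R n).
Local Notation iB := ('i%C *: B).
Variables (Phi Psi : R -> 'M[C]_n).
Hypothesis Phi_mbd : mxmbd Phi.
Hypothesis Psi_mbd : mxmbd Psi.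

Local Notation source_coef := (source_coef B Psi).
Local Notation bvp_solution := (bvp_solution B Phi Psi).

(** The counterpart of [source_coef] for the second argument: after integration by parts v enters
    only through [adj_coef v 1 - adj_coef v t], the integral of the adjoint of v times Phi over
    [t, 1]. *)
Definition adj_coef (v : L2 R n) (x : R) : 'rV[C]_n :=
  mxprim (fun t => adjmx (L2repr v t) *m Phi t) x.

Lemma adj_coef_L1 v : mxLfun 1 (fun t => adjmx (L2repr v t) *m Phi t).
Proof. by apply: mxL1_mulmxr => //; apply/mxL21/mxL2_adj/L2repr_L2. Qed.

Lemma adj_coef_mbd v : mxmbd (adj_coef v).
Proof. exact: mxmbd_prim (adj_coef_L1 v). Qed.

Lemma dot_Phi_prim v (G : R -> 'cV[C]_n) : mxLfun 1 G ->
  dot (L2class (fun x => Phi x *m mxprim G x)) v =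
  mxprim (fun t => (adj_coef v 1 - adj_coef v t) *m G t) 1 0 0.
Proof.
move=> Gi; rewrite dot_class_repr; last first.
  by apply: mxmbd_L2; apply: mxmbd_mulmx => //; exact: mxmbd_prim.
apply: eq_entry.
have := mxprim_by_parts I01_1 (adj_coef_L1 v) Gi; rewrite -!/(adj_coef v _) => <-.
by apply: eq_mxprim => [|t _]; [exact: I01_1|rewrite mulmxA].
Qed.

Lemma dot_Phi_cst v (c : 'cV[C]_n) :
  dot (L2class (fun x => Phi x *m c)) v = (adj_coef v 1 *m c) 0 0.
Proof.
rewrite dot_class_repr; last first.
  by apply: mxmbd_L2; apply: mxmbd_mulmx => //; exact: mxmbd_cst.
rewrite /adj_coef -mxprim_mulmxr; [|exact: I01_1|exact: adj_coef_L1].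
apply: eq_entry; apply: eq_mxprim => [|t _]; first exact: I01_1.
by rewrite mulmxA.
Qed.

Lemma bvp_solution_split K u : L2class (bvp_solution K u) =
  L2class (fun x => Phi x *m source_coef u x) +
  L2class (fun x => Phi x *m (K *m source_coef u 1)).
Proof.
rewrite -L2classD; last 2 first.
- by apply: mxmbd_L2; apply: mxmbd_mulmx => //; exact: source_coef_mbd.
- by apply: mxmbd_L2; apply: mxmbd_mulmx => //; exact: mxmbd_cst.
by congr L2class; apply/funext => x; rewrite -mulmxDr.
Qed.

(** The representative is explicit: integration by parts turns the pairing with v into the integral
    of a bounded row kernel r against u. *)
Lemma bvp_solution_adjoint K v : exists w, forall u,
  dot (L2class (bvp_solution K u)) v = dot u w.
Proof.
pose r t := (adj_coef v 1 - adj_coef v t + adj_coef v 1 *m K) *m (Psi t *m iB).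
have ab := adj_coef_mbd v.
have ab1 : mxmbd (fun t => adj_coef v 1 - adj_coef v t).
  by apply: mxmbdD; [exact: mxmbd_cst|exact: mxmbdN].
have rb : mxmbd r.
  apply: mxmbd_mulmx; last by apply: mxmbd_mulmx => //; exact: mxmbd_cst.
  by apply: mxmbdD => //; exact: mxmbd_cst.
exists (row_class r) => u; rewrite dot_row_class// bvp_solution_split dotDl.
rewrite [X in X + _](dot_Phi_prim v (PsiBu_L1 B Psi_mbd u)).
rewrite [X in _ + X](dot_Phi_cst v (K *m source_coef u 1)).
have -> : mxprim (fun x => r x *m L2repr u x) 1 =
    mxprim (fun t => (adj_coef v 1 - adj_coef v t) *m (Psi t *m iB *m L2repr u t)) 1 +
    adj_coef v 1 *m (K *m source_coef u 1).
  rewrite mulmxA -(mxprim_mulmxl _ I01_1 (PsiBu_L1 B Psi_mbd u)) -mxprimD.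
  - apply: eq_mxprim => [|t _]; first exact: I01_1.
    by rewrite -mulmxDl /r !mulmxA.
  - exact: I01_1.
  - by apply: mxL1_mulmxl => //; exact: PsiBu_L1.
  - by apply: mxL1_mulmxl; [exact: mxmbd_cst|exact: PsiBu_L1].
by rewrite addmx_entry.
Qed.

Lemma mxtrace_mxprim (F : R -> 'M[C]_n) : mxLfun 1 F ->
  \tr (mxprim F 1) = cprim (fun t => \tr (F t)) 1.
Proof.
move=> Fi; rewrite /mxtrace cprim_sum; [|exact: I01_1|by move=> i; exact: Fi].
by apply: eq_bigr => i _; rewrite mxprimE.
Qed.

(** The form is the sum over a, b of K a b <u, q b> <p a, v>, with p a the columns of Phi and q b
    the functionals given by the rows of Psi iB. Its trace is that of K times the integral of Psi iB
    Phi, and cyclicity under the integral gives the stated order. *)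
Lemma nuclear_boundary_form K : nuclear_form dot
  (fun u v => (adj_coef v 1 *m (K *m source_coef u 1)) 0 0)
  (\tr (mxprim (fun x => Phi x *m K *m Psi x *m iB) 1)).
Proof.
have PsiB_b : mxmbd (fun t => Psi t *m iB).
  by apply: mxmbd_mulmx => //; exact: mxmbd_cst.
pose p a := L2class (fun x => col a (Phi x)).
pose q b := row_class (fun t => row b (Psi t *m iB)).
have p2 a : mxLfun 2%:E (fun x => col a (Phi x)) by exact/mxmbd_L2/mxmbd_col.
have dpv a v : dot (p a) v = adj_coef v 1 0 a.
  rewrite dot_class_repr// /adj_coef !mxprimE; apply: eq_cprim => [|t _]; first exact: I01_1.
  by rewrite -col_mulmx mxE.
have duq b u : dot u (q b) = source_coef u 1 b 0.
  rewrite dot_row_class; last exact: mxmbd_row.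
  rewrite /source_coef !mxprimE; apply: eq_cprim => [|t _]; first exact: I01_1.
  by rewrite -row_mul mxE.
have dpq a b : dot (p a) (q b) = mxprim (fun x => Psi x *m iB *m Phi x) 1 b a.
  rewrite L2dot_mxprim//; last exact/mxmbd_L2/mxmbd_adj/mxmbd_row.
  rewrite !mxprimE; apply: eq_cprim => [|t _]; first exact: I01_1.
  have -> : adjmx (adjmx (row b (Psi t *m iB))) = row b (Psi t *m iB).
    by apply/matrixP => i j; rewrite !adjmxE conjcK.
  by rewrite -row_mul mxE -col_mulmx mxE.
have := nuclear_form_sum (index_enum 'I_n) (fun a => nuclear_form_sum (index_enum 'I_n)
  (fun b => nuclear_form_rank1 (@L2_complete R n) (p a) (q b) (K a b))).
have -> : \sum_a \sum_b K a b * dot (p a) (q b) =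
    \tr (mxprim (fun x => Phi x *m K *m Psi x *m iB) 1).
  transitivity (\tr (K *m mxprim (fun x => Psi x *m iB *m Phi x) 1)).
    by apply: eq_bigr => a _; rewrite mxE; apply: eq_bigr => b _; rewrite dpq.
  have Kb := mxmbd_cst K; have PBP : mxmbd (fun x => Psi x *m iB *m Phi x).
    exact: mxmbd_mulmx.
  have F1 := mxmbd_L1 (mxmbd_mulmx Kb PBP).
  have F2 := mxmbd_L1 (mxmbd_mulmx (mxmbd_mulmx (mxmbd_mulmx Phi_mbd Kb) Psi_mbd)
    (mxmbd_cst iB)).
  rewrite -(mxprim_mulmxl K I01_1 (mxmbd_L1 PBP)).
  apply: (etrans (mxtrace_mxprim F1)); apply: (etrans _ (esym (mxtrace_mxprim F2))).
  apply: eq_cprim => [|t _]; first exact: I01_1.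
  by rewrite !mulmxA mxtrace_mulC !mulmxA.
apply: nuclear_form_ext => u v; rewrite mxE; apply: eq_bigr => a _.
rewrite [X in _ = _ * X]mxE mulr_sumr; apply: eq_bigr => b _.
rewrite [RHS]mulrC; congr (_ * _ * _); [exact: duq|exact: dpv].
Qed.

End BoundaryValueForms.

(** The pointwise derivative of Psi1 (y1 - y2) when y_j' = A_j y_j + s and y2 = Phi2 z2: the common
    source s cancels and A1 - A2 acting on y2 remains. *)
Lemma variation_identity (R : pzRingType) n (P A A' F : 'M[R]_n) (y y' s : 'cV[R]_n) :
  - (P *m A) *m (y - F *m y') + P *m (A *m y + s - (A' *m (F *m y') + s)) =
  P *m (A - A') *m F *m y'.
Proof.
rewrite opprD addrACA subrr addr0 mulNmx -!mulmxA -mulmxN -mulmxDr.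
by congr (_ *m _); rewrite mulmxBr opprB addrA subrK -mulmxBl.
Qed.

(** * The difference of the two Volterra terms *)

Section VolterraDifference.
Context {R : realType}.
Variables (n : nat) (B : 'M[R[i]]_n) (lambda : R[i]).
Local Notation C := R[i].
Local Notation I01 := (I01 R).
Local Notation dot := (@L2dot R n).
Local Notation iB := ('i%C *: B).
Variables (Q1 Q2 Phi1 Phi2 Psi1 Psi2 : R -> 'M[C]_n).
Local Notation A1 := (ode_coef B lambda Q1).
Local Notation A2 := (ode_coef B lambda Q2).
Hypothesis Q1_L1 : mxLfun 1 Q1.
Hypothesis Q2_L1 : mxLfun 1 Q2.
Hypothesis WPhi1 : W11_deriv Phi1 (fun x => A1 x *m Phi1 x).
Hypothesis WPhi2 : W11_deriv Phi2 (fun x => A2 x *m Phi2 x).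
Hypothesis WPsi1 : W11_deriv Psi1 (fun x => - (Psi1 x *m A1 x)).
Hypothesis WPsi2 : W11_deriv Psi2 (fun x => - (Psi2 x *m A2 x)).
Hypothesis PsiPhi1 : forall x, I01 x -> Psi1 x *m Phi1 x = 1%:M.
Hypothesis PsiPhi2 : forall x, I01 x -> Psi2 x *m Phi2 x = 1%:M.

Let N s := Psi1 s *m (A1 s - A2 s) *m Phi2 s.

Lemma volterra_coef_L1 : mxLfun 1 N.
Proof.
apply: mxL1_mulmxr; last exact: W11_mbd WPhi2.
apply: mxL1_mulmxl; first exact: W11_mbd WPsi1.
by apply: mxL1D; [|apply: mxL1N]; exact: ode_coef_L1.
Qed.

Let z1 u := source_coef B Psi1 u.
Let z2 u := source_coef B Psi2 u.

Let Nz_L1 u : mxLfun 1 (fun s => N s *m z2 u s).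
Proof.
apply: mxL1_mulmxr; first exact: volterra_coef_L1.
by apply: source_coef_mbd; exact: W11_mbd WPsi2.
Qed.

(** With y_j = Phi_j z_j, the function Psi1 (y1 - y2) vanishes at 0 and has derivative N z2 by
    [variation_identity]; multiplication by Phi1 recovers y1 - y2. *)
Lemma volterra_difference u x : I01 x ->
  Phi1 x *m z1 u x - Phi2 x *m z2 u x =
  Phi1 x *m mxprim (fun s => N s *m z2 u s) x.
Proof.
move=> x01.
have W (Q Phi Psi : R -> 'M[C]_n) (WPhi : W11_deriv Phi (fun x => ode_coef B lambda Q x *m Phi x))
    (WPsi : W11_deriv Psi (fun x => - (Psi x *m ode_coef B lambda Q x)))
    (PsiPhi : forall x, I01 x -> Psi x *m Phi x = 1%:M) :
    W11_deriv (fun x => Phi x *m source_coef B Psi u x)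
    (fun x => ode_coef B lambda Q x *m (Phi x *m source_coef B Psi u x) + iB *m L2repr u x).
  by apply: W11_ext (W11_Phi_source WPhi WPsi PsiPhi u 0) => t _; rewrite addr0.
have W1 := W _ _ _ WPhi1 WPsi1 PsiPhi1; have W2 := W _ _ _ WPhi2 WPsi2 PsiPhi2.
have W3 := W11_mulmx WPsi1 (W11D W1 (W11N W2)).
have := W11_prim_eq x01 W3.
rewrite /source_coef !mxprim0 !mulmx0 subr0 mulmx0 add0r => E.
have P1 : Phi1 x *m Psi1 x = 1%:M by exact: mulmx1C (PsiPhi1 x01).
rewrite -[LHS]mul1mx -P1 -mulmxA; congr (_ *m _).
rewrite [LHS]E; apply: eq_mxprim => // t _.
exact: variation_identity.
Qed.

(** Integrated by parts, the form is the integral of a(s) N(s) z2(s) with a(s) =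
    [adj_coef Phi1 v 1 - adj_coef Phi1 v s]. Expanding the matrix product, each entry of N becomes
    the integrable weight of one application of [nuclear_form_integral]. *)
Lemma nuclear_volterra_form : nuclear_form dot
  (fun u v => dot (L2class (fun x => Phi1 x *m z1 u x) -
                   L2class (fun x => Phi2 x *m z2 u x)) v) 0.
Proof.
have Phi1_b := W11_mbd WPhi1; have Phi2_b := W11_mbd WPhi2.
have Psi1_b := W11_mbd WPsi1; have Psi2_b := W11_mbd WPsi2.
have PsiB_b : mxmbd (fun t => Psi2 t *m iB).
  by apply: mxmbd_mulmx => //; exact: mxmbd_cst.
(* pf a s vanishes for x <= s and qf b s for x > s: hence the trace 0. *)
pose pf a s x := (~~ (x <= s)%R)%:R *: col a (Phi1 x) : 'cV[C]_n.
pose qf b s x := (x <= s)%R%:R *: row b (Psi2 x *m iB) : 'rV[C]_n.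
have pf_b a s : mxmbd (pf a s) by apply: mxmbd_scale; [exact: cmbd_gt_ind|exact: mxmbd_col].
have qf_b b s : mxmbd (qf b s) by apply: mxmbd_scale; [exact: cmbd_le_ind|exact: mxmbd_row].
pose p a s := L2class (pf a s); pose q b s := row_class (qf b s).
have duq b u s : I01 s -> dot u (q b s) = z2 u s b 0.
  move=> s01; rewrite dot_row_class// /z2 /source_coef (mxprim_indicator _ s01).
  rewrite !mxprimE; apply: eq_cprim => [|t _]; first exact: I01_1.
  by rewrite -scalemxAl mxE [RHS]mxE -row_mul mxE.
have dpv a v s : I01 s -> dot (p a s) v = (adj_coef Phi1 v 1 - adj_coef Phi1 v s) 0 a.
  move=> s01; rewrite dot_class_repr; last exact: mxmbd_L2.
  have E : adj_coef Phi1 v 1 = adj_coef Phi1 v s +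
      mxprim (fun t => (~~ (t <= s)%R)%:R *: (adjmx (L2repr v t) *m Phi1 t)) 1.
    rewrite /adj_coef (mxprim_indicator _ s01) -mxprimD; first last.
    - move=> i j; apply: cLfun_ext (cLfun1M (adj_coef_L1 Phi1_b v i j) (cmbd_gt_ind s)) => t.
      by rewrite [RHS]mxE mulrC.
    - move=> i j; apply: cLfun_ext (cLfun1M (adj_coef_L1 Phi1_b v i j) (cmbd_le_ind s)) => t.
      by rewrite [RHS]mxE mulrC.
    - exact: I01_1.
    apply: eq_mxprim => [|t _]; first exact: I01_1.
    by case: (t <= s)%R; rewrite scale1r scale0r ?addr0 ?add0r.
  rewrite E addrC addKr; rewrite !mxprimE; apply: eq_cprim => [|t _]; first exact: I01_1.
  by rewrite -scalemxAr mxE [RHS]mxE -col_mulmx mxE.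
have dpq a b s : dot (p a s) (q b s) = 0.
  rewrite L2dot_mxprim; [|exact: mxmbd_L2|exact/mxmbd_L2/mxmbd_adj].
  rewrite mxprimE (@eq_cprim _ _ (fun=> 0 * 0)) => [|//|t _]; last first.
  - rewrite mul0r (_ : adjmx (adjmx _) = qf b s t); last first.
      by apply/matrixP => i j; rewrite !adjmxE conjcK.
    rewrite /qf /pf -scalemxAl -scalemxAr scalerA.
    by case: (t <= s)%R; rewrite ?mulr0 ?mul0r scale0r mxE.
  - exact: I01_1.
  by rewrite cprimZ ?mul0r//; [exact: I01_1|exact: cLfun0].
have nab a b : nuclear_form dot
    (fun u v => cprim (fun s => N s a b * dot u (q b s) * dot (p a s) v) 1) 0.
  (* One constant has to bound both families; cutting off lowers the norm, so the sum of the norms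
     of the full column and the full row serves for all s. *)
  have := @nuclear_form_integral R _ dot (@L2_complete R n) (p a) (q b) (fun s => N s a b)
    (hn dot (L2class (fun x => col a (Phi1 x))) +
     hn dot (row_class (fun x => row b (Psi2 x *m iB)))).
  rewrite [X in nuclear_form _ _ X](_ : _ = 0); last first.
    rewrite (@eq_cprim _ _ (fun=> 0 * 0)) => [|//|t _]; last by rewrite [X in _ * X](dpq a b t) mulr0 mul0r.
    - by rewrite cprimZ ?mul0r//; [exact: I01_1|exact: cLfun0].
    - exact: I01_1.
  apply.
  - exact: volterra_coef_L1.
  - move=> s _; apply: ler_wpDr; first exact: hn_ge0.
    apply: (hn_indicator_le (c := fun x => ~~ (x <= s)%R)); first exact/mxmbd_L2/mxmbd_col.
    exact: (mxmbd_L2 (pf_b a s)).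
  - move=> s _; apply: ler_wpDl; first exact: hn_ge0.
    have -> : q b s = L2class (fun x => (x <= s)%R%:R *: adjmx (row b (Psi2 x *m iB))).
      congr L2class; apply/funext => x; apply/matrixP => i j.
      rewrite [RHS]mxE !adjmxE [X in conjc X = _]mxE.
      by case: (x <= s)%R; rewrite ?mul1r ?mul0r ?conjc0.
    apply: hn_indicator_le; first exact/mxmbd_L2/mxmbd_adj/mxmbd_row.
    by apply/mxmbd_L2/mxmbd_scale; [exact: cmbd_le_ind|exact/mxmbd_adj/mxmbd_row].
  - move=> u; apply: cmbd_ext (source_coef_mbd B Psi2_b u b 0) => s s01.
    exact/esym/duq.
  - move=> v; apply: cmbd_ext (mxmbdD (mxmbd_cst (adj_coef Phi1 v 1))
      (mxmbdN (adj_coef_mbd Phi1_b v)) 0 a) => s s01.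
    exact/esym/dpv.
have := nuclear_form_sum (index_enum 'I_n) (fun a => nuclear_form_sum (index_enum 'I_n)
  (fun b => nab a b)).
rewrite big1 => [|a _]; last by rewrite big1.
apply: nuclear_form_ext => u v.
have z1_b := source_coef_mbd B Psi1_b u.
have z2_b := source_coef_mbd B Psi2_b u.
rewrite -L2classB; last 2 first.
- exact: (mxmbd_L2 (mxmbd_mulmx Phi1_b z1_b)).
- exact: (mxmbd_L2 (mxmbd_mulmx Phi2_b z2_b)).
have -> : L2class (fun x => Phi1 x *m z1 u x - Phi2 x *m z2 u x) =
    L2class (fun x => Phi1 x *m mxprim (fun s => N s *m z2 u s) x).
  apply: L2class_ext => [||x x01]; last exact: volterra_difference.
  - exact: (mxmbd_L2 (mxmbdD (mxmbd_mulmx Phi1_b z1_b)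
      (mxmbdN (mxmbd_mulmx Phi2_b z2_b)))).
  - exact: (mxmbd_L2 (mxmbd_mulmx Phi1_b (mxmbd_prim (Nz_L1 u)))).
rewrite (dot_Phi_prim Phi1_b v (Nz_L1 u)) mxprimE.
have cL a b : cLfun 1 (fun s => N s a b * z2 u s b 0 *
    (adj_coef Phi1 v 1 - adj_coef Phi1 v s) 0 a).
  apply: cLfun1M.
    by apply: cLfun1M; [exact: volterra_coef_L1|exact: z2_b].
  exact: (mxmbdD (mxmbd_cst (adj_coef Phi1 v 1)) (mxmbdN (adj_coef_mbd Phi1_b v)) 0 a).
transitivity (\sum_a \sum_b cprim (fun s => N s a b * z2 u s b 0 *
    (adj_coef Phi1 v 1 - adj_coef Phi1 v s) 0 a) 1).
  apply: eq_bigr => a _; apply: eq_bigr => b _; apply: eq_cprim => [|s s01].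
    exact: I01_1.
  by congr (_ * _ * _); [exact: duq|exact: dpv].
transitivity (\sum_a cprim (fun s => \sum_b N s a b * z2 u s b 0 *
    (adj_coef Phi1 v 1 - adj_coef Phi1 v s) 0 a) 1).
  by apply: eq_bigr => a _; rewrite cprim_sum//; exact: I01_1.
rewrite -cprim_sum; [|exact: I01_1|by move=> a; exact: cLfun_sum].
apply: eq_cprim => [|s _]; first exact: I01_1.
rewrite [RHS]mxE; apply: eq_bigr => a _; rewrite [X in _ = _ * X]mxE mulr_sumr.
by apply: eq_bigr => b _; rewrite [RHS]mulrC.
Qed.

End VolterraDifference.

(** * Assembly of the difference of the resolvents and its trace *)

Section ResolventDifference.
Context {R : realType}.
Variables (n : nat) (B : 'M[R[i]]_n) (lambda : R[i]).
Hypothesis B_unit : B \in unitmx.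
Local Notation C := R[i].
Local Notation I01 := (I01 R).
Local Notation dot := (@L2dot R n).
Local Notation iB := ('i%C *: B).

Lemma resolventP (A : set (L2 R n * L2 R n)) (l : C) : resolvent_set dot A l ->
  is_resolvent dot A l (resolvent dot A l).
Proof. by move=> hA; exact: (@xgetPex _ (fun=> 0) _ hA). Qed.

(** From M0 = C + D F1 one gets M0^-1 C + M0^-1 D F1 = 1, so K = M0^-1 C - 1. The remainder - iB is
    the same for both problems and drops out of the difference. *)
Lemma boundary_trace_integrand (M0 Cm Dm F1 F X : 'M[C]_n) :
  M0 = Cm + Dm *m F1 -> M0 \in unitmx -> X *m F = 1%:M ->
  F *m - (invmx M0 *m Dm *m F1) *m X *m iB =
  F *m invmx M0 *m Cm *m invmx F *m iB - iB.
Proof.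
move=> M0E M0u XF; have FX := mulmx1C XF.
have [Fu _] := mulmx1_unit FX.
have -> : invmx F = X by rewrite -[LHS]mul1mx -XF mulmxK.
have -> : - (invmx M0 *m Dm *m F1) = invmx M0 *m Cm - 1%:M.
  have : invmx M0 *m Cm + invmx M0 *m Dm *m F1 = 1%:M.
    by rewrite -mulmxA -mulmxDr -M0E mulVmx.
  by move=> <-; rewrite opprD addrA subrr add0r.
by rewrite mulmxBr mulmx1 mulmxBl FX mulmxBl mul1mx !mulmxA.
Qed.

Lemma linear_sub_fun (U V : lmodType C) (f g : U -> V) :
  linear f -> linear g -> linear (f \- g).
Proof. by move=> lf lg a u v; rewrite /= lf lg scalerBr opprD addrACA. Qed.

(** Formulated for any normalised solutions Phi_j of the equation, so that it covers both
    constructed fundamental matrices and those given in the trace formula. *)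
Lemma resolvent_difference_nuclear (Q1 Q2 Phi1 Phi2 : R -> 'M[C]_n)
    (C1 D1 C2 D2 : 'M[C]_n) :
  mxLfun 1 Q1 -> mxLfun 1 Q2 ->
  W11_deriv Phi1 (fun x => ode_coef B lambda Q1 x *m Phi1 x) -> Phi1 0 = 1%:M ->
  W11_deriv Phi2 (fun x => ode_coef B lambda Q2 x *m Phi2 x) -> Phi2 0 = 1%:M ->
  resolvent_set dot (bvp_op B Q1 C1 D1) lambda ->
  resolvent_set dot (bvp_op B Q2 C2 D2) lambda ->
  let T := resolvent dot (bvp_op B Q1 C1 D1) lambda
        \- resolvent dot (bvp_op B Q2 C2 D2) lambda in
  trace_class dot T /\
  has_trace dot T (\tr (mxintegral I01 (fun x =>
    (Phi1 x *m invmx (C1 + D1 *m Phi1 1) *m C1 *m invmx (Phi1 x)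
     - Phi2 x *m invmx (C2 + D2 *m Phi2 1) *m C2 *m invmx (Phi2 x)) *m iB))).
Proof.
move=> Q1i Q2i W1 P10 W2 P20 rho1 rho2 T.
have [Psi1 WX1 XP1] := linear_ode_inverse (ode_coef_L1 B lambda Q1i).
have [Psi2 WX2 XP2] := linear_ode_inverse (ode_coef_L1 B lambda Q2i).
have {}XP1 := XP1 _ W1 P10; have {}XP2 := XP2 _ W2 P20.
have U1 := boundary_matrix_unit B_unit W1 P10 XP1 rho1.
have U2 := boundary_matrix_unit B_unit W2 P20 XP2 rho2.
have R1 := resolventP rho1; have R2 := resolventP rho2.
have P1b := W11_mbd W1; have P2b := W11_mbd W2.
have X1b := W11_mbd WX1; have X2b := W11_mbd WX2.
set M1 := C1 + D1 *m Phi1 1 in U1 *; set M2 := C2 + D2 *m Phi2 1 in U2 *.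
pose K1 := - (invmx M1 *m D1 *m Phi1 1); pose K2 := - (invmx M2 *m D2 *m Phi2 1).
have TE u : T u = L2class (bvp_solution B Phi1 Psi1 K1 u) -
    L2class (bvp_solution B Phi2 Psi2 K2 u).
  by congr (_ - _); [exact: resolventE R1 _|exact: resolventE R2 _].
have bT : bounded_op dot T.
  have [b1 _] := R1; have [b2 _] := R2.
  have [N1 _ h1] := bounded_op_hn b1; have [N2 _ h2] := bounded_op_hn b2.
  apply: bounded_opP.
    exact: linear_sub_fun b1.1 b2.1.
  exists (N1 + N2) => u; rewrite mulrDl; apply: le_trans (hnD _ _ _) _.
  by rewrite hnN; apply: lerD; [exact: h1|exact: h2].
have [S1 hS1] := choice (bvp_solution_adjoint B P1b X1b K1).
have [S2 hS2] := choice (bvp_solution_adjoint B P2b X2b K2).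
have TS u v : dot (T u) v = dot u (S1 v - S2 v).
  by rewrite TE dotBl dotBr; congr (_ - _); [exact: hS1|exact: hS2].
apply: (nuclear_form_trace_class (@L2_complete R n) bT TS).
have addB_split (a b c d e f : L2 R n) : a = b + c -> d = e + f ->
    a - d = b - e + (c - f).
  by move=> -> ->; rewrite opprD addrACA.
have Tsplit u := etrans (TE u) (addB_split _ _ _ _ _ _
  (bvp_solution_split B P1b X1b K1 u) (bvp_solution_split B P2b X2b K2 u)).
have nV := nuclear_volterra_form Q1i Q2i W1 W2 WX1 WX2 XP1 XP2.
have n1 := nuclear_boundary_form B P1b X1b K1.
(* The minus sign is put into the matrix, as nuclear forms are only combined by addition. *)
have n2 := nuclear_boundary_form B P2b X2b (- K2).
have := nuclear_formD nV (nuclear_formD n1 n2).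
rewrite (_ : 0 + _ = \tr (mxintegral I01 (fun x =>
    (Phi1 x *m invmx M1 *m C1 *m invmx (Phi1 x)
     - Phi2 x *m invmx M2 *m C2 *m invmx (Phi2 x)) *m iB))).
  apply: nuclear_form_ext => u v.
  rewrite Tsplit [RHS]dotDl; congr (_ + _).
  rewrite [RHS]dotBl; congr (_ + _); first exact/esym/dot_Phi_cst.
  rewrite mulNmx mulmxN mxE; congr (- _); exact/esym/dot_Phi_cst.
have L (F X : R -> 'M[C]_n) (K : 'M[C]_n) : mxmbd F -> mxmbd X -> mxLfun 1 (fun x => F x *m K *m X x *m iB).
  move=> Fb Xb; exact: mxmbd_L1 (mxmbd_mulmx (mxmbd_mulmx (mxmbd_mulmx Fb
    (mxmbd_cst K)) Xb) (mxmbd_cst iB)).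
rewrite add0r -mxtraceD -(mxprimD I01_1 (L _ _ K1 P1b X1b) (L _ _ (- K2) P2b X2b)).
congr mxtrace; apply: eq_mxprim => [|x x01]; first exact: I01_1.
have -> : Phi2 x *m (- K2) *m Psi2 x *m iB = - (Phi2 x *m K2 *m Psi2 x *m iB).
  by rewrite mulmxN !mulNmx.
rewrite (boundary_trace_integrand (erefl M1) U1 (XP1 x x01)).
rewrite (boundary_trace_integrand (erefl M2) U2 (XP2 x x01)).
by rewrite opprB addrA subrK mulmxBl.
Qed.

End ResolventDifference.

Theorem theorem6p3 (R : realType) (n : nat) (b : 'rV[R[i]]_n)
    (Q1 Q2 : R -> 'M[R[i]]_n) (C1 D1 C2 D2 : 'M[R[i]]_n)
    (n_gt0 : (0 < n)%N)
    (B_unit : diag_mx b \in unitmx)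
    (Q1_L1 : mxLfun 1%:E Q1) (Q2_L1 : mxLfun 1%:E Q2)
    (rank1 : \rank (row_mx C1 D1) = n) (rank2 : \rank (row_mx C2 D2) = n)
    (lambda : R[i])
    (rho1 : resolvent_set (@L2dot R n) (bvp_op (diag_mx b) Q1 C1 D1) lambda)
    (rho2 : resolvent_set (@L2dot R n) (bvp_op (diag_mx b) Q2 C2 D2) lambda) :
  let T := resolvent (@L2dot R n) (bvp_op (diag_mx b) Q1 C1 D1) lambda
        \- resolvent (@L2dot R n) (bvp_op (diag_mx b) Q2 C2 D2) lambda in
  trace_class (@L2dot R n) T /\
  forall Phi1 Phi2 : R -> 'M[R[i]]_n,
    fundamental_solution (diag_mx b) Q1 lambda Phi1 ->
    fundamental_solution (diag_mx b) Q2 lambda Phi2 ->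
    has_trace (@L2dot R n) T
      (\tr (mxintegral (I01 R) (fun x =>
        (Phi1 x *m invmx (C1 + D1 *m Phi1 1) *m C1 *m invmx (Phi1 x)
         - Phi2 x *m invmx (C2 + D2 *m Phi2 1) *m C2 *m invmx (Phi2 x))
        *m ('i%C *: diag_mx b)))).
Proof.
move=> T; split.
  (* The trace class claim comes without fundamental matrices, so they are constructed here. *)
  have [F1 W1 F10] := linear_ode (ode_coef_L1 (diag_mx b) lambda Q1_L1).
  have [F2 W2 F20] := linear_ode (ode_coef_L1 (diag_mx b) lambda Q2_L1).
  by have [] := resolvent_difference_nuclear B_unit Q1_L1 Q2_L1 W1 F10 W2 F20 rho1 rho2.
move=> Phi1 Phi2 /(fundamental_solution_W11 B_unit Q1_L1) [W1 F10].
move=> /(fundamental_solution_W11 B_unit Q2_L1) [W2 F20].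
by have [] := resolvent_difference_nuclear B_unit Q1_L1 Q2_L1 W1 F10 W2 F20 rho1 rho2.
Qed.
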